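(* Let $\mu,\chi>0$, $\gamma,\kappa\ge0$, let $(u_0,w_0)\in L^2_\sigma(\mathbb{R}^3)\times L^2(\mathbb{R}^3)$, and let $(u_L,w_L)$ be the solution of the linear micropolar system with initial data $(u_0,w_0)$. Set $$\Omega_L=\operatorname{curl}u_L,\qquad h_L=\mathbb{P}w_L,\qquad \mathcal{E}_L=h_L-\tfrac12\Omega_L,\qquad a=\frac{\gamma\chi+\mu\chi+2\mu\gamma}{4\chi^2}.$$ Then the following enstrophy identity holds for $t>0$: $$\frac12\frac{d}{dt}\Big(\|\mathcal{E}_L\|_{L^2}^2+a\|\Omega_L\|_{L^2}^2\Big)+4\chi\|\mathcal{E}_L\|_{L^2}^2+(\gamma+\chi)\Big\|\nabla\mathcal{E}_L-\frac{\mu}{2\chi}\nabla\Omega_L\Big\|_{L^2}^2+\frac{\mu\gamma}{4\chi^2}(\mu+\chi)\|\nabla\Omega_L\|_{L^2}^2=0.$$ Moreover, as $t\to+\infty$, $$\|\mathcal{E}_L(t)\|_{L^2}^2=o(t^{-1}),\qquad\|\Omega_L(t)\|_{L^2}^2=o(t^{-1}),\qquad\|h_L(t)\|_{L^2}^2=o(t^{-1}).$$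
   Context: $L^2_\sigma(\mathbb{R}^3)$: $\mathbb{R}^3$-valued $L^2$ fields that are divergence free in the sense of distributions. $\mathbb{P}$: $L^2$-orthogonal projector onto divergence-free fields. Linear micropolar system on $\mathbb{R}^3$, $t>0$: $$\partial_t u_L=(\mu+\chi)\Delta u_L+2\chi\operatorname{curl} w_L,\quad \partial_t w_L=\gamma\Delta w_L+\kappa\nabla(\operatorname{div} w_L)+2\chi\operatorname{curl}u_L-4\chi w_L,\quad \operatorname{div}u_L=0,$$ with $(u_L,w_L)|_{t=0}=(u_0,w_0)$; its solution is the unique $L^2$ solution obtained by solving the corresponding linear ODE system in Fourier variables. In the identity, a term with zero coefficient (the last one when $\gamma=0$) is omitted. *)

(* Defs.v *)
From HB Require Import structures.
From mathcomp Require Import all_boot all_order all_algebra.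
From mathcomp Require Import all_classical all_reals all_analysis.
From mathcomp Require Import complex.
Set Implicit Arguments.
Unset Strict Implicit.
Unset Printing Implicit Defensive.
Import Order.TTheory GRing.Theory Num.Theory.
Import numFieldNormedType.Exports.

Local Open Scope classical_set_scope.
Local Open Scope ring_scope.

(* R^3 is the product R * R * R, so that the library's product topology,
   sigma-algebra and product measure apply. *)
Notation R3 R := (R * R * R)%type.
Notation vfield R := ('I_3 -> R3 R -> R).

Notation leb3 :=
  ((lebesgue_measure \x lebesgue_measure) \x lebesgue_measure)%E.

(* Functionals on test functions; only their values on C_c^oo are ever used. *)
Notation distr R := ((R3 R -> R) -> R).

Section micropolar.
Context {R : realType}.
Implicit Types (x xi : R3 R) (f g phi : R3 R -> R) (v w h : vfield R).
Implicit Types (T : distr R) (V : 'I_3 -> distr R).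

Definition crd x (i : 'I_3) : R := tnth [tuple x.1.1; x.1.2; x.2] i.

Definition bvec (i : 'I_3) : R3 R :=
  ((i == 0 :> 'I_3)%:R, (i == 1 :> 'I_3)%:R, (i == 2 :> 'I_3)%:R).

Definition dot x xi : R := \sum_i crd x i * crd xi i.

Definition iter_partial (s : seq 'I_3) phi : R3 R -> R :=
  foldr (fun i f => 'D_(bvec i) f) phi s.

(* C_c^oo(R^3): all iterated partial derivatives exist and are continuous. *)
Definition test_function phi : Prop :=
  (forall s : seq 'I_3, continuous (iter_partial s phi) /\
     forall x i, derivable (iter_partial s phi) x (bvec i)) /\
  (exists M : R, forall x, M < `|x| -> phi x = 0).

Definition dist_of f : distr R := fun phi => \int[leb3]_x (f x * phi x).

Definition vdist_of v : 'I_3 -> distr R := fun i => dist_of (v i).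

Definition dpartial (i : 'I_3) T : distr R := fun phi => - T ('D_(bvec i) phi).

Definition ddiv V : distr R := \sum_i dpartial i (V i).

(* Indices are added modulo 3 in 'I_3. *)
Definition dcurl V : 'I_3 -> distr R := fun i =>
  dpartial (i + 1) (V (i + 2)) - dpartial (i + 2) (V (i + 1)).

Definition dgrad V : 'I_3 -> 'I_3 -> distr R := fun i j => dpartial i (V j).

Definition L2 v : Prop := forall i, v i \in Lfun leb3 2%:E.

Definition sqL2 f : \bar R := \int[leb3]_x ((f x) ^+ 2)%:E.

(* Squared L^2 norm of a distribution.  The L^2 function representing T is
   unique almost everywhere if it exists, so the infimum is its squared norm;
   it is +oo if T is not given by an L^2 function, and since 0 * +oo = 0 in
   \bar R a term with zero coefficient then drops out of a sum. *)
Definition dist_sqL2 T : \bar R :=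
  ereal_inf [set sqL2 g | g in [set g | g \in Lfun leb3 2%:E /\
    forall phi, test_function phi -> T phi = dist_of g phi]].

Definition vsqL2 v : \bar R := (\sum_i sqL2 (v i))%E.

Definition vdist_sqL2 V : \bar R := (\sum_i dist_sqL2 (V i))%E.

Definition tdist_sqL2 (G : 'I_3 -> 'I_3 -> distr R) : \bar R :=
  (\sum_i \sum_j dist_sqL2 (G i j))%E.

Definition L2sigma v : Prop :=
  L2 v /\ forall phi, test_function phi -> ddiv (vdist_of v) phi = 0.

(* h is the orthogonal projection of the L^2 field w onto L2sigma. *)
Definition leray_projection w h : Prop :=
  L2sigma h /\
  forall v, L2sigma v -> \sum_i \int[leb3]_x ((w i x - h i x) * v i x) = 0.

(* The integral of f(x) exp(- i x.xi) over the cube [-n, n]^3; the norm of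
   R * R * R is the sup norm. *)
Definition trunc_fourier f (n : nat) xi : R[i] :=
  let Q := [set x : R3 R | `|x| <= n%:R] in
  Complex (\int[leb3]_(x in Q) (f x * cos (dot x xi)))
          (- \int[leb3]_(x in Q) (f x * sin (dot x xi))).

(* F is the L^2 Fourier transform of f, obtained as the limit in L^2 of the
   Fourier transforms of the truncations of f. *)
Definition is_fourier f (F : R3 R -> R[i]) : Prop :=
  [/\ f \in Lfun leb3 2%:E,
      (fun xi => complex.Re (F xi)) \in Lfun leb3 2%:E,
      (fun xi => complex.Im (F xi)) \in Lfun leb3 2%:E &
      (sqL2 (fun xi => complex.Re (F xi - trunc_fourier f n xi)%R) +
       sqL2 (fun xi => complex.Im (F xi - trunc_fourier f n xi)%R))%E
        @[n --> \oo] --> 0%E].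

Definition is_vfourier v (F : R3 R -> 'I_3 -> R[i]) : Prop :=
  forall i, is_fourier (v i) (F ^~ i).

Definition cvg_at_right0 (z : R -> R[i]) : Prop :=
  complex.Re (z t) @[t --> 0^'+] --> complex.Re (z 0) /\
  complex.Im (z t) @[t --> 0^'+] --> complex.Im (z 0).

Definition is_cderive (z : R -> R[i]) (t : R) (dz : R[i]) : Prop :=
  is_derive t 1 (fun s => complex.Re (z s)) (complex.Re dz) /\
  is_derive t 1 (fun s => complex.Im (z s)) (complex.Im dz).

(* The Fourier symbols of div and curl. *)
Definition fdiv xi (Z : 'I_3 -> R[i]) : R[i] :=
  'i%C * \sum_j (crd xi j)%:C%C * Z j.

Definition fcurl xi (Z : 'I_3 -> R[i]) : 'I_3 -> R[i] := fun i =>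
  'i%C * ((crd xi (i + 1))%:C%C * Z (i + 2)
          - (crd xi (i + 2))%:C%C * Z (i + 1)).

(* (u, w) solves the system iff, for almost every frequency xi, its Fourier
   transform (U, W) solves the corresponding linear ODE in time; the initial
   data are attained by continuity at t = 0. *)
Definition micropolar_solution (mu chi gamma kappa : R) (u0 w0 : vfield R)
    (u w : R -> vfield R) : Prop :=
  exists U W : R -> R3 R -> 'I_3 -> R[i],
  [/\ is_vfourier u0 (U 0) /\ is_vfourier w0 (W 0),
      forall t, 0 < t -> is_vfourier (u t) (U t) /\ is_vfourier (w t) (W t),
      {ae leb3, forall xi i,
        cvg_at_right0 (fun t => U t xi i) /\ cvg_at_right0 (fun t => W t xi i)} &
      {ae leb3, forall xi (t : R), 0 < t ->
        [/\ forall i, is_cderive (fun s => U s xi i) t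
              (- ((mu + chi) * dot xi xi)%:C%C * U t xi i
               + (2 * chi)%:C%C * fcurl xi (W t xi) i),
            forall i, is_cderive (fun s => W s xi i) t
              (- (gamma * dot xi xi)%:C%C * W t xi i
               + kappa%:C%C * ('i%C * (crd xi i)%:C%C * fdiv xi (W t xi))
               + (2 * chi)%:C%C * fcurl xi (U t xi) i
               - (4 * chi)%:C%C * W t xi i) &
            fdiv xi (U t xi) = 0]}].

(* The filter t --> +oo, packaged for the Landau notations. *)
Definition at_infty : filter_on R := FilterType (pinfty_nbhs R) _.

End micropolar.

(* Main.v *)
(* The Hartley transform, whose kernel cas(x.xi) = cos(x.xi) + sin(x.xi) is real
   and symmetric, is isometric on L^2 up to a constant c, hence an involution up
   to c; it replaces the Fourier transform. Many distributions T occurring here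
   have a symbol m, in the sense that T phi = c^-1 * int m (H phi); the transforms
   of test functions separate symbols, so m determines T and the squared L^2 norm
   of T is c^-1 * int m^2. The Leray projection acts on symbols as the pointwise
   projection orthogonal to xi.

   At almost every xi the symbols of (u, w) solve a linear system X' = F X with F
   symmetric and nonpositive, and the enstrophy balance is a pointwise identity.
   Since F is symmetric, the energy e = |X|^2, the dissipation p = -e' and the
   quantity q = -p' = 4|FX|^2 are nonnegative and nonincreasing, so that
   (t - T) p(t) <= e(T) - e(t) and q(t) <= 4 e(T) / (t - T)^2. These bounds justify
   differentiation under the integral sign. As p controls the enstrophy density
   and the integral of e converges at infinity, they also give the o(1/t) decay. *)
Require Import Defs.
From HB Require Import structures.
From mathcomp Require Import all_boot all_order all_algebra.
From mathcomp Require Import all_classical all_reals all_analysis.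
From mathcomp Require Import measurable_realfun lebesgue_integral_under.
From mathcomp Require Import complex ring lra.
Set Implicit Arguments.
Unset Strict Implicit.
Unset Printing Implicit Defensive.
Import Order.TTheory GRing.Theory Num.Theory.
Import numFieldNormedType.Exports.

Local Open Scope classical_set_scope.
Local Open Scope ring_scope.

(** * Square-integrable functions *)

(** The isometry is the one property of the transform that needs an explicit computation. It is
    checked on indicators of boxes and extended by density. The kernel cas does not factor over a
    product of spaces, but the pair (cos, sin) does, by the addition formulas; so the passage from
    the line to the space carries the pair, together with the orthogonality of cosine and sine
    transforms. On the line all rests on int (1 - cos(a x)) / x^2 dx = k |a|, which is a matter of
    scaling; k = pi is never evaluated, only k > 0 matters.

    The price of a real kernel is that the transform of a derivative is evaluated at -xi.
    Reflections therefore run through the symbols; for the curl they cancel, since the velocity is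
    transformed at -xi.

    For data in L^2 the estimates degenerate at t = 0, so each of them compares a time t with an
    earlier positive time. Let O be the symbol of the vorticity. The dissipation controls |O|^2 but
    not |xi|^2 |O|^2, which the enstrophy balance contains when gamma > 0; the missing weight is
    recovered from the time derivatives of both unknowns, that is from q. When gamma = 0 the term is
    absent. *)

Section square_integrable.
Context d (T : measurableType d) (R : realType).
Variable mu : {measure set T -> \bar R}.
Implicit Types f g h : T -> R.

Definition sqint f := measurable_fun setT f /\
  mu.-integrable setT (fun x => (f x ^+ 2)%:E).

(** An infinite integral counts as 0 here, so bilinearity of [ip] is available under [sqint]
    hypotheses. *)
Definition ip f g : R := \int[mu]_x (f x * g x).

(** The bridge from the L^2 membership of the statement to [sqint], a condition on functions that
    combines well with pointwise bounds. *)
Lemma Lfun2P f : (f \in Lfun mu 2%:E) <-> sqint f.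
Proof.
split=> [f2|[mf f2]].
  split; last exact: (Lfun2_integrable_sqr f2).
  by move: f2; rewrite inE => /andP[+ _]; rewrite inE.
apply/andP; split; rewrite inE//= /finite_norm.
rewrite unlock /Lnorm; rewrite poweR_lty//.
case/integrableP : f2 => _; apply: le_lt_trans; rewrite le_eqVlt; apply/orP; left.
apply/eqP/eq_integral => x _ /=.
by rewrite powR_mulrn// normrX.
Qed.

Lemma le_integrable_EFin f g : measurable_fun setT f ->
  (forall x, `|f x| <= g x) -> mu.-integrable setT (EFin \o g) ->
  mu.-integrable setT (EFin \o f).
Proof.
move=> mf fg ig; apply: (le_integrable _ _ _ ig) => //.
  exact/measurable_EFinP.
by move=> x _ /=; rewrite lee_fin (le_trans (fg x))// ler_norm.
Qed.

Lemma sqint_le f g : measurable_fun setT f -> (forall x, `|f x| <= `|g x|) ->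
  sqint g -> sqint f.
Proof.
move=> mf fg [mg ig]; split=> //.
apply: (le_integrable_EFin _ _ ig); first exact: measurable_funX.
move=> x; rewrite ger0_norm ?sqr_ge0//.
by rewrite -[f x ^+ 2]real_normK ?num_real// -[g x ^+ 2]real_normK ?num_real// ler_pXn2r// nnegrE.
Qed.

Lemma integrable_EFinD f g : mu.-integrable setT (EFin \o f) ->
  mu.-integrable setT (EFin \o g) -> mu.-integrable setT (EFin \o (f \+ g)).
Proof. by move=> fi gi; rewrite (_ : _ \o _ = (EFin \o f) \+ (EFin \o g))%E//; exact: integrableD. Qed.

Lemma integrable_EFinB f g : mu.-integrable setT (EFin \o f) ->
  mu.-integrable setT (EFin \o g) -> mu.-integrable setT (EFin \o (f \- g)).
Proof. by move=> fi gi; rewrite (_ : _ \o _ = (EFin \o f) \- (EFin \o g))%E//; exact: integrableB. Qed.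

Lemma integrable_EFinZ k f : mu.-integrable setT (EFin \o f) ->
  mu.-integrable setT (EFin \o (fun x => k * f x)).
Proof. by move=> fi; rewrite (_ : _ \o _ = fun x => k%:E * (f x)%:E)%E//; exact: integrableZl. Qed.

Lemma integrable_sqintM f g : sqint f -> sqint g ->
  mu.-integrable setT (EFin \o (f \* g)).
Proof.
move=> [mf fi] [mg gi]; have := integrable_EFinD fi gi; apply: le_integrable_EFin.
  exact: measurable_funM.
move=> x /=; rewrite ler_norml; apply/andP; split; nra.
Qed.

Lemma sqint0 : sqint (fun=> 0).
Proof.
split; first exact: measurable_cst.
by under eq_fun do rewrite expr0n/=; exact: integrable0.
Qed.

Lemma sqintZ k f : sqint f -> sqint (fun x => k * f x).
Proof.
move=> [mf fi]; split; first exact: measurable_funM.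
have := integrable_EFinZ (k ^+ 2) fi; apply: eq_integrable => // x _ /=.
by rewrite exprMn.
Qed.

Lemma sqintD f g : sqint f -> sqint g -> sqint (f \+ g).
Proof.
move=> [mf fi] [mg gi]; split; first exact: measurable_funD.
have := integrable_EFinZ 2 (integrable_EFinD fi gi).
apply: le_integrable_EFin; first by apply: measurable_funX; exact: measurable_funD.
move=> x /=; rewrite ger0_norm ?sqr_ge0//; have := sqr_ge0 (f x - g x); nra.
Qed.

Lemma sqintN f : sqint f -> sqint (\- f).
Proof. by move=> /(sqintZ (-1)); congr sqint; apply/funext => x /=; rewrite mulN1r. Qed.

Lemma sqintB f g : sqint f -> sqint g -> sqint (f \- g).
Proof. by move=> hf /sqintN; exact: sqintD. Qed.

Lemma ipC f g : ip f g = ip g f.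
Proof. by rewrite /ip; apply: eq_Rintegral => x _; rewrite mulrC. Qed.

Lemma ipDl f g h : sqint f -> sqint g -> sqint h -> ip (f \+ g) h = ip f h + ip g h.
Proof.
move=> hf hg hh; rewrite /ip -RintegralD//; last 2 first.
- exact: integrable_sqintM hf hh.
- exact: integrable_sqintM hg hh.
by apply: eq_Rintegral => x _ /=; rewrite mulrDl.
Qed.

Lemma ipZl k f g : sqint f -> sqint g -> ip (fun x => k * f x) g = k * ip f g.
Proof.
move=> hf hg; rewrite /ip -RintegralZl//; last exact: integrable_sqintM hf hg.
by apply: eq_Rintegral => x _ /=; rewrite mulrA.
Qed.

Lemma ipBl f g h : sqint f -> sqint g -> sqint h -> ip (f \- g) h = ip f h - ip g h.
Proof.
move=> hf hg hh; rewrite /ip -RintegralB//; last 2 first.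
- exact: integrable_sqintM hf hh.
- exact: integrable_sqintM hg hh.
by apply: eq_Rintegral => x _ /=; rewrite mulrBl.
Qed.

Lemma ipDr f g h : sqint f -> sqint g -> sqint h -> ip h (f \+ g) = ip h f + ip h g.
Proof. by move=> *; rewrite ipC ipDl// !(ipC h). Qed.

Lemma ipBr f g h : sqint f -> sqint g -> sqint h -> ip h (f \- g) = ip h f - ip h g.
Proof. by move=> *; rewrite ipC ipBl// !(ipC h). Qed.

Lemma ipZr k f g : sqint f -> sqint g -> ip g (fun x => k * f x) = k * ip g f.
Proof. by move=> *; rewrite ipC ipZl// ipC. Qed.

Lemma ip_ge0 f : 0 <= ip f f.
Proof. by apply: Rintegral_ge0 => x _; rewrite -expr2 sqr_ge0. Qed.

Lemma integral_sqr f : sqint f -> (\int[mu]_x ((f x) ^+ 2)%:E = (ip f f)%:E)%E.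
Proof.
move=> hf; rewrite /ip /Rintegral fineK.
  by apply: eq_integral => x _; rewrite expr2.
exact: integrable_fin_num (integrable_sqintM hf hf).
Qed.

Lemma sqint_lty f : measurable_fun setT f ->
  (\int[mu]_x ((f x) ^+ 2)%:E < +oo)%E -> sqint f.
Proof.
move=> mf fi; split=> //; apply/integrableP; split.
  by apply/measurable_EFinP; exact: measurable_funX.
by under eq_integral => x _ do rewrite gee0_abs ?lee_fin ?sqr_ge0//.
Qed.

Lemma sqint_bound f (M : R) : measurable_fun setT f ->
  (\int[mu]_x ((f x) ^+ 2)%:E <= M%:E)%E -> sqint f /\ ip f f <= M.
Proof.
move=> mf fM; have hf : sqint f by apply: sqint_lty => //; rewrite (le_lt_trans fM)// ltry.
by split=> //; rewrite -lee_fin -integral_sqr.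
Qed.

Lemma ip_eq0 f : sqint f -> ip f f = 0 -> {ae mu, forall x, f x = 0}.
Proof.
move=> hf f0; have [mf _] := hf.
have := integral_sqr hf; rewrite f0.
have mf2 : measurable_fun setT (fun x => ((f x) ^+ 2)%:E : \bar R).
  by apply/measurable_EFinP; exact: measurable_funX.
move=> i0.
have /(ae_eq_integral_abs mu measurableT mf2) : (\int[mu]_x `|((f x) ^+ 2)%:E| = 0)%E.
  by rewrite -[RHS]i0; apply: eq_integral => x _; rewrite gee0_abs ?lee_fin ?sqr_ge0.
apply: filterS => x /= /(_ I) /eqP.
by rewrite eqe expf_eq0/= => /eqP.
Qed.

Lemma ae_eq_ip f f' g : measurable_fun setT f -> measurable_fun setT f' ->
  measurable_fun setT g ->
  {ae mu, forall x, f x = f' x} -> ip f g = ip f' g.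
Proof.
move=> mf mf' mg ff'; rewrite /ip /Rintegral; congr fine.
apply: ae_eq_integral => //.
- by apply/measurable_EFinP; exact: measurable_funM.
- by apply/measurable_EFinP; exact: measurable_funM.
- by apply: filterS ff' => x /= -> _.
Qed.

Lemma sqint_ae f f' : measurable_fun setT f' ->
  {ae mu, forall x, f x = f' x} -> sqint f -> sqint f'.
Proof.
move=> mf' ff' hf; apply: sqint_lty => //.
rewrite (ae_eq_integral (fun x => ((f x) ^+ 2)%:E))//.
- by rewrite integral_sqr// ltry.
- by apply/measurable_EFinP; exact: measurable_funX.
- by apply/measurable_EFinP; apply: measurable_funX; case: hf.
- by apply: filterS ff' => x /= -> _.
Qed.

(** The polynomial t -> |f + t g|^2 is nonnegative; the degenerate case |g| = 0 is treated apart. *)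
Lemma cauchy_schwarz f g : sqint f -> sqint g -> ip f g ^+ 2 <= ip f f * ip g g.
Proof.
move=> hf hg.
have pol (t : R) : 0 <= ip f f + 2 * t * ip f g + t ^+ 2 * ip g g.
  have htg := sqintZ t hg.
  have := ip_ge0 (f \+ (fun x => t * g x)).
  have hs := sqintD hf htg.
  rewrite ipDl// !ipDr// !ipZl// !ipZr// (ipC g f); lra.
have f0 := ip_ge0 f; have g0 := ip_ge0 g.
have [gg0|gg0] := eqVneq (ip g g) 0.
  rewrite gg0 mulr0.
  have [->|fg0] := eqVneq (ip f g) 0; first by rewrite expr0n.
  (* The polynomial is now affine in t with nonzero slope, and this t gives it the value -1. *)
  have := pol (- (ip f f + 1) / (2 * ip f g)).
  rewrite gg0 mulr0 addr0.
  have -> : 2 * (- (ip f f + 1) / (2 * ip f g)) * ip f g = - (ip f f + 1).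
    by field.
  lra.
(* The minimum of the quadratic polynomial. *)
have := pol (- (ip f g / ip g g)).
have -> : ip f f + 2 * - (ip f g / ip g g) * ip f g + (- (ip f g / ip g g)) ^+ 2 * ip g g
   = ip f f - (ip f g) ^+ 2 / ip g g by field.
by rewrite subr_ge0 ler_pdivrMr// lt_neqAle eq_sym gg0.
Qed.

Lemma ip_sqrD f g : sqint f -> sqint g ->
  ip (f \+ g) (f \+ g) <= 2 * ip f f + 2 * ip g g.
Proof.
move=> hf hg; have := ip_ge0 (f \- g).
have hD := sqintD hf hg; have hB := sqintB hf hg.
rewrite ipBl// !ipBr// ipDl// !ipDr// (ipC g f); lra.
Qed.

Lemma ip_sqr_triangle f g h : sqint f -> sqint g -> sqint h ->
  ip (f \- h) (f \- h) <= 2 * ip (f \- g) (f \- g) + 2 * ip (g \- h) (g \- h).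
Proof.
move=> hf hg hh; have := ip_sqrD (sqintB hf hg) (sqintB hg hh).
by congr (_ <= _); congr ip; apply/funext => x /=; rewrite addrA subrK.
Qed.

Lemma ip_sqrBC f g : ip (f \- g) (f \- g) = ip (g \- f) (g \- f).
Proof. by apply: eq_Rintegral => x _ /=; rewrite -mulrNN !opprB. Qed.

Definition cvgL2 (f_ : nat -> T -> R) f := ip (f_ n \- f) (f_ n \- f) @[n --> \oo] --> 0.

Lemma cvgL2_ipl (f_ : nat -> T -> R) f g : (forall n, sqint (f_ n)) -> sqint f -> sqint g ->
  cvgL2 f_ f -> ip (f_ n) g @[n --> \oo] --> ip f g.
Proof.
move=> hf_ hf hg fc.
apply/cvgrPdist_le => e e0.
have : (ip g g) * ip (f_ n \- f) (f_ n \- f) @[n --> \oo] --> (0:R).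
  by rewrite -[X in _ --> X](mulr0 (ip g g)); apply: cvgM fc; exact: cvg_cst.
move/cvgrPdist_le => /(_ (e ^+ 2)); rewrite exprn_gt0// => /(_ isT).
apply: filterS => n; rewrite sub0r normrN => le2.
have := cauchy_schwarz (sqintB (hf_ n) hf) hg.
rewrite mulrC => cs; have := le_trans cs (le_trans (ler_norm _) le2).
rewrite ipBl// -[X in X <= _]real_normK ?num_real// distrC.
by rewrite ler_pXn2r// nnegrE// ltW.
Qed.

Lemma cvgL2_norm (f_ : nat -> T -> R) f : (forall n, sqint (f_ n)) -> sqint f ->
  cvgL2 f_ f -> ip (f_ n) (f_ n) @[n --> \oo] --> ip f f.
Proof.
move=> hf_ hf fc.
rewrite (_ : (fun n => _) = (fun n => ip (f_ n \- f) (f_ n \- f) + 2 * ip (f_ n) f - ip f f)).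
  rewrite [X in _ --> X](_ : _ = 0 + 2 * ip f f - ip f f); last lra.
  apply: cvgB; last exact: cvg_cst.
  apply: (cvgD fc); apply: cvgM; first exact: cvg_cst.
  exact: (cvgL2_ipl hf_ hf hf fc).
apply/funext => n; have h := sqintB (hf_ n) hf.
rewrite ipBl// !ipBr// (ipC f (f_ n)); lra.
Qed.

(** Polarization reduces the claim to convergence of the norms of [f_], [g_] and their sum. *)
Lemma cvgL2_ip (f_ : nat -> T -> R) f (g_ : nat -> T -> R) g : (forall n, sqint (f_ n)) -> sqint f ->
  (forall n, sqint (g_ n)) -> sqint g ->
  cvgL2 f_ f -> cvgL2 g_ g -> ip (f_ n) (g_ n) @[n --> \oo] --> ip f g.
Proof.
move=> hf_ hf hg_ hg fc gc.
have hs n : sqint (f_ n \+ g_ n) by exact: sqintD.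
have hsl : sqint (f \+ g) by exact: sqintD.
have sc : cvgL2 (fun n => f_ n \+ g_ n) (f \+ g).
  apply: (@squeeze_cvgr _ _ _ _ (cst 0) (fun n => 2 * ip (f_ n \- f) (f_ n \- f) + 2 * ip (g_ n \- g) (g_ n \- g))).
  - apply: nearW => n; rewrite ip_ge0/=.
    rewrite (_ : _ \- _ = (f_ n \- f) \+ (g_ n \- g)).
      by apply: ip_sqrD; exact: sqintB.
    by apply/funext => x /=; ring.
  - exact: cvg_cst.
  - rewrite [X in _ --> X](_ : _ = 2 * 0 + 2 * 0); last lra.
    by apply: cvgD; (apply: cvgM; first exact: cvg_cst).
rewrite (_ : (fun n => _) = (fun n => 2^-1 * (ip (f_ n \+ g_ n) (f_ n \+ g_ n) - ip (f_ n) (f_ n) - ip (g_ n) (g_ n)))).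
  rewrite [X in _ --> X](_ : _ = 2^-1 * (ip (f \+ g) (f \+ g) - ip f f - ip g g)).
    apply: cvgM; first exact: cvg_cst.
    by apply: cvgB; [apply: cvgB|]; exact: cvgL2_norm.
  by rewrite ipDl// !ipDr// (ipC g f); lra.
apply/funext => n.
by rewrite ipDl// !ipDr// (ipC (g_ n) (f_ n)); lra.
Qed.

(** Dominated convergence for the squares, with majorant 4 g^2 because |f_n - f| <= 2 |g|. *)
Lemma cvgL2_dominated (f_ : nat -> T -> R) f g : (forall n, measurable_fun setT (f_ n)) ->
  measurable_fun setT f -> sqint g ->
  (forall n x, `|f_ n x| <= `|g x|) ->
  (forall x, f_ n x @[n --> \oo] --> f x) -> cvgL2 f_ f.
Proof.
move=> mf_ mf hg fg fc.
have fgl x : `|f x| <= `|g x|.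
  apply: (cvgr_to_le (cvg_norm (fc x))).
  by apply: nearW => n; exact: fg.
have h n : sqint (f_ n) by exact: (sqint_le _ _ hg).
have hf : sqint f by exact: (sqint_le _ _ hg).
pose g_ n x := ((f_ n x - f x) ^+ 2)%:E.
have mg_ n : measurable_fun setT (g_ n).
  by apply/measurable_EFinP; apply: measurable_funX; exact: measurable_funB.
have [] := @dominated_convergence _ _ _ mu setT measurableT g_ (fun=> 0%E) (fun x => (4 * g x ^+ 2)%:E) mg_.
- exact: measurable_cst.
- apply: aeW => x _; rewrite /g_; apply: cvg_EFin; first exact: nearW.
  rewrite [X in _ --> X](_ : _ = (f x - f x) ^+ 2); last by rewrite subrr expr0n.
  apply: (cvg_comp (fun n => f_ n x - f x) (fun y => y ^+ 2)); last exact: exprn_continuous.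
  by apply: cvgB => //; exact: cvg_cst.
- by have := integrable_EFinZ 4 hg.2.
- apply: aeW => x n _; rewrite /g_ /= lee_fin ger0_norm ?sqr_ge0//.
  have := fg n x; have := fgl x; move: (f_ n x) (f x) (g x) => u v w H1 H2.
  rewrite -[w ^+ 2]real_normK ?num_real// -[(u - v) ^+ 2]real_normK ?num_real//.
  have : `|u - v| <= 2 * `|w| by rewrite (le_trans (ler_normB _ _))//; lra.
  have := normr_ge0 (u - v); nra.
move=> _ + _.
rewrite /cvgL2 => c0.
rewrite (_ : (fun n => _) = fine \o (fun n => \int[mu]_x `|(g_ n x - 0)%E|)%E).
  exact: (fine_cvg c0).
apply/funext => n /=; rewrite /ip /Rintegral; congr fine; apply: eq_integral => x _.
by rewrite subr0 ger0_norm ?sqr_ge0// expr2.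
Qed.

(** Lets a Cauchy estimate pass to a pointwise limit whose square-integrability is not known
    beforehand. *)
Lemma fatouL2 (f_ : nat -> T -> R) f (M : R) : (forall n, sqint (f_ n)) ->
  (forall x, f_ n x @[n --> \oo] --> f x) ->
  (forall n, ip (f_ n) (f_ n) <= M) -> sqint f /\ ip f f <= M.
Proof.
move=> hf_ fc fM; apply: sqint_bound.
  by apply: (measurable_fun_cvg (fun n => (hf_ n).1)) => x _; exact: fc.
pose g_ n x : \bar R := ((f_ n x) ^+ 2)%:E.
have mg_ n : measurable_fun setT (g_ n).
  by apply/measurable_EFinP; apply: measurable_funX; case: (hf_ n).
have g0 n x : setT x -> (0 <= g_ n x)%E by rewrite lee_fin sqr_ge0.
have := fatou mu measurableT mg_ g0.
rewrite (eq_integral (fun x => (f x ^+ 2)%:E)); last first.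
  move=> x _.
  have : g_ n x @[n --> \oo] --> (f x ^+ 2)%:E.
    apply: cvg_EFin; first exact: nearW.
    exact: (cvg_comp (fun n => f_ n x) (fun y => y ^+ 2) (fc x) (@exprn_continuous _ 2 _)).
  by move/cvg_limn_einf_sup => [->].
move/le_trans; apply.
rewrite (_ : (fun n => _) = (fun n => (ip (f_ n) (f_ n))%:E)); last first.
  by apply/funext => n; rewrite integral_sqr.
rewrite limn_einf_lim; apply: lime_le; first exact: is_cvg_einfs.
apply: nearW => n; apply: (@le_trans _ _ (ip (f_ n) (f_ n))%:E); last by rewrite lee_fin.
by apply: ereal_inf_lbound; exists n => //=.
Qed.

Lemma ip_le f g : measurable_fun setT f -> (forall x, `|f x| <= `|g x|) -> sqint g ->
  ip f f <= ip g g.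
Proof.
move=> mf fg hg; have hf := sqint_le mf fg hg.
apply: le_Rintegral => //; [exact: integrable_sqintM|exact: integrable_sqintM|].
by move=> x _; rewrite -!expr2 -[f x ^+ 2]real_normK ?num_real// -[g x ^+ 2]real_normK ?num_real// ler_pXn2r// nnegrE.
Qed.

(* The weights 4^k force the increments of a fast Cauchy sequence to decay
   geometrically at almost every point. *)
Lemma fast_cauchy_ae (g_ : nat -> T -> R) : (forall n, sqint (g_ n)) ->
  (forall k, ip (g_ k.+1 \- g_ k) (g_ k.+1 \- g_ k) <= 8^-1 ^+ k) ->
  {ae mu, forall x, cvgn (g_ ^~ x)}.
Proof.
move=> hg gc.
pose u k x : \bar R := ((4 ^+ k) * (g_ k.+1 x - g_ k x) ^+ 2)%:E.
have mu_ k : measurable_fun setT (u k).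
  apply/measurable_EFinP; apply: measurable_funM => //; apply: measurable_funX.
  by apply: measurable_funB; [case: (hg k.+1)|case: (hg k)].
have u0 k x : setT x -> (0 <= u k x)%E by move=> _; rewrite /u lee_fin; apply: mulr_ge0; [exact: exprn_ge0|exact: sqr_ge0].
have iu : (\int[mu]_x (\sum_(k <oo) u k x) < +oo)%E.
  rewrite integral_nneseries//.
  apply: (@le_lt_trans _ _ (\sum_(k <oo) (2^-1 ^+ k)%:E)%E).
    apply: lee_nneseries => k _; first by move=> _; apply: integral_ge0 => x _; exact: u0.
    rewrite /u; under eq_integral do rewrite EFinM.
    rewrite ge0_integralZl//; last 2 first.
    - by apply/measurable_EFinP; apply: measurable_funX; apply: measurable_funB; [case: (hg k.+1)|case: (hg k)].
    - by move=> x _; rewrite lee_fin sqr_ge0.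
    rewrite (integral_sqr (sqintB (hg k.+1) (hg k))) -EFinM lee_fin.
    apply: (@le_trans _ _ (4 ^+ k * 8^-1 ^+ k)).
      by rewrite ler_wpM2l ?exprn_ge0.
    by rewrite -exprMn (_ : 4 * 8^-1 = 2^-1 :> R)//; lra.
  have -> : (\sum_(k <oo) (2^-1 ^+ k)%:E = 2%:E :> \bar R)%E.
    apply/cvg_lim => //.
    have := @cvg_geometric_series R 1 2^-1.
    have q1 : `|2^-1 : R| < 1 by rewrite ger0_norm//; lra.
    move=> /(_ q1); rewrite (_ : 1 - 2^-1 = 2^-1 :> R); last lra.
    rewrite invrK mul1r => c; rewrite (_ : (fun n => _) = (fun n => (series (geometric 1 2^-1) n)%:E)).
      by apply: cvg_EFin => //; exact: nearW.
    apply/funext => n; rewrite /series/= sumEFin; congr EFin.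
    by apply: eq_bigr => i _; rewrite mul1r.
  by rewrite ltry.
have imu : mu.-integrable setT (fun x => \sum_(k <oo) u k x)%E.
  apply/integrableP; split.
    by apply: ge0_emeasurable_sum => // k x _ _; exact: u0.
  rewrite (eq_integral (fun x => \sum_(k <oo) u k x)%E)// => x _.
  by rewrite gee0_abs//; apply: nneseries_ge0 => k _ _; exact: u0.
have := integrable_ae measurableT imu; apply: filterS => x /(_ I) xfin.
have [C C0 uC] : exists2 C : R, 0 <= C & forall k, 4 ^+ k * (g_ k.+1 x - g_ k x) ^+ 2 <= C.
  exists (fine (\sum_(k <oo) u k x)%E); first by apply: fine_ge0; apply: nneseries_ge0 => k _ _; exact: u0.
  move=> k; rewrite -lee_fin fineK// -/(u k x).
  apply: (@le_trans _ _ (\sum_(0 <= j < k.+1) u j x)%E).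
    rewrite big_nat_recr//= leeDr//; apply: sume_ge0 => j _; exact: u0.
  by apply: nneseries_lim_ge => n _ _; exact: u0.
(* The increments d_k satisfy 4^k d_k^2 <= C, hence |d_k| <= D 2^-k, and the telescoping series
   converges. *)
pose D := Num.sqrt C.
have dD k : `|g_ k.+1 x - g_ k x| <= D * 2^-1 ^+ k.
  rewrite -(@ler_pXn2r _ 2)// ?nnegrE// ?mulr_ge0 ?sqrtr_ge0 ?exprn_ge0//.
  rewrite exprMn sqr_sqrtr// real_normK ?num_real//.
  rewrite -exprM mulnC exprM (_ : 2^-1 ^+ 2 = 4^-1 :> R); last by rewrite expr2; lra.
  by rewrite exprVn ler_pdivlMr ?exprn_gt0// mulrC.
have cs : cvgn (series (fun k => g_ k.+1 x - g_ k x)).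
  apply: normed_cvg.
  apply: (@series_le_cvg _ _ (geometric D 2^-1)).
  - by move=> n /=.
  - by move=> n /=; rewrite mulr_ge0 ?sqrtr_ge0 ?exprn_ge0.
  - by move=> n /=; exact: dD.
  - by apply: is_cvg_geometric_series; rewrite ger0_norm//; lra.
rewrite (_ : g_ ^~ x = (fun n => series (fun k => g_ k.+1 x - g_ k x) n + g_ 0%N x)).
  by apply: is_cvgD => //; exact: is_cvg_cst.
apply/funext => n; rewrite /series/= telescope_sumr// subrK//.
Qed.

(** Riesz-Fischer: a fast subsequence converges almost everywhere, and Fatou's lemma along it turns
    the Cauchy estimates into L^2 convergence of the whole sequence. *)
Lemma sqint_complete (f_ : nat -> T -> R) : (forall n, sqint (f_ n)) ->
  (forall e : R, 0 < e -> exists N, forall m n, (N <= m)%N -> (N <= n)%N ->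
     ip (f_ m \- f_ n) (f_ m \- f_ n) <= e) ->
  exists2 f, sqint f & cvgL2 f_ f.
Proof.
move=> hf fc.
have /choice[N NP] : forall k, exists N, forall m n, (N <= m)%N -> (N <= n)%N ->
     ip (f_ m \- f_ n) (f_ m \- f_ n) <= 8^-1 ^+ k.
  by move=> k; apply: fc; rewrite exprn_gt0.
(* Sums of the thresholds instead of the thresholds themselves: the indices become nondecreasing and
   still satisfy [N k <= s k]. *)
pose s k := (\sum_(j < k.+1) N j)%N.
have sN k j : (j <= k)%N -> (N j <= s k)%N.
  by move=> jk; rewrite /s (bigD1 (Ordinal (jk : (j < k.+1)%N)))//= leq_addr.
have := @fast_cauchy_ae (fun k => f_ (s k)) (fun k => hf _) _.
case; first by move=> k; apply: NP; apply: sN.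
move=> Z [mZ Z0 Zc].
(* Multiplication by the indicator of the complement of the null set gives convergence everywhere,
   hence a measurable limit. *)
pose I x := \1_(~` Z) x : R.
have mI : measurable_fun setT I by exact: measurable_indic (measurableC mZ).
have I1 x : `|I x| <= 1.
  by rewrite /I indicE; case: (_ \in _); rewrite ?normr1 ?normr0.
pose h k x := I x * f_ (s k) x.
have mf n : measurable_fun setT (f_ n) by case: (hf n).
have hc x : cvgn (h ^~ x).
  have [Zx|Zx] := pselect (Z x).
    rewrite (_ : h ^~ x = cst 0); first exact: is_cvg_cst.
    by apply/funext => k; rewrite /h /I indicE memNset ?mul0r//; apply/not_notP.
  apply: is_cvgM; first exact: is_cvg_cst.
  by apply: contrapT => nc; apply: Zx; exact: Zc.
pose f x := limn (h ^~ x).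
have mfl : measurable_fun setT f.
  apply: (@measurable_fun_cvg _ _ _ _ h) => [k|x _]; last exact: hc.
  exact: measurable_funM.
(* The Cauchy estimate between [f_ n] and the subsequence passes to the limit by Fatou's lemma; [k0]
   marks where the subsequence has passed [M]. *)
have key e M : (forall m n, (M <= m)%N -> (M <= n)%N -> ip (f_ m \- f_ n) (f_ m \- f_ n) <= e) ->
    forall n, (M <= n)%N -> (exists k0, forall k, (k0 <= k)%N -> (M <= s k)%N) ->
    sqint (f_ n \- f) /\ ip (f_ n \- f) (f_ n \- f) <= e.
  move=> Me n Mn [k0 k0P].
  have [] := @fatouL2 (fun k x => I x * (f_ n \- f_ (s (k + k0)%N)) x) (fun x => I x * f_ n x - f x) e.
  - move=> k; apply: (sqint_le _ _ (sqintB (hf n) (hf (s (k + k0)%N)))).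
      by apply: measurable_funM => //; exact: measurable_funB.
    by move=> x; rewrite normrM ler_piMl.
  - move=> x; under eq_fun do rewrite mulrBr.
    apply: cvgB; first exact: cvg_cst.
    have := hc x; rewrite -(cvg_shiftn k0); exact.
  - move=> k; apply: (le_trans _ (Me n (s (k + k0)%N) Mn (k0P _ (leq_addl _ _)))).
    apply: ip_le; last exact: sqintB.
      by apply: measurable_funM => //; exact: measurable_funB.
    by move=> x; rewrite normrM ler_piMl.
  move=> hi hle.
  have aee : {ae mu, forall x, I x * f_ n x - f x = (f_ n \- f) x}.
    exists Z; split=> // x /= nx; apply: contrapT => Zx; apply: nx.
    by rewrite /I indicE mem_set// mul1r.
  have mnf : measurable_fun setT (f_ n \- f) by exact: measurable_funB.
  have hi' := sqint_ae mnf aee hi.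
  split=> //; apply: le_trans hle.
  rewrite -(ae_eq_ip _ _ _ aee)//; try exact: (hi.1).
  by rewrite ipC -(ae_eq_ip _ _ _ aee)//; exact: (hi.1).
have sinf k n : (k <= n)%N -> (s k <= s n)%N.
  move=> kn; rewrite /s -!(big_mkord xpredT N).
  by rewrite (big_cat_nat (n := k.+1) (p := n.+1))//= leq_addr.
have hfl : sqint f.
  have [||B _] := @key 1 (s 0%N) _ (s 0%N) (leqnn _) _.
  - by move=> m n m0 n0; have := NP 0%N m n; rewrite expr0; apply; rewrite (leq_trans (sN 0%N 0%N _)).
  - by exists 0%N => k _; exact: sinf.
  have := sqintB (hf (s 0%N)) B; congr sqint.
  by apply/funext => x /=; rewrite subKr.
exists f => //; apply/cvgr0Pnorm_le => e e0.
have [k ke] : exists k, 8^-1 ^+ k <= e.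
  have q1 : `|8^-1 : R| < 1 by rewrite ger0_norm//; lra.
  have /cvgr0Pnorm_le/(_ e e0)[k _ /(_ k (leqnn _))] := cvg_expr q1.
  by move=> /=; rewrite ger0_norm ?exprn_ge0//; exists k.
exists (N k) => // n /= Nn; rewrite ger0_norm ?ip_ge0//.
have [|_] := key (8^-1 ^+ k) (N k) (NP k) n Nn _; last by move/le_trans; apply.
by exists k => k'; exact: sN.
Qed.

End square_integrable.

(** * Integrals over product spaces *)

Section fubini_reals.
Context d1 d2 (X : measurableType d1) (Y : measurableType d2) (R : realType).
Variables (m1 : {sigma_finite_measure set X -> \bar R})
          (m2 : {sigma_finite_measure set Y -> \bar R}).

Lemma integrable_prodM (f : X -> R) (g : Y -> R) :
  m1.-integrable setT (EFin \o f) -> m2.-integrable setT (EFin \o g) ->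
  (m1 \x m2)%E.-integrable setT (EFin \o (fun p : X * Y => f p.1 * g p.2)).
Proof.
move=> fi gi.
have mf : measurable_fun setT f by apply/measurable_EFinP; exact: (measurable_int _ fi).
have mg : measurable_fun setT g by apply/measurable_EFinP; exact: (measurable_int _ gi).
apply/integrable12ltyP.
  apply/measurable_EFinP; apply: measurable_funM.
    exact: (measurableT_comp mf).
  exact: (measurableT_comp mg).
rewrite (eq_integral (fun x => `|f x|%:E * \int[m2]_y `|g y|%:E)%E); last first.
  move=> x _; rewrite -ge0_integralZl//; last first.
    by apply/measurable_EFinP; exact: measurableT_comp.
  by apply: eq_integral => y _ /=; rewrite normrM EFinM.
rewrite ge0_integralZr//; last 2 first.
- by apply/measurable_EFinP; exact: measurableT_comp.
- exact: integral_ge0.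
by case/integrableP : fi => _ fi; case/integrableP : gi => _ gi; apply: lte_mul_pinfty => //; [exact: integral_ge0|by rewrite ge0_fin_numE// integral_ge0].
Qed.

Lemma Rintegral_prodM (f : X -> R) (g : Y -> R) :
  m1.-integrable setT (EFin \o f) -> m2.-integrable setT (EFin \o g) ->
  \int[(m1 \x m2)%E]_p (f p.1 * g p.2) = (\int[m1]_x f x) * (\int[m2]_y g y).
Proof.
move=> fi gi; rewrite /Rintegral -(integral12_prod_meas1 (integrable_prodM fi gi)).
rewrite /fubini_F/=.
rewrite (eq_integral (fun x => (f x)%:E * \int[m2]_y (g y)%:E)%E); last first.
  move=> x _; rewrite -integralZl//.
rewrite -(fineK (integrable_fin_num measurableT gi)) integralZr//.
by rewrite -(fineK (integrable_fin_num measurableT fi)).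
Qed.

(** Integrability is asked of every section, so that each inner integral is finite and agrees with
    its real value. *)
Lemma Rfubini (F : X -> Y -> R) :
  (m1 \x m2)%E.-integrable setT (fun p => (F p.1 p.2)%:E) ->
  (forall x, m2.-integrable setT (EFin \o F x)) ->
  (forall y, m1.-integrable setT (fun x => (F x y)%:E)) ->
  \int[m1]_x \int[m2]_y F x y = \int[m2]_y \int[m1]_x F x y.
Proof.
move=> Fi F1 F2; rewrite /Rintegral; congr fine.
transitivity (\int[m1]_x \int[m2]_y (F x y)%:E)%E.
  by apply: eq_integral => x _; rewrite fineK//; exact: integrable_fin_num (F1 x).
rewrite (Fubini Fi); apply: eq_integral => y _ /=.
by rewrite fineK//; exact: integrable_fin_num (F2 y).
Qed.

End fubini_reals.

Lemma cvg_eq_lim (R : realType) (u v : nat -> R) (l l' : R) :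
  (forall n, u n = v n) -> u n @[n --> \oo] --> l -> v n @[n --> \oo] --> l' -> l = l'.
Proof.
move=> uv ul vl; have : u n @[n --> \oo] --> l' by rewrite (_ : u = v)//; exact/funext.
exact: (cvg_unique _ ul).
Qed.

(** * Transforms with an isometric kernel *)

Section kernel_transform.
Context d (X : measurableType d) (R : realType).
Variable mu : {sigma_finite_measure set X -> \bar R}.
Variable k : X -> X -> R.
Implicit Types f g h : X -> R.

(** Absolutely convergent for integrable [f]; on all of L^2 the transform is the relation [hart]. *)
Definition ktr f : X -> R := fun y => \int[mu]_x (f x * k x y).

(** The integrals of the positive and of the negative part are measurable in the parameter by
    Tonelli's theorem. *)
Lemma ktr_measurable f :
  measurable_fun setT (fun p : X * X => k p.1 p.2) -> measurable_fun setT f -> measurable_fun setT (ktr f).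
Proof.
move=> mk mf.
have mF : measurable_fun setT (fun p : X * X => (f p.1 * k p.1 p.2)%:E).
  apply/measurable_EFinP; apply: measurable_funM => //.
  exact: (measurableT_comp mf).
apply: (measurableT_comp (fine_measurable measurableT)) => //=.
under eq_fun do rewrite integralE.
apply: emeasurable_funB.
- have F0 p : (0 <= (fun p : X * X => (f p.1 * k p.1 p.2)%:E)^\+ p)%E by rewrite funepos_ge0.
  have := measurable_fun_fubini_tonelli_G (m1 := mu) _ (measurable_funepos mF) F0.
  by apply: eq_measurable_fun => x _; apply: eq_integral => y _; rewrite !funeposE.
- have F0 p : (0 <= (fun p : X * X => (f p.1 * k p.1 p.2)%:E)^\- p)%E by rewrite funeneg_ge0.
  have := measurable_fun_fubini_tonelli_G (m1 := mu) _ (measurable_funeneg mF) F0.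
  by apply: eq_measurable_fun => x _; apply: eq_integral => y _; rewrite !funenegE.
Qed.

(* [Q] exhausts the space by boxes, [B] is the pi-system of boxes, and the
   kernel acts as [sqrt c] times an isometry on the indicators of boxes. *)
Record isometric_kernel (Q : nat -> set X) (B : set (set X)) (c : R) : Prop := {
  ik_meas : measurable_fun setT (fun p : X * X => k p.1 p.2);
  ik_sym : forall x y, k x y = k y x;
  ik_le : forall x y, `|k x y| <= 2;
  ik_Q : forall n, B (Q n);
  ik_Qnd : forall m n, (m <= n)%N -> Q m `<=` Q n;
  ik_QT : forall x, exists n, Q n x;
  ik_Bm : forall A, B A -> measurable A;
  ik_Bfin : forall A, B A -> (mu A < +oo)%E;
  ik_BI : setI_closed B;
  ik_Bgen : @measurable _ X = <<s B >>;
  ik_c : 0 < c;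
  ik_sqint : forall A, B A -> sqint mu (ktr \1_A);
  ik_iso : forall A A', B A -> B A' ->
    ip mu (ktr \1_A) (ktr \1_A') = c * ip mu \1_A \1_A' }.

Variables (Q : nat -> set X) (B : set (set X)) (c : R).
Hypothesis K : isometric_kernel Q B c.
Let mk := ik_meas K.
Local Notation sq := (sqint mu).
Local Notation "<< f , g >>" := (ip mu f g).

Let mk2 y : measurable_fun setT (k ^~ y).
Proof. exact: (measurable_fun_pair1 (f := fun p => k p.1 p.2) y mk). Qed.

Let mk1 x : measurable_fun setT (k x).
Proof. exact: (measurable_fun_pair2 (f := fun p => k p.1 p.2) x mk). Qed.

Lemma integrable_Mk f y : mu.-integrable setT (EFin \o f) ->
  mu.-integrable setT (EFin \o (fun x => f x * k x y)).
Proof.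
move=> fi; have := integrable_EFinZ 2 (integrable_norm fi).
apply: le_integrable_EFin.
  by apply: measurable_funM => //; apply/measurable_EFinP; exact: (measurable_int _ fi).
by move=> x /=; rewrite normrM mulrC ler_wpM2r// (ik_le K).
Qed.

Lemma ktr_le f y : mu.-integrable setT (EFin \o f) ->
  `|ktr f y| <= 2 * \int[mu]_x `|f x|.
Proof.
move=> fi; have fk := integrable_Mk y fi.
apply: (le_trans (le_normr_Rintegral measurableT fk)).
rewrite -RintegralZl//; last exact: integrable_norm.
apply: le_Rintegral => //; first exact: integrable_norm fk.
  exact: (integrable_EFinZ 2 (integrable_norm fi)).
by move=> x _; rewrite normrM mulrC ler_wpM2r// (ik_le K).
Qed.

Lemma ktrD f g : mu.-integrable setT (EFin \o f) -> mu.-integrable setT (EFin \o g) ->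
  ktr (f \+ g) = ktr f \+ ktr g.
Proof.
move=> fi gi; apply/funext => y; rewrite /ktr /=.
rewrite -RintegralD//; [|exact: integrable_Mk|exact: integrable_Mk].
by apply: eq_Rintegral => x _ /=; rewrite mulrDl.
Qed.

Lemma ktrZ a f : mu.-integrable setT (EFin \o f) ->
  ktr (fun x => a * f x) = fun y => a * ktr f y.
Proof.
move=> fi; apply/funext => y; rewrite /ktr -RintegralZl//; last exact: integrable_Mk.
by apply: eq_Rintegral => x _ /=; rewrite mulrA.
Qed.

Lemma ktrB f g : mu.-integrable setT (EFin \o f) -> mu.-integrable setT (EFin \o g) ->
  ktr (f \- g) = ktr f \- ktr g.
Proof.
move=> fi gi; apply/funext => y; rewrite /ktr /=.
rewrite -RintegralB//; [|exact: integrable_Mk|exact: integrable_Mk].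
by apply: eq_Rintegral => x _ /=; rewrite mulrBl.
Qed.

Lemma ktr0 : ktr (fun=> 0) = fun=> 0.
Proof.
apply/funext => y; rewrite /ktr; under eq_Rintegral do rewrite mul0r.
by rewrite /Rintegral integral0.
Qed.

(** Fubini's theorem and the symmetry of the kernel. *)
Lemma ktr_adjoint f g : mu.-integrable setT (EFin \o f) ->
  mu.-integrable setT (EFin \o g) -> << ktr f, g >> = << f, ktr g >>.
Proof.
move=> fi gi; rewrite /ip /ktr.
have mf : measurable_fun setT f by apply/measurable_EFinP; exact: (measurable_int _ fi).
have mg : measurable_fun setT g by apply/measurable_EFinP; exact: (measurable_int _ gi).
transitivity (\int[mu]_y \int[mu]_x (f x * k x y * g y)).
  apply: eq_Rintegral => y _; rewrite -RintegralZr//; exact: integrable_Mk.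
rewrite -(@Rfubini _ _ _ _ _ mu mu (fun x y => f x * k x y * g y)).
- apply: eq_Rintegral => x _; rewrite -RintegralZl//; last exact: integrable_Mk.
  by apply: eq_Rintegral => y _; rewrite (ik_sym K x y) mulrAC mulrA.
- have := integrable_EFinZ 2 (integrable_norm (integrable_prodM fi gi)).
  apply: le_integrable_EFin.
    apply: measurable_funM; first apply: measurable_funM => //.
      exact: (measurableT_comp mf).
    exact: (measurableT_comp mg).
  move=> p /=; rewrite !normrM mulrAC mulrC ler_wpM2r ?mulr_ge0//; exact: (ik_le K).
- move=> x; have := integrable_EFinZ (f x) (integrable_Mk x gi).
  by apply: eq_integrable => // y _ /=; rewrite (ik_sym K x y) -mulrA (mulrC (k _ _)).
- move=> y; have := integrable_EFinZ (g y) (integrable_Mk y fi).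
  by apply: eq_integrable => // x _ /=; rewrite mulrC.
Qed.

Definition trunc n f : X -> R := fun x => \1_(Q n) x * f x.

Let mQ n : measurable (Q n). Proof. exact/(ik_Bm K)/(ik_Q K). Qed.

(** Over a box of finite measure L^2 is contained in L^1, so [ktr] converges absolutely on these
    functions. *)
Definition bsupp n f := sq f /\ forall x, ~ Q n x -> f x = 0.

Lemma sqint_indic A : B A -> sq \1_A.
Proof.
move=> BA; split; first exact: measurable_indic (ik_Bm K BA).
rewrite (_ : (fun _ => _) = EFin \o \1_A).
  apply/integrableP; split.
    by apply/measurable_EFinP; exact: measurable_indic (ik_Bm K BA).
  rewrite (eq_integral (EFin \o \1_A)).
    by rewrite integral_indic// ?setIT ?(ik_Bfin K)//; exact: (ik_Bm K).
  by move=> x _ /=; rewrite ger0_norm.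
by apply/funext => x /=; rewrite indicE; case: (_ \in _); rewrite ?expr1n ?expr0n.
Qed.

Lemma bsuppE n f : bsupp n f -> f = trunc n f.
Proof.
move=> [_ f0]; apply/funext => x; rewrite /trunc indicE.
by have [Qx|Qx] := pselect (Q n x); [rewrite mem_set// mul1r|rewrite f0// mulr0].
Qed.

Lemma bsupp_integrable n f : bsupp n f -> mu.-integrable setT (EFin \o f).
Proof.
move=> fb; rewrite (bsuppE fb).
exact: integrable_sqintM (sqint_indic (ik_Q K n)) fb.1.
Qed.

Lemma trunc_bsupp n f : sq f -> bsupp n (trunc n f).
Proof.
move=> hf; split.
  apply: (sqint_le _ _ hf); first by apply: measurable_funM; [exact: measurable_indic|case: hf].
  move=> x; rewrite /trunc normrM indicE; case: (_ \in _); first by rewrite normr1 mul1r.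
  by rewrite normr0 mul0r.
by move=> x nQ; rewrite /trunc indicE memNset// mul0r.
Qed.

Lemma bsuppD n f g : bsupp n f -> bsupp n g -> bsupp n (f \+ g).
Proof.
move=> [hf f0] [hg g0]; split; first exact: sqintD.
by move=> x nQ /=; rewrite f0// g0// addr0.
Qed.

Lemma bsuppZ n a f : bsupp n f -> bsupp n (fun x => a * f x).
Proof.
move=> [hf f0]; split; first exact: sqintZ.
by move=> x nQ /=; rewrite f0// mulr0.
Qed.

Lemma bsuppB n f g : bsupp n f -> bsupp n g -> bsupp n (f \- g).
Proof.
move=> [hf f0] [hg g0]; split; first exact: sqintB.
by move=> x nQ /=; rewrite f0// g0// subr0.
Qed.

Lemma bsuppS m n f : (m <= n)%N -> bsupp m f -> bsupp n f.
Proof. by move=> mn [hf f0]; split=> // x nQ; apply: f0 => Qx; apply: nQ; exact: (ik_Qnd K mn). Qed.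

(** Cauchy-Schwarz against the indicator of [Q n]. Consequently L^2 convergence inside a fixed box
    implies pointwise convergence of the transforms. *)
Lemma ktr_bsupp_le n f y : bsupp n f ->
  ktr f y ^+ 2 <= 4 * << \1_(Q n), \1_(Q n) >> * << f, f >>.
Proof.
move=> fb; have fi := bsupp_integrable fb.
have hQ := sqint_indic (ik_Q K n).
have hnf : sq (fun x => `|f x|).
  apply: (sqint_le _ _ fb.1) => [|x]; last by rewrite normr_id.
  by apply: measurableT_comp => //; case: fb => -[].
have : \int[mu]_x `|f x| = << \1_(Q n), fun x => `|f x| >>.
  by apply: eq_Rintegral => x _; rewrite {1}(bsuppE fb) /trunc normrM indicE; case: (_ \in _); rewrite ?normr1 ?normr0.
have := cauchy_schwarz hQ hnf => cs E.
have := ktr_le y fi; rewrite E => le1.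
have ff : << fun x => `|f x|, fun x => `|f x| >> = << f, f >>.
  by apply: eq_Rintegral => x _; rewrite -!expr2 real_normK ?num_real.
rewrite ff in cs.
rewrite -real_normK ?num_real//; apply: (@le_trans _ _ ((2 * << \1_(Q n), fun x => `|f x| >>) ^+ 2)).
  by rewrite ler_pXn2r// nnegrE// (le_trans _ le1).
rewrite exprMn -mulrA (_ : 2 ^+ 2 = 4); last by rewrite expr2; lra.
by rewrite ler_pM2l.
Qed.

(** Only sets of the pi-system [B] occur, because the isometry is postulated on their indicators
    alone. *)
Inductive step n : (X -> R) -> Prop :=
| step0 : step n (fun=> 0)
| stepD a A f : B A -> A `<=` Q n -> step n f -> step n ((fun x => a * \1_A x) \+ f).

Let bsupp_indic n A : B A -> A `<=` Q n -> bsupp n \1_A.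
Proof.
move=> BA AQ; split; first exact: sqint_indic.
by move=> x nQ; rewrite indicE memNset// => Ax; apply: nQ; exact: AQ.
Qed.

Lemma step_bsupp n f : step n f -> bsupp n f.
Proof.
elim=> [|a A {}f BA AQ sf IH]; first by split; [exact: sqint0|].
by apply: bsuppD => //; apply: bsuppZ; exact: bsupp_indic.
Qed.

Lemma step_add n f g : step n f -> step n g -> step n (f \+ g).
Proof.
move=> + sg; elim=> [|a A {}f BA AQ sf IH].
  by rewrite (_ : _ \+ g = g)//; apply/funext => x /=; rewrite add0r.
rewrite (_ : _ \+ g = (fun x => a * \1_A x) \+ (f \+ g)); first exact: stepD.
by apply/funext => x /=; rewrite addrA.
Qed.

Lemma step_scale n a f : step n f -> step n (fun x => a * f x).
Proof.
elim=> [|b A {}f BA AQ sf IH].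
  by rewrite (_ : (fun _ => _) = fun=> 0); [exact: step0|apply/funext => x; rewrite mulr0].
rewrite (_ : (fun _ => _) = (fun x => (a * b) * \1_A x) \+ (fun x => a * f x)); first exact: stepD.
by apply/funext => x /=; rewrite mulrDr mulrA.
Qed.

Lemma step_sub n f g : step n f -> step n g -> step n (f \- g).
Proof.
move=> sf /(step_scale (-1)) /(step_add sf).
by congr step; apply/funext => x /=; rewrite mulN1r.
Qed.

Let ktr_stepD n a A f : B A -> A `<=` Q n -> step n f ->
  ktr ((fun x => a * \1_A x) \+ f) = (fun x => a * ktr \1_A x) \+ ktr f.
Proof.
move=> BA AQ sf.
have i1 := bsupp_integrable (bsupp_indic BA AQ).
rewrite ktrD//; [by rewrite ktrZ|exact: integrable_EFinZ|].
exact: bsupp_integrable (step_bsupp sf).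
Qed.

Lemma step_sqint n f : step n f -> sq (ktr f).
Proof.
elim=> [|a A {}f BA AQ sf IH]; first by rewrite ktr0; exact: sqint0.
rewrite (ktr_stepD _ BA AQ sf); apply: sqintD => //; apply: sqintZ.
exact: (ik_sqint K).
Qed.

Let ip0l g : << fun=> 0, g >> = 0.
Proof. by rewrite /ip; under eq_Rintegral do rewrite mul0r; rewrite /Rintegral integral0. Qed.

Lemma step_iso n f g : step n f -> step n g -> << ktr f, ktr g >> = c * << f, g >>.
Proof.
move=> + sg; elim=> [|a A {}f BA AQ sf IH]; first by rewrite ktr0 !ip0l mulr0.
have hA := ik_sqint K BA; have hg := step_sqint sg; have hf := step_sqint sf.
have iA := sqint_indic BA; have ig := (step_bsupp sg).1; have if_ := (step_bsupp sf).1.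
rewrite (ktr_stepD _ BA AQ sf) ipDl//; last exact: sqintZ.
rewrite [in RHS]ipDl//; last exact: sqintZ.
rewrite IH !ipZl// mulrDr; congr (_ + _); rewrite mulrCA; congr (_ * _).
elim: sg {hg ig IH} => [|b A' {}g BA' AQ' sg IH]; first by rewrite ktr0 ipC ip0l (ipC _ \1_A) ip0l mulr0.
have hA' := ik_sqint K BA'; have hg := step_sqint sg.
have iA' := sqint_indic BA'; have ig := (step_bsupp sg).1.
rewrite (ktr_stepD _ BA' AQ' sg) ipDr//; last exact: sqintZ.
rewrite [in RHS]ipDr//; last exact: sqintZ.
by rewrite IH !ipZr// (ik_iso K)// mulrDr; congr (_ + _); rewrite mulrCA.
Qed.

(** The L^2 closure of the step functions within a fixed box. *)
Definition apx n f := bsupp n f /\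
  forall e : R, 0 < e -> exists2 g, step n g & << f \- g, f \- g >> <= e.

Lemma apx_step n f : step n f -> apx n f.
Proof.
move=> sf; split; first exact: step_bsupp.
move=> e e0; exists f => //; rewrite (_ : f \- f = fun=> 0); first by rewrite ip0l ltW.
by apply/funext => x /=; rewrite subrr.
Qed.

Lemma apx_closed n f : bsupp n f ->
  (forall e : R, 0 < e -> exists2 g, apx n g & << f \- g, f \- g >> <= e) -> apx n f.
Proof.
move=> fb fa; split=> // e e0.
have e40 : 0 < e / 4 by lra.
have [g [gb ga] fg] := fa _ e40; have [h sh gh] := ga _ e40.
exists h => //; have := ip_sqr_triangle fb.1 gb.1 (step_bsupp sh).1; lra.
Qed.

Lemma apxD n f g : apx n f -> apx n g -> apx n (f \+ g).
Proof.
move=> [fb fa] [gb ga]; split; first exact: bsuppD.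
move=> e e0; have e40 : 0 < e / 4 by lra.
have [f' sf' ff'] := fa _ e40; have [g' sg' gg'] := ga _ e40.
exists (f' \+ g'); first exact: step_add.
rewrite (_ : _ \- _ = (f \- f') \+ (g \- g')); last by apply/funext => x /=; ring.
have := ip_sqrD (sqintB fb.1 (step_bsupp sf').1) (sqintB gb.1 (step_bsupp sg').1); lra.
Qed.

Lemma apxZ n a f : apx n f -> apx n (fun x => a * f x).
Proof.
move=> [fb fa]; split; first exact: bsuppZ.
(* The summand 1 covers a = 0. *)
move=> e e0; have a0 : 0 < a ^+ 2 + 1 by rewrite ltr_wpDl// sqr_ge0.
have [f' sf' ff'] := fa _ (divr_gt0 e0 a0).
exists (fun x => a * f' x); first exact: step_scale.
rewrite (_ : _ \- _ = (fun x => a * (f \- f') x)); last by apply/funext => x /=; ring.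
have hB := sqintB fb.1 (step_bsupp sf').1.
rewrite ipZl//; last exact: sqintZ.
rewrite ipZr// mulrA -expr2; move: ff'; rewrite ler_pdivlMr// => ff'.
apply: le_trans ff'; rewrite mulrC ler_wpM2l ?ip_ge0// lerDl//.
Qed.

Lemma apxB n f g : apx n f -> apx n g -> apx n (f \- g).
Proof.
move=> af /(apxZ (-1)) /(apxD af).
by congr apx; apply/funext => x /=; rewrite mulN1r.
Qed.

Lemma apx_sum n (I : Type) (s : seq I) (P : pred I) (F : I -> X -> R) :
  (forall i, P i -> apx n (F i)) -> apx n (fun x => \sum_(i <- s | P i) F i x).
Proof.
move=> aF; elim: s => [|i s IH].
  by under eq_fun do rewrite big_nil; apply: apx_step; exact: step0.
have [Pi|nPi] := boolP (P i).
  rewrite (_ : (fun _ => _) = F i \+ (fun x => \sum_(i <- s | P i) F i x)).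
    by apply: apxD => //; exact: aF.
  by apply/funext => x; rewrite big_cons Pi.
by move: IH; congr apx; apply/funext => x; rewrite big_cons (negbTE nPi).
Qed.

Lemma apx_cvgL2 n (f_ : nat -> X -> R) f : (forall m, apx n (f_ m)) -> bsupp n f ->
  cvgL2 mu f_ f -> apx n f.
Proof.
move=> af fb fc; apply: apx_closed => // e e0.
have /cvgr0Pnorm_le/(_ e e0)[N _ /(_ N (leqnn _))] := fc.
rewrite ger0_norm ?ip_ge0// ip_sqrBC; by exists (f_ N).
Qed.

(** Dynkin's pi-lambda theorem: the sets [A] with this property form a lambda-system, which contains
    [B] because [B] is stable under intersection with [Q n]. *)
Lemma apx_indic n A : measurable A -> apx n (trunc n \1_A).
Proof.
have tE D : trunc n \1_D = \1_(Q n `&` D).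
  by apply/funext => x; rewrite /trunc indicI.
rewrite (ik_Bgen K) => sA; pose P D := apx n (trunc n \1_D).
have mB D : measurable D -> bsupp n (trunc n \1_D).
  move=> mD; split.
    apply: (sqint_le _ _ (sqint_indic (ik_Q K n))).
      by rewrite tE; apply: measurable_indic; exact: measurableI.
    by move=> x; rewrite /trunc !indicE; case: (x \in Q n); case: (x \in D); rewrite ?(mulr0, mulr1, mul0r, normr0, normr1).
  by move=> x nQ; rewrite /trunc indicE memNset// mul0r.
apply: (@dynkin_induction _ _ B P (ik_Bgen K) (ik_BI K) _ _ _ _ _ sA).
- have := apx_step (stepD 1 (ik_Q K n) (fun _ => id) (step0 n)).
  rewrite /P tE setIT; congr apx; by apply/funext => x /=; rewrite mul1r addr0.
- move=> D BD; rewrite /P tE.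
  have BQ := ik_BI K (ik_Q K n) BD.
  have := apx_step (stepD 1 BQ (@subIsetl _ _ _) (step0 n)).
  by congr apx; apply/funext => x /=; rewrite mul1r addr0.
- move=> D mD PD.
  have aQ : apx n \1_(Q n).
    have := apx_step (stepD 1 (ik_Q K n) (fun _ => id) (step0 n)).
    by congr apx; apply/funext => x /=; rewrite mul1r addr0.
  rewrite /P (_ : trunc n _ = \1_(Q n) \- trunc n \1_D); first exact: apxB.
  apply/funext => x /=; rewrite /trunc.
  have -> : \1_(~` D) x = 1 - \1_D x :> R.
    by rewrite !indicE in_setC; case: (x \in D); rewrite ?subrr ?subr0.
  by rewrite mulrBr mulr1.
- move=> F mF tF PF.
  (* Partial sums over the disjoint union; they are dominated by the indicator of [Q n]. *)
  pose f_ m x := \sum_(0 <= i < m) trunc n \1_(F i) x.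
  have f_E m : f_ m = trunc n \1_(\big[setU/set0]_(0 <= i < m) F i).
    apply/funext => x; rewrite /f_ /trunc -mulr_sumr; congr (_ * _).
    elim: m => [|m IH]; first by rewrite !big_geq// indic0.
    rewrite big_nat_recr// [in RHS]big_nat_recr//= IH !indicE in_setU.
    case: (boolP (x \in F m)) => xm; rewrite ?orbT ?orbF ?addr0//=.
    rewrite (_ : x \in _ = false) ?add0r//; apply/negbTE/negP.
    rewrite big_mkord -bigcup_mkord inE => -[] /= i im Fi.
    have : (F i `&` F m) !=set0 by exists x; split => //; rewrite inE in xm.
    by move/(tF i m I I) => eim; move: im; rewrite eim ltnn.
  apply: (@apx_cvgL2 n f_).
  + by move=> m; apply: apx_sum => i _; exact: PF.
  + by apply: mB; exact: bigcup_measurable.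
  + apply: (@cvgL2_dominated _ _ _ _ _ _ \1_(Q n)).
    * move=> m; rewrite f_E; case: (mB (\big[setU/set0]_(0 <= i < m) F i)); first exact: bigsetU_measurable.
      by case.
    * by case: (mB (\bigcup_k F k) (bigcup_measurable _)) => // -[].
    * exact: sqint_indic (ik_Q K n).
    * by move=> m x; rewrite f_E /trunc normrM ler_piMr// indicE; case: (_ \in _); rewrite ?normr1 ?normr0.
    * move=> x; apply: cvg_near_cst.
      have [[N _ FN]|nF] := pselect ((\bigcup_k F k) x).
        exists N.+1 => // m /= Nm; rewrite f_E /trunc; congr (_ * _).
        rewrite !indicE !mem_set//; first by exists N.
        by rewrite big_mkord -bigcup_mkord; exists N.
      apply: nearW => m; rewrite f_E /trunc; congr (_ * _).
      rewrite !indicE !memNset//; apply: contra_not nF.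
      by rewrite big_mkord -bigcup_mkord => -[i _ Fi]; exists i.
Qed.

Import HBNNSimple.

(** [f] is the difference of (|f| + f)/2 and (|f| - f)/2, and each of these is a dominated limit of
    simple functions. *)
Lemma bsupp_apx n f : bsupp n f -> apx n f.
Proof.
suff pos g : bsupp n g -> (forall x, 0 <= g x) -> apx n g.
  move=> fb; have hab : bsupp n (fun x => `|f x|).
    split; last by move=> x nQ; rewrite fb.2// normr0.
    apply: (sqint_le _ _ fb.1) => [|x]; last by rewrite normr_id.
    by apply: measurableT_comp => //; case: fb => -[].
  rewrite (_ : f = (fun x => 2^-1 * (`|f x| + f x)) \- (fun x => 2^-1 * (`|f x| - f x))); last first.
    by apply/funext => x /=; field.
  apply: apxB; apply: pos.
  - exact: bsuppZ (bsuppD hab fb).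
  - by move=> x; rewrite mulr_ge0 ?invr_ge0// -lerBlDr sub0r -normrN ler_norm.
  - exact: bsuppZ (bsuppB hab fb).
  - by move=> x; rewrite mulr_ge0 ?invr_ge0// subr_ge0 ler_norm.
move=> gb g0.
have mg : measurable_fun setT (EFin \o g) by apply/measurable_EFinP; case: gb => -[].
have eg0 x : setT x -> (0 <= (EFin \o g) x)%E by move=> _; rewrite lee_fin.
pose s_ := nnsfun_approx measurableT mg.
have sg m x : s_ m x <= g x by have := le_approx m eg0 (I : setT x); rewrite -lee_fin /s_ nnsfun_approxE.
apply: (@apx_cvgL2 n (fun m x => s_ m x)) => //.
(* A nonnegative simple function below [g] vanishes outside [Q n], so truncating its level sets does
   not change it. *)
- move=> m; rewrite (_ : (fun x => _) = (fun x => \sum_(y <- finmap.enum_fset (fset_set (range (s_ m)))) y * trunc n \1_(s_ m @^-1` [set y]) x)).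
    by apply: apx_sum => y _; apply: apxZ; apply: apx_indic; exact: measurable_funPTI.
  apply/funext => x.
  transitivity (\1_(Q n) x * s_ m x).
    rewrite indicE; have [Qx|Qx] := pselect (Q n x); first by rewrite mem_set// mul1r.
    rewrite memNset// mul0r; apply/eqP; rewrite eq_le fun_ge0 andbT.
    by rewrite (le_trans (sg m x))// gb.2.
  rewrite [X in _ * X]fimfunE fsbig_finite//= mulr_sumr.
  by apply: eq_bigr => y _; rewrite /trunc mulrCA.
- apply: (@cvgL2_dominated _ _ _ _ _ _ g) => //.
  + by case: gb => -[].
  + by case: gb.
  + by move=> m x; rewrite !ger0_norm.
  + move=> x; have := cvg_nnsfun_approx measurableT mg eg0 (I : setT x).
    by move/fine_cvg.
Qed.

(** The transforms of step approximants form a Cauchy sequence in L^2 by [step_iso] and converge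
    pointwise by [ktr_bsupp_le]; Fatou's lemma identifies the two limits. *)
Lemma ktr_bsupp_iso n f : bsupp n f ->
  sq (ktr f) /\ << ktr f, ktr f >> = c * << f, f >>.
Proof.
move=> fb; have [_ fa] := bsupp_apx fb.
have /choice[g gP] : forall m : nat, exists g, step n g /\ << f \- g, f \- g >> <= m.+1%:R^-1.
  by move=> m; have [|g sg fg] := fa m.+1%:R^-1; [rewrite invr_gt0|exists g].
have sg m : step n (g m) by case: (gP m).
have fg m : << f \- g m, f \- g m >> <= m.+1%:R^-1 by case: (gP m).
have bg m := step_bsupp (sg m).
have fi := bsupp_integrable fb.
have gi m := bsupp_integrable (bg m).
have gf : cvgL2 mu g f.
  apply: (@squeeze_cvgr _ _ _ _ (cst 0) (fun m => m.+1%:R^-1)).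
  - by apply: nearW => m; rewrite ip_ge0/= ip_sqrBC fg.
  - exact: cvg_cst.
  - exact: cvg_harmonic.
pose q := << \1_(Q n), \1_(Q n) >>.
have q0 : 0 <= q by exact: ip_ge0.
have pc y : ktr (g m) y @[m --> \oo] --> ktr f y.
  apply/cvgrPdist_le => e e0.
  have : 4 * q * << g m \- f, g m \- f >> @[m --> \oo] --> (0 : R).
    by rewrite -[X in _ --> X](mulr0 (4 * q)); apply: cvgM gf; exact: cvg_cst.
  move/cvgr0Pnorm_le/(_ (e ^+ 2)); rewrite exprn_gt0// => /(_ isT).
  apply: filterS => m le2; rewrite distrC.
  have := ktr_bsupp_le y (bsuppB (bg m) fb); rewrite ktrB//= -/q => le3.
  have := le_trans le3 (le_trans (ler_norm _) le2).
  by rewrite -real_normK ?num_real// ler_pXn2r// nnegrE// ltW.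
have sk m : sq (ktr (g m)) by exact: step_sqint.
have isoB m l : << ktr (g m) \- ktr (g l), ktr (g m) \- ktr (g l) >> = c * << g m \- g l, g m \- g l >>.
  by rewrite -ktrB//; apply: step_iso; exact: step_sub.
have c0 := ik_c K.
(* The factor 4 is 2 + 2 from the triangle inequality for squares, both distances to [f] being at
   most 1/(m+1). *)
have key (m : nat) : sq (ktr (g m) \- ktr f) /\
    << ktr (g m) \- ktr f, ktr (g m) \- ktr f >> <= c * (4 * m.+1%:R^-1).
  apply: (@fatouL2 _ _ _ _ (fun l => ktr (g m) \- ktr (g (l + m)%N))).
  - by move=> l; exact: sqintB.
  - move=> y; apply: cvgB; first exact: cvg_cst.
    by have := pc y; rewrite -(cvg_shiftn m); exact.
  - move=> l; rewrite isoB ler_pM2l//.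
    have := ip_sqr_triangle (bg m).1 fb.1 (bg (l + m)%N).1.
    rewrite (ip_sqrBC mu (g m) f); have := fg m; have := fg (l + m)%N.
    have : (l + m).+1%:R^-1 <= m.+1%:R^-1 :> R by rewrite lef_pV2 ?posrE// ler_nat ltnS leq_addl.
    by move: (_.+1%:R^-1) (m.+1%:R^-1) => u v; lra.
have hkf : sq (ktr f).
  have := sqintB (sk 0%N) (key 0%N).1; congr sqint.
  by apply/funext => x /=; rewrite subKr.
have kc : cvgL2 mu (fun m => ktr (g m)) (ktr f).
  apply: (@squeeze_cvgr _ _ _ _ (cst 0) (fun m => c * (4 * m.+1%:R^-1))).
  - by apply: nearW => m; rewrite ip_ge0/= (key m).2.
  - exact: cvg_cst.
  - rewrite -[X in _ --> X](mulr0 c); apply: cvgM; first exact: cvg_cst.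
    rewrite -[X in _ --> X](mulr0 4); apply: cvgM; first exact: cvg_cst.
    exact: cvg_harmonic.
split=> //.
have l1 := cvgL2_norm sk hkf kc.
have l2 : c * << g m, g m >> @[m --> \oo] --> c * << f, f >>.
  by apply: cvgM; [exact: cvg_cst|exact: cvgL2_norm (fun m => (bg m).1) fb.1 gf].
by apply: (cvg_eq_lim _ l1 l2) => m; rewrite (step_iso (sg m) (sg m)).
Qed.

(** The L^2 transform as a relation, by the truncation procedure of [is_fourier]; [g] is determined
    up to a null set. *)
Definition hart f g := [/\ sq f, sq g & cvgL2 mu (fun n => ktr (trunc n f)) g].

Let tb n f : sq f -> bsupp n (trunc n f). Proof. exact: trunc_bsupp. Qed.

Lemma cvgL2_trunc f : sq f -> cvgL2 mu (fun n => trunc n f) f.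
Proof.
move=> hf; apply: (@cvgL2_dominated _ _ _ _ _ _ f) => //.
- by move=> n; case: (tb n hf) => -[].
- by case: hf.
- by move=> n x; rewrite /trunc normrM ler_piMl// indicE; case: (_ \in _); rewrite ?normr1 ?normr0.
- move=> x; apply: cvg_near_cst; have [N QN] := ik_QT K x.
  exists N => // n /= Nn; rewrite /trunc indicE mem_set ?mul1r//.
  exact: (ik_Qnd K Nn).
Qed.

Lemma ktrB_trunc_iso m n f : sq f ->
  << ktr (trunc m f) \- ktr (trunc n f), ktr (trunc m f) \- ktr (trunc n f) >> =
  c * << trunc m f \- trunc n f, trunc m f \- trunc n f >>.
Proof.
move=> hf; have tm := tb m hf; have tn := tb n hf.
rewrite -ktrB; [|exact: bsupp_integrable tm|exact: bsupp_integrable tn].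
apply: (ktr_bsupp_iso (n := maxn m n) _).2.
by apply: bsuppB; [exact: bsuppS (leq_maxl _ _) tm|exact: bsuppS (leq_maxr _ _) tn].
Qed.

(** Truncations of [f] converge to [f], so their transforms form a Cauchy sequence by the
    isometry. *)
Lemma hart_exists f : sq f -> exists g, hart f g.
Proof.
move=> hf; have c0 := ik_c K.
have [|e e0|g hg gc] := @sqint_complete _ _ _ mu (fun n => ktr (trunc n f)).
- by move=> n; exact: (ktr_bsupp_iso (tb n hf)).1.
- have e40 : 0 < e / (4 * c) by rewrite divr_gt0// mulr_gt0.
  have /cvgr0Pnorm_le/(_ _ e40)[N _ NP] := cvgL2_trunc hf.
  exists N => m n Nm Nn; rewrite ktrB_trunc_iso//.
  have := ip_sqr_triangle (tb m hf).1 hf (tb n hf).1.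
  have := NP m Nm; have := NP n Nn; rewrite !ger0_norm ?ip_ge0// (ip_sqrBC _ f).
  move=> H1 H2 H3; apply: (@le_trans _ _ (c * (4 * (e / (4 * c))))).
    by rewrite ler_pM2l//; lra.
  by rewrite le_eqVlt; apply/orP; left; apply/eqP; field; rewrite gt_eqF.
by exists g; split.
Qed.

Lemma hart_norm f g : hart f g -> << g, g >> = c * << f, f >>.
Proof.
move=> [hf hg fg].
have l1 := cvgL2_norm (fun n => (ktr_bsupp_iso (tb n hf)).1) hg fg.
have l2 : c * << trunc n f, trunc n f >> @[n --> \oo] --> c * << f, f >>.
  by apply: cvgM; [exact: cvg_cst|exact: cvgL2_norm (fun n => (tb n hf).1) hf (cvgL2_trunc hf)].
by apply: (cvg_eq_lim _ l1 l2) => n; rewrite (ktr_bsupp_iso (tb n hf)).2.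
Qed.

Let cvgL2Z a (f_ : nat -> X -> R) f : (forall n, sq (f_ n)) -> sq f -> cvgL2 mu f_ f ->
  cvgL2 mu (fun n x => a * f_ n x) (fun x => a * f x).
Proof.
move=> h hf fc; rewrite /cvgL2 (_ : (fun n => _) = (fun n => a ^+ 2 * << f_ n \- f, f_ n \- f >>)).
  by rewrite -[X in _ --> X](mulr0 (a ^+ 2)); apply: cvgM fc; exact: cvg_cst.
apply/funext => n.
have hB := sqintB (h n) hf.
rewrite (_ : _ \- _ = (fun x => a * (f_ n \- f) x)); last by apply/funext => x /=; ring.
by rewrite ipZl//; [rewrite ipZr// mulrA|exact: sqintZ].
Qed.

Let cvgL2D (f_ g_ : nat -> X -> R) f g : (forall n, sq (f_ n)) -> (forall n, sq (g_ n)) ->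
  sq f -> sq g -> cvgL2 mu f_ f -> cvgL2 mu g_ g ->
  cvgL2 mu (fun n => f_ n \+ g_ n) (f \+ g).
Proof.
move=> hf_ hg_ hf hg fc gc.
apply: (@squeeze_cvgr _ _ _ _ (cst 0) (fun n => 2 * << f_ n \- f, f_ n \- f >> + 2 * << g_ n \- g, g_ n \- g >>)).
- apply: nearW => n; rewrite ip_ge0/=.
  rewrite (_ : _ \- _ = (f_ n \- f) \+ (g_ n \- g)); last by apply/funext => x /=; ring.
  by apply: ip_sqrD; exact: sqintB.
- exact: cvg_cst.
- rewrite [X in _ --> X](_ : _ = 2 * 0 + 2 * 0); last lra.
  by apply: cvgD; (apply: cvgM; first exact: cvg_cst).
Qed.

Lemma hartZ a f g : hart f g -> hart (fun x => a * f x) (fun x => a * g x).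
Proof.
move=> [hf hg fg]; split; [exact: sqintZ|exact: sqintZ|].
have := cvgL2Z a (fun n => (ktr_bsupp_iso (tb n hf)).1) hg fg.
rewrite (_ : (fun n => _) = (fun n => ktr (trunc n (fun x => a * f x))))//; apply/funext => n.
rewrite -ktrZ; last exact: bsupp_integrable (tb n hf).
by congr ktr; apply/funext => x; rewrite /trunc mulrCA.
Qed.

Lemma hartD f g f' g' : hart f g -> hart f' g' -> hart (f \+ f') (g \+ g').
Proof.
move=> [hf hg fg] [hf' hg' fg']; split; [exact: sqintD|exact: sqintD|].
have := cvgL2D (fun n => (ktr_bsupp_iso (tb n hf)).1) (fun n => (ktr_bsupp_iso (tb n hf')).1) hg hg' fg fg'.
rewrite (_ : (fun n => _) = (fun n => ktr (trunc n (f \+ f'))))//; apply/funext => n.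
rewrite -ktrD; [|exact: bsupp_integrable (tb n hf)|exact: bsupp_integrable (tb n hf')].
by congr ktr; apply/funext => x; rewrite /trunc /= mulrDr.
Qed.

Lemma hartB f g f' g' : hart f g -> hart f' g' -> hart (f \- f') (g \- g').
Proof.
move=> h1 /(hartZ (-1)) /(hartD h1).
by congr hart; apply/funext => x /=; rewrite mulN1r.
Qed.

Lemma hart_ip f g f' g' : hart f g -> hart f' g' -> << g, g' >> = c * << f, f' >>.
Proof.
move=> h h'; have E1 := hart_norm (hartD h h'); have E2 := hart_norm h.
have E3 := hart_norm h'; case: h h' => [hf hg _] [hf' hg' _].
have hs := sqintD hf hf'; have hs' := sqintD hg hg'.
move: E1; rewrite !(ipDl, ipDr)// E2 E3 (ipC _ g' g) (ipC _ f' f); lra.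
Qed.

Lemma hart_adjoint f g f' g' : hart f g -> hart f' g' -> << g, f' >> = << f, g' >>.
Proof.
move=> [hf hg fg] [hf' hg' fg'].
have l1 := cvgL2_ip (fun n => (ktr_bsupp_iso (tb n hf)).1) hg (fun n => (tb n hf').1) hf' fg (cvgL2_trunc hf').
have l2 := cvgL2_ip (fun n => (tb n hf).1) hf (fun n => (ktr_bsupp_iso (tb n hf')).1) hg' (cvgL2_trunc hf) fg'.
apply: (cvg_eq_lim _ l1 l2) => n; rewrite ktr_adjoint//; [exact: bsupp_integrable (tb n hf)|exact: bsupp_integrable (tb n hf')].
Qed.

Lemma hart_ae f g g' : hart f g -> measurable_fun setT g' ->
  {ae mu, forall x, g x = g' x} -> hart f g'.
Proof.
move=> [hf hg fg] mg' gg'; have hg' := sqint_ae mg' gg' hg; split=> //.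
move: fg; rewrite /cvgL2.
rewrite (_ : (fun n => ip mu (_ \- g) _) = (fun n => ip mu (ktr (trunc n f) \- g') (ktr (trunc n f) \- g')))//.
apply/funext => n.
have hk := (ktr_bsupp_iso (tb n hf)).1.
have ee : {ae mu, forall x, (ktr (trunc n f) \- g) x = (ktr (trunc n f) \- g') x}.
  by apply: filterS gg' => x /= ->.
have m1 := (sqintB hk hg).1; have m2 := (sqintB hk hg').1.
by rewrite (ae_eq_ip m1 m2 m1 ee) ipC (ae_eq_ip m1 m2 m2 ee).
Qed.

Lemma ip_separates f g : sq f -> sq g -> (forall h, sq h -> << f, h >> = << g, h >>) ->
  {ae mu, forall x, f x = g x}.
Proof.
move=> hf hg fg; have hB := sqintB hf hg.
have : << f \- g, f \- g >> = 0 by rewrite ipBl// fg// subrr.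
by move/(ip_eq0 hB); apply: filterS => x /= /eqP; rewrite subr_eq0 => /eqP.
Qed.

(* A symmetric isometry is an involution. *)
Lemma hart_inv f g : hart f g -> hart g (fun x => c * f x).
Proof.
move=> fg; have [hf hg _] := fg; have [k' gk] := hart_exists hg.
have [_ hk _] := gk.
apply: (hart_ae gk); first by have [] := sqintZ c hf.
apply: ip_separates => //; first exact: sqintZ.
move=> h hh; have [h' hh'] := hart_exists hh.
by rewrite (hart_adjoint gk hh') (hart_ip fg hh') ipZl.
Qed.

Lemma hart_bsupp n f : bsupp n f -> hart f (ktr f).
Proof.
move=> fb; split; [exact: fb.1|exact: (ktr_bsupp_iso fb).1|].
apply: cvg_near_cst; exists n => // m /= nm.
rewrite -(bsuppE (bsuppS nm fb)) (_ : _ \- _ = fun=> 0) ?ip0l//.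
by apply/funext => x /=; rewrite subrr.
Qed.

(** The L^2 transform [g] of [f] pairs to 0 with each of its own truncations, because that pairing
    moves over to [ktr f]. So [g] vanishes, and the isometry gives the claim without identifying [g]
    with [ktr f] pointwise. *)
Lemma ktr_eq0 f : sq f -> mu.-integrable setT (EFin \o f) ->
  (forall y, ktr f y = 0) -> {ae mu, forall x, f x = 0}.
Proof.
move=> hf fi k0; have [g fg] := hart_exists hf; have [_ hg _] := fg.
have gg : << g, g >> = 0.
  have l := cvgL2_ipl (fun n => (tb n hg).1) hg hg (cvgL2_trunc hg).
  apply: (cvg_eq_lim _ l (cvg_cst 0)) => n; rewrite ipC (hart_adjoint fg (hart_bsupp (tb n hg))).
  rewrite -ktr_adjoint//; last exact: bsupp_integrable (tb n hg).
  by rewrite (_ : ktr f = fun=> 0) ?ip0l//; apply/funext.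
apply: (ip_eq0 hf); have := hart_norm fg; rewrite gg => /esym/eqP.
by rewrite mulf_eq0 gt_eqF ?(ik_c K)//= => /eqP.
Qed.

End kernel_transform.

(** * Measure-preserving maps *)

Section measure_preserving.
Context d1 d2 (X : measurableType d1) (Y : measurableType d2) (R : realType).

Definition preserves d (Z : measurableType d) (mu : {measure set Z -> \bar R}) (s : Z -> Z) :=
  measurable_fun setT s /\ forall A, measurable A -> mu (s @^-1` A) = mu A.

Lemma preserves_integral d (Z : measurableType d) (mu : {measure set Z -> \bar R}) s
    (f : Z -> \bar R) : preserves mu s -> measurable_fun setT f ->
  (\int[mu]_x f (s x) = \int[mu]_x f x)%E.
Proof.
move=> [ms sP] mf.
have pos g : measurable_fun setT g -> (forall x, 0 <= g x)%E ->
    (\int[mu]_x g (s x) = \int[mu]_x g x)%E.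
  move=> mg g0.
  have /= <- := @ge0_integral_pushforward _ _ _ _ _ s ms mu setT g measurableT mg (fun x _ => g0 x).
  by apply: eq_measure_integral => A mA _; rewrite /= /pushforward sP.
rewrite integralE [RHS]integralE; congr (_ - _)%E.
- rewrite -(pos f^\+%E); first by apply: eq_integral => x _; rewrite !funeposE.
    exact: measurable_funepos.
  by move=> x; rewrite funepos_ge0.
- rewrite -(pos f^\-%E); first by apply: eq_integral => x _; rewrite !funenegE.
    exact: measurable_funeneg.
  by move=> x; rewrite funeneg_ge0.
Qed.

Lemma preserves_integrable d (Z : measurableType d) (mu : {measure set Z -> \bar R}) s
    (f : Z -> \bar R) : preserves mu s -> mu.-integrable setT f ->
  mu.-integrable setT (f \o s).
Proof.
move=> sP /integrableP[mf fi]; apply/integrableP; split.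
  by apply: measurableT_comp => //; case: sP.
rewrite (_ : integral _ _ _ = \int[mu]_x `|f x|)%E//.
rewrite -(preserves_integral sP (f := fun x => `|f x|)%E)//.
exact: measurableT_comp.
Qed.

Lemma preserves_Rintegral d (Z : measurableType d) (mu : {measure set Z -> \bar R}) s
    (f : Z -> R) : preserves mu s -> measurable_fun setT f ->
  \int[mu]_x f (s x) = \int[mu]_x f x.
Proof.
move=> sP mf; rewrite /Rintegral (preserves_integral sP (f := EFin \o f))//.
exact/measurable_EFinP.
Qed.

Lemma preserves_sqint d (Z : measurableType d) (mu : {measure set Z -> \bar R}) s
    (f : Z -> R) : preserves mu s -> sqint mu f -> sqint mu (f \o s).
Proof.
move=> sP [mf fi]; split; first by apply: measurableT_comp => //; case: sP.
exact: (preserves_integrable sP fi).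
Qed.

Lemma preserves_ip d (Z : measurableType d) (mu : {measure set Z -> \bar R}) s
    (f g : Z -> R) : preserves mu s -> measurable_fun setT f -> measurable_fun setT g ->
  ip mu (f \o s) (g \o s) = ip mu f g.
Proof.
move=> sP mf mg; rewrite /ip -(preserves_Rintegral sP (f := fun x => f x * g x))//.
exact: measurable_funM.
Qed.

(** Uniqueness of the product measure reduces the claim to rectangles. *)
Lemma preserves_prod (m1 : {sigma_finite_measure set X -> \bar R})
    (m2 : {sigma_finite_measure set Y -> \bar R}) s1 s2 :
  preserves m1 s1 -> preserves m2 s2 ->
  preserves (m1 \x m2)%E (fun p => (s1 p.1, s2 p.2)).
Proof.
move=> [ms1 s1P] [ms2 s2P].
have ms : measurable_fun setT (fun p : X * Y => (s1 p.1, s2 p.2)).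
  by apply/measurable_fun_pairP; split; [exact: (measurableT_comp ms1)|exact: (measurableT_comp ms2)].
split=> // A mA.
rewrite -[LHS]/(pushforward (m1 \x m2)%E (fun p : X * Y => (s1 p.1, s2 p.2)) A).
apply/esym/product_measure_unique => // B1 B2 mB1 mB2.
rewrite /= /pushforward (_ : _ @^-1` _ = (s1 @^-1` B1) `*` (s2 @^-1` B2)); last by apply/seteqP; split.
rewrite product_measure1E ?s1P ?s2P//.
- by rewrite -[X in measurable X]setTI; exact: ms1.
- by rewrite -[X in measurable X]setTI; exact: ms2.
Qed.

End measure_preserving.

(** A cylinder over a generator need not be a product of generators, but the exhaustions [Q1] and
    [Q2] make it a countable union of such products. *)
Lemma g_sigma_algebra_prod d1 d2 (X : measurableType d1) (Y : measurableType d2)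
    (B1 : set (set X)) (B2 : set (set Y)) (Q1 : nat -> set X) (Q2 : nat -> set Y) :
  (forall n, B1 (Q1 n)) -> (forall n, B2 (Q2 n)) ->
  (forall x, exists n, Q1 n x) -> (forall y, exists n, Q2 n y) ->
  @measurable _ X = <<s B1 >> -> @measurable _ Y = <<s B2 >> ->
  @measurable _ (X * Y)%type = <<s [set A `*` B | A in B1 & B in B2] >>.
Proof.
move=> BQ1 BQ2 QT1 QT2 g1 g2; set G := [set A `*` B | A in B1 & B in B2].
have sG := smallest_sigma_algebra setT G.
have Gcup (F : nat -> set (X * Y)) : (forall n, <<s G >> (F n)) -> <<s G >> (\bigcup_n F n).
  by move=> FG; exact: sigma_algebra_bigcup.
have GC A : <<s G >> A -> <<s G >> (~` A) by exact: sigma_algebraC.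
have GI A A' : <<s G >> A -> <<s G >> A' -> <<s G >> (A `&` A').
  move=> GA GA'; rewrite -[A `&` A']setCK setCI -bigcup2E; apply: (GC); apply: Gcup; by case=> [|[|n]] /=; do ?[exact: GC|exact: sigma_algebra0].
apply/seteqP; split; last first.
  apply: smallest_sub; first exact: sigma_algebra_measurable.
  move=> _ [A BA] [B BB] <-; apply: measurableX; [rewrite g1|rewrite g2]; exact: sub_sigma_algebra.
have cylL A : measurable A -> <<s G >> (A `*` setT).
  rewrite g1; suff sub : <<s B1 >> `<=` [set A | <<s G >> (A `*` setT)] by exact: sub.
  apply: smallest_sub; last first.
    move=> D BD /=; rewrite (_ : D `*` setT = \bigcup_n (D `*` Q2 n)).
      by apply: Gcup => n; apply: sub_sigma_algebra; exists D => //; exists (Q2 n).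
    apply/seteqP; split=> [[x y] [/= Dx _]|[x y] [n _ []]//].
    by have [n Qn] := QT2 y; exists n.
  split=> /=.
  - by rewrite set0X; exact: sigma_algebra0.
  - move=> D GD; rewrite setTD (_ : _ `*` _ = ~` (D `*` setT)); first exact: GC.
    by apply/seteqP; split=> [[x y] [/= nD _] [] //|[x y] /= nD]; split=> // Dx; exact: nD.
  - move=> F GF; rewrite (_ : _ `*` _ = \bigcup_n (F n `*` setT)); first exact: Gcup.
    by rewrite setX_bigcupl.
have cylR A : measurable A -> <<s G >> (setT `*` A).
  rewrite g2; suff sub : <<s B2 >> `<=` [set A | <<s G >> (setT `*` A)] by exact: sub.
  apply: smallest_sub; last first.
    move=> D BD /=; rewrite (_ : setT `*` D = \bigcup_n (Q1 n `*` D)).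
      by apply: Gcup => n; apply: sub_sigma_algebra; exists (Q1 n) => //; exists D.
    apply/seteqP; split=> [[x y] [/= _ Dy]|[x y] [n _ []]//].
    by have [n Qn] := QT1 x; exists n.
  split=> /=.
  - by rewrite setX0; exact: sigma_algebra0.
  - move=> D GD; rewrite setTD (_ : _ `*` _ = ~` (setT `*` D)); first exact: GC.
    by apply/seteqP; split=> [[x y] [/= _ nD] [] //|[x y] /= nD]; split=> // Dx; exact: nD.
  - move=> F GF; rewrite (_ : _ `*` _ = \bigcup_n (setT `*` F n)); first exact: Gcup.
    by rewrite setX_bigcupr.
rewrite measurable_prod_measurableType; apply: smallest_sub => //.
move=> _ [A mA] [B mB] <-.
rewrite (_ : A `*` B = (A `*` setT) `&` (setT `*` B)); first by apply: GI; [exact: cylL|exact: cylR].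
by apply/seteqP; split=> [[x y] [/= Ax By]|[x y] [[/= Ax _] [/= _ By]]].
Qed.

(* [C] and [S] play the roles of cos(x.xi) and sin(x.xi). *)
Record trig_kernel d (X : measurableType d) (R : realType)
    (mu : {sigma_finite_measure set X -> \bar R}) (C S : X -> X -> R)
    (Q : nat -> set X) (B : set (set X)) (c : R) : Prop := {
  tk_mC : measurable_fun setT (fun p : X * X => C p.1 p.2);
  tk_mS : measurable_fun setT (fun p : X * X => S p.1 p.2);
  tk_symC : forall x y, C x y = C y x;
  tk_symS : forall x y, S x y = S y x;
  tk_le : forall x y, C x y ^+ 2 + S x y ^+ 2 <= 1;
  tk_Q : forall n, B (Q n);
  tk_Qnd : forall m n, (m <= n)%N -> Q m `<=` Q n;
  tk_QT : forall x, exists n, Q n x;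
  tk_Bm : forall A, B A -> measurable A;
  tk_Bfin : forall A, B A -> (mu A < +oo)%E;
  tk_BI : setI_closed B;
  tk_Bgen : @measurable _ X = <<s B >>;
  tk_c : 0 < c;
  tk_sqC : forall A, B A -> sqint mu (ktr mu C \1_A);
  tk_sqS : forall A, B A -> sqint mu (ktr mu S \1_A);
  tk_iso : forall A A', B A -> B A' ->
    ip mu (ktr mu C \1_A) (ktr mu C \1_A') + ip mu (ktr mu S \1_A) (ktr mu S \1_A') =
    c * ip mu \1_A \1_A';
  tk_ortho : forall A A', B A -> B A' -> ip mu (ktr mu C \1_A) (ktr mu S \1_A') = 0 }.

Section trig_kernel_theory.
Context d (X : measurableType d) (R : realType).
Variables (mu : {sigma_finite_measure set X -> \bar R}) (C S : X -> X -> R).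
Variables (Q : nat -> set X) (B : set (set X)) (c : R).
Hypothesis K : trig_kernel mu C S Q B c.

Lemma tk_C1 x y : `|C x y| <= 1.
Proof.
have := tk_le K x y; have := sqr_ge0 (S x y); rewrite -[C x y ^+ 2]real_normK ?num_real//.
have := normr_ge0 (C x y); nra.
Qed.

Lemma tk_S1 x y : `|S x y| <= 1.
Proof.
have := tk_le K x y; have := sqr_ge0 (C x y); rewrite -[S x y ^+ 2]real_normK ?num_real//.
have := normr_ge0 (S x y); nra.
Qed.

Lemma tk_integrable_indic A : B A -> mu.-integrable setT (EFin \o \1_A).
Proof.
move=> BA; apply/integrableP; split.
  by apply/measurable_EFinP; exact: measurable_indic (tk_Bm K BA).
rewrite (eq_integral (EFin \o \1_A)).
  by rewrite integral_indic// ?setIT ?(tk_Bfin K)//; exact: (tk_Bm K).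
by move=> x _ /=; rewrite ger0_norm.
Qed.

Let integrable_bounded (h : X -> X -> R) A y :
  measurable_fun setT (fun p : X * X => h p.1 p.2) -> (forall x y, `|h x y| <= 1) -> B A ->
  mu.-integrable setT (EFin \o (fun x => \1_A x * h x y)).
Proof.
move=> mh h1 BA; apply: (le_integrable_EFin _ _ (tk_integrable_indic BA)).
  apply: measurable_funM; first exact: measurable_indic (tk_Bm K BA).
  exact: (measurable_fun_pair1 (f := fun p => h p.1 p.2) y mh).
by move=> x; rewrite normrM [`|\1_A x|]ger0_norm// ler_piMr.
Qed.

Lemma tk_integrableC A y : B A -> mu.-integrable setT (EFin \o (fun x => \1_A x * C x y)).
Proof. exact: integrable_bounded (tk_mC K) tk_C1. Qed.

Lemma tk_integrableS A y : B A -> mu.-integrable setT (EFin \o (fun x => \1_A x * S x y)).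
Proof. exact: integrable_bounded (tk_mS K) tk_S1. Qed.

(** The mixed terms in the pairing of C + S with itself vanish by [tk_ortho]. *)
Lemma isometric_kernel_trig : isometric_kernel mu (fun x y => C x y + S x y) Q B c.
Proof.
have ktrE A : B A -> ktr mu (fun x y => C x y + S x y) \1_A = ktr mu C \1_A \+ ktr mu S \1_A.
  move=> BA; apply/funext => y; rewrite /ktr /= -RintegralD//; last 2 first.
  - exact: tk_integrableC.
  - exact: tk_integrableS.
  by apply: eq_Rintegral => x _; rewrite mulrDr.
split; try by case: K.
- by apply: measurable_funD; case: K.
- by move=> x y; rewrite (tk_symC K) (tk_symS K).
- move=> x y; apply: (le_trans (ler_normD _ _)).
  by have := tk_C1 x y; have := tk_S1 x y; lra.
- by move=> A BA; rewrite ktrE//; apply: sqintD; [exact: (tk_sqC K BA)|exact: (tk_sqS K BA)].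
- move=> A A' BA BA'; rewrite !ktrE//.
  have hC := tk_sqC K BA; have hS := tk_sqS K BA; have hC' := tk_sqC K BA'; have hS' := tk_sqS K BA'.
  have hs' := sqintD hC' hS'.
  rewrite ipDl// !ipDr// (tk_ortho K BA BA') (ipC _ (ktr mu S \1_A)) (tk_ortho K BA' BA).
  by rewrite addr0 add0r (tk_iso K).
Qed.

End trig_kernel_theory.

(* The library's sigma-finiteness instance for product measures is shadowed by
   the one for subprobabilities, hence this explicit packing. *)
Section sigma_finite_product.
Context d1 d2 (X : measurableType d1) (Y : measurableType d2) (R : realType).
Variables (m1 : {sigma_finite_measure set X -> \bar R})
          (m2 : {sigma_finite_measure set Y -> \bar R}).

Lemma sigma_finite_prod : sigma_finite setT (m1 \x m2)%E.
Proof.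
have /sigma_finiteP[F [TF ndF Foo]] := sigma_finiteT m1.
have /sigma_finiteP[G [TG ndG Goo]] := sigma_finiteT m2.
exists (fun n => F n `*` G n).
  apply/esym; rewrite -subTset => -[x y] _.
  have [n _ Fx] : (\bigcup_n F n) x by rewrite -TF.
  have [m _ Gy] : (\bigcup_n G n) y by rewrite -TG.
  exists (maxn n m) => //; split.
    by move: x Fx; apply/subsetPset/ndF/leq_maxl.
  by move: y Gy; apply/subsetPset/ndG/leq_maxr.
move=> n; have [mF Fn] := Foo n; have [mG Gn] := Goo n.
split; first exact: measurableX.
by rewrite product_measure1E// lte_mul_pinfty// ge0_fin_numE.
Qed.

Definition prod_measure : {sigma_finite_measure set (X * Y)%type -> \bar R} :=
  HB.pack (m1 \x m2)%E (Measure_isSigmaFinite.Build _ _ _ (m1 \x m2)%E sigma_finite_prod).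

Lemma prod_measureE A A' : measurable A -> measurable A' ->
  prod_measure (A `*` A') = (m1 A * m2 A')%E.
Proof. by move=> mA mA'; exact: product_measure1E. Qed.

Lemma integrable_pmM (f : X -> R) (g : Y -> R) :
  m1.-integrable setT (EFin \o f) -> m2.-integrable setT (EFin \o g) ->
  prod_measure.-integrable setT (EFin \o (fun p : X * Y => f p.1 * g p.2)).
Proof. exact: integrable_prodM. Qed.

Lemma Rintegral_pmM (f : X -> R) (g : Y -> R) :
  m1.-integrable setT (EFin \o f) -> m2.-integrable setT (EFin \o g) ->
  \int[prod_measure]_p (f p.1 * g p.2) = (\int[m1]_x f x) * (\int[m2]_y g y).
Proof. exact: Rintegral_prodM. Qed.

End sigma_finite_product.

(** * Products of trigonometric kernels *)

Section trig_kernel_prod.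
Context d1 d2 (X : measurableType d1) (Y : measurableType d2) (R : realType).
Variables (m1 : {sigma_finite_measure set X -> \bar R}) (C1 S1 : X -> X -> R).
Variables (Q1 : nat -> set X) (B1 : set (set X)) (c1 : R).
Variables (m2 : {sigma_finite_measure set Y -> \bar R}) (C2 S2 : Y -> Y -> R).
Variables (Q2 : nat -> set Y) (B2 : set (set Y)) (c2 : R).

(** The real and imaginary parts of the product of C1 + i S1 and C2 + i S2, that is the addition
    formulas. *)
Definition prodC (p q : X * Y) := C1 p.1 q.1 * C2 p.2 q.2 - S1 p.1 q.1 * S2 p.2 q.2.
Definition prodS (p q : X * Y) := S1 p.1 q.1 * C2 p.2 q.2 + C1 p.1 q.1 * S2 p.2 q.2.

Hypothesis K1 : trig_kernel m1 C1 S1 Q1 B1 c1.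
Hypothesis K2 : trig_kernel m2 C2 S2 Q2 B2 c2.

Local Notation m12 := (prod_measure m1 m2).
Let B12 := [set A `*` B | A in B1 & B in B2].

Let indicX (A : set X) (A' : set Y) p : \1_(A `*` A') p = \1_A p.1 * \1_A' p.2 :> R.
Proof. by rewrite !indicE in_setX; case: (_ \in A); case: (_ \in A'); rewrite ?mulr1 ?mulr0 ?mul0r. Qed.

Let ktr_prodC A A' : B1 A -> B2 A' -> ktr m12 prodC \1_(A `*` A') =
  (fun q => ktr m1 C1 \1_A q.1 * ktr m2 C2 \1_A' q.2) \-
  (fun q => ktr m1 S1 \1_A q.1 * ktr m2 S2 \1_A' q.2).
Proof.
move=> BA BA'; apply/funext => q; rewrite /ktr /=.
have iC1 := tk_integrableC K1 q.1 BA; have iS1 := tk_integrableS K1 q.1 BA.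
have iC2 := tk_integrableC K2 q.2 BA'; have iS2 := tk_integrableS K2 q.2 BA'.
rewrite -(Rintegral_pmM iC1 iC2) -(Rintegral_pmM iS1 iS2) -RintegralB//; last 2 first.
- exact: integrable_pmM iC1 iC2.
- exact: integrable_pmM iS1 iS2.
by apply: eq_Rintegral => p _; rewrite indicX /prodC; ring.
Qed.

Let ktr_prodS A A' : B1 A -> B2 A' -> ktr m12 prodS \1_(A `*` A') =
  (fun q => ktr m1 S1 \1_A q.1 * ktr m2 C2 \1_A' q.2) \+
  (fun q => ktr m1 C1 \1_A q.1 * ktr m2 S2 \1_A' q.2).
Proof.
move=> BA BA'; apply/funext => q; rewrite /ktr /=.
have iC1 := tk_integrableC K1 q.1 BA; have iS1 := tk_integrableS K1 q.1 BA.
have iC2 := tk_integrableC K2 q.2 BA'; have iS2 := tk_integrableS K2 q.2 BA'.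
rewrite -(Rintegral_pmM iS1 iC2) -(Rintegral_pmM iC1 iS2) -RintegralD//; last 2 first.
- exact: integrable_pmM iS1 iC2.
- exact: integrable_pmM iC1 iS2.
by apply: eq_Rintegral => p _; rewrite indicX /prodS; ring.
Qed.

Let sqint_prod f g : sqint m1 f -> sqint m2 g -> sqint m12 (fun p => f p.1 * g p.2).
Proof.
move=> [mf fi] [mg gi]; split.
  by apply: measurable_funM; [exact: (measurableT_comp mf)|exact: (measurableT_comp mg)].
have := integrable_pmM fi gi; apply: eq_integrable => // p _ /=.
by rewrite exprMn.
Qed.

Let ip_prod f f' g g' : sqint m1 f -> sqint m1 f' -> sqint m2 g -> sqint m2 g' ->
  ip m12 (fun p => f p.1 * g p.2) (fun p => f' p.1 * g' p.2) = ip m1 f f' * ip m2 g g'.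
Proof.
move=> hf hf' hg hg'.
rewrite /ip -(Rintegral_pmM (integrable_sqintM hf hf') (integrable_sqintM hg hg')).
by apply: eq_Rintegral => p _ /=; ring.
Qed.

(** Once the mixed pairings of the first factor vanish, the sum of the cosine and sine pairings
    splits into the product of the corresponding sums for the two factors. *)
Lemma trig_kernel_prod : trig_kernel m12 prodC prodS (fun n => Q1 n `*` Q2 n) B12 (c1 * c2).
Proof.
have mp (h : X -> X -> R) : measurable_fun setT (fun p : X * X => h p.1 p.2) ->
    measurable_fun setT (fun p : (X * Y) * (X * Y) => h p.1.1 p.2.1).
  move=> mh; apply: (measurableT_comp (f := fun p : X * X => h p.1 p.2) (g := fun p : (X * Y) * (X * Y) => (p.1.1, p.2.1))) => //.
  by apply/measurable_fun_pairP; split; [exact: (measurableT_comp measurable_fst measurable_fst)|exact: (measurableT_comp measurable_fst measurable_snd)].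
have mp' (h : Y -> Y -> R) : measurable_fun setT (fun p : Y * Y => h p.1 p.2) ->
    measurable_fun setT (fun p : (X * Y) * (X * Y) => h p.1.2 p.2.2).
  move=> mh; apply: (measurableT_comp (f := fun p : Y * Y => h p.1 p.2) (g := fun p : (X * Y) * (X * Y) => (p.1.2, p.2.2))) => //.
  by apply/measurable_fun_pairP; split; [exact: (measurableT_comp measurable_snd measurable_fst)|exact: (measurableT_comp measurable_snd measurable_snd)].
split.
- apply: measurable_funB; apply: measurable_funM; [apply: mp|apply: mp'|apply: mp|apply: mp'];
  by [case: K1|case: K2].
- apply: measurable_funD; apply: measurable_funM; [apply: mp|apply: mp'|apply: mp|apply: mp'];
  by [case: K1|case: K2].
- by move=> p q; rewrite /prodC (tk_symC K1) (tk_symC K2) (tk_symS K1) (tk_symS K2).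
- by move=> p q; rewrite /prodS (tk_symC K1) (tk_symC K2) (tk_symS K1) (tk_symS K2).
- move=> p q; rewrite (_ : _ + _ = (C1 p.1 q.1 ^+ 2 + S1 p.1 q.1 ^+ 2) * (C2 p.2 q.2 ^+ 2 + S2 p.2 q.2 ^+ 2)).
    by rewrite mulr_ile1 ?(tk_le K1) ?(tk_le K2)// addr_ge0 ?sqr_ge0.
  by rewrite /prodC /prodS; ring.
- by move=> n; exists (Q1 n); [exact: (tk_Q K1 n)|exists (Q2 n) => //; exact: (tk_Q K2 n)].
- by move=> m n mn [x y] [/= Qx Qy]; split; [exact: (tk_Qnd K1 mn)|exact: (tk_Qnd K2 mn)].
- move=> [x y]; have [n Qn] := tk_QT K1 x; have [m Qm] := tk_QT K2 y.
  exists (maxn n m); split; [exact: (tk_Qnd K1 (leq_maxl _ _) Qn)|exact: (tk_Qnd K2 (leq_maxr _ _) Qm)].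
- by move=> _ [A BA] [A' BA'] <-; apply: measurableX; [exact: (tk_Bm K1 BA)|exact: (tk_Bm K2 BA')].
- move=> _ [A BA] [A' BA'] <-; rewrite prod_measureE; last 2 first.
  + exact: (tk_Bm K1 BA).
  + exact: (tk_Bm K2 BA').
  apply: lte_mul_pinfty => //; last exact: (tk_Bfin K2 BA').
  by rewrite ge0_fin_numE//; exact: (tk_Bfin K1 BA).
- move=> _ _ [A BA] [A' BA'] <- [D BD] [D' BD'] <-; rewrite -setXI.
  by exists (A `&` D); [exact: (tk_BI K1 BA BD)|exists (A' `&` D') => //; exact: (tk_BI K2 BA' BD')].
- exact: (g_sigma_algebra_prod (tk_Q K1) (tk_Q K2) (tk_QT K1) (tk_QT K2) (tk_Bgen K1) (tk_Bgen K2)).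
- by rewrite mulr_gt0 ?(tk_c K1) ?(tk_c K2).
- move=> _ [A BA] [A' BA'] <-; rewrite ktr_prodC//; apply: sqintB; apply: sqint_prod.
  + exact: (tk_sqC K1 BA).
  + exact: (tk_sqC K2 BA').
  + exact: (tk_sqS K1 BA).
  + exact: (tk_sqS K2 BA').
- move=> _ [A BA] [A' BA'] <-; rewrite ktr_prodS//; apply: sqintD; apply: sqint_prod.
  + exact: (tk_sqS K1 BA).
  + exact: (tk_sqC K2 BA').
  + exact: (tk_sqC K1 BA).
  + exact: (tk_sqS K2 BA').
- move=> _ _ [A BA] [A' BA'] <- [D BD] [D' BD'] <-; rewrite !ktr_prodC// !ktr_prodS//.
  have a1 := tk_sqC K1 BA; have a2 := tk_sqS K1 BA; have a3 := tk_sqC K2 BA'; have a4 := tk_sqS K2 BA'.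
  have e1 := tk_sqC K1 BD; have e2 := tk_sqS K1 BD; have e3 := tk_sqC K2 BD'; have e4 := tk_sqS K2 BD'.
  have p13 := sqint_prod a1 a3; have p24 := sqint_prod a2 a4; have p23 := sqint_prod a2 a3; have p14 := sqint_prod a1 a4.
  have q13 := sqint_prod e1 e3; have q24 := sqint_prod e2 e4; have q23 := sqint_prod e2 e3; have q14 := sqint_prod e1 e4.
  have qB := sqintB q13 q24; have qD := sqintD q23 q14.
  rewrite ipBl// !ipBr// ipDl// !ipDr// !ip_prod//.
  have -> : ip m12 \1_(A `*` A') \1_(D `*` D') = ip m1 \1_A \1_D * ip m2 \1_A' \1_D'.
    rewrite -ip_prod//; first by congr ip; apply/funext => p; rewrite indicX.
    - exact: sqint_indic (isometric_kernel_trig K1) _ BA.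
    - exact: sqint_indic (isometric_kernel_trig K1) _ BD.
    - exact: sqint_indic (isometric_kernel_trig K2) _ BA'.
    - exact: sqint_indic (isometric_kernel_trig K2) _ BD'.
  rewrite mulrACA -(tk_iso K1 BA BD) -(tk_iso K2 BA' BD').
  have o1 := tk_ortho K1 BA BD.
  have o2 : ip m1 (ktr m1 S1 \1_A) (ktr m1 C1 \1_D) = 0 by rewrite ipC (tk_ortho K1).
  rewrite o1 o2.
  move: (ip m1 (ktr m1 C1 \1_A) (ktr m1 C1 \1_D)) (ip m1 (ktr m1 S1 \1_A) (ktr m1 S1 \1_D))
    (ip m2 (ktr m2 C2 \1_A') (ktr m2 C2 \1_D')) (ip m2 (ktr m2 S2 \1_A') (ktr m2 S2 \1_D'))
    (ip m2 (ktr m2 C2 \1_A') (ktr m2 S2 \1_D')) (ip m2 (ktr m2 S2 \1_A') (ktr m2 C2 \1_D')).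
  by move=> *; ring.
- move=> _ _ [A BA] [A' BA'] <- [D BD] [D' BD'] <-; rewrite !ktr_prodC// !ktr_prodS//.
  have a1 := tk_sqC K1 BA; have a2 := tk_sqS K1 BA; have a3 := tk_sqC K2 BA'; have a4 := tk_sqS K2 BA'.
  have e1 := tk_sqC K1 BD; have e2 := tk_sqS K1 BD; have e3 := tk_sqC K2 BD'; have e4 := tk_sqS K2 BD'.
  have p13 := sqint_prod a1 a3; have p24 := sqint_prod a2 a4.
  have q23 := sqint_prod e2 e3; have q14 := sqint_prod e1 e4.
  have qD := sqintD q23 q14.
  rewrite ipBl// !ipDr// !ip_prod//.
  have o1 := tk_ortho K1 BA BD; have o3 := tk_ortho K2 BA' BD'.
  have o2 : ip m1 (ktr m1 S1 \1_A) (ktr m1 C1 \1_D) = 0 by rewrite ipC (tk_ortho K1).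
  have o4 : ip m2 (ktr m2 S2 \1_A') (ktr m2 C2 \1_D') = 0 by rewrite ipC (tk_ortho K2).
  by rewrite o1 o2 o3 o4 !(mul0r, mulr0, addr0, subr0).
Qed.

End trig_kernel_prod.

Lemma ae_mono d (X : measurableType d) (R : realType) (mu : {measure set X -> \bar R}) (P Q : X -> Prop) :
  {ae mu, forall x, P x} -> (forall x, P x -> Q x) -> {ae mu, forall x, Q x}.
Proof. by move=> aeP PQ; apply: filterS aeP. Qed.

Lemma ae_mono2 d (X : measurableType d) (R : realType) (mu : {measure set X -> \bar R}) (P Q S : X -> Prop) :
  {ae mu, forall x, P x} -> {ae mu, forall x, Q x} -> (forall x, P x -> Q x -> S x) ->
  {ae mu, forall x, S x}.
Proof. by move=> aeP aeQ PQ; apply: filterS2 aeP aeQ. Qed.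

(** Real powers are measurable, and x^-1 = x (x^2)^-1 holds at 0 too, where both sides are 0. *)
Lemma measurable_inv (R : realType) : measurable_fun setT (@GRing.inv R).
Proof.
rewrite (_ : @GRing.inv R = (fun x => x * (x ^+ 2) `^ (-1))).
  apply: measurable_funM => //; apply: (measurableT_comp (measurable_powR _)) => //.
apply/funext => x; rewrite powR_inv1 ?sqr_ge0//.
have [->|x0] := eqVneq x 0; first by rewrite invr0 mul0r.
by field.
Qed.

Lemma measurable_cos (R : realType) : measurable_fun setT (@cos R).
Proof. by apply: continuous_measurable_fun; exact: continuous_cos. Qed.

Lemma measurable_sin (R : realType) : measurable_fun setT (@sin R).
Proof. by apply: continuous_measurable_fun; exact: continuous_sin. Qed.

Lemma is_derive_mulr (R : realType) (x y : R) : is_derive x 1 (fun x => x * y) y.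
Proof.
apply: is_derive_eq; rewrite scaler0 add0r.
by rewrite /GRing.scale/= mulr1.
Qed.

Lemma is_derive_sin_mulr (R : realType) (x y : R) :
  is_derive x 1 (fun x => sin (x * y)) (cos (x * y) * y).
Proof. by have := @is_derive1_comp R (@sin R) (fun x => x * y) x _ _ (is_derive_sin (x * y)) (is_derive_mulr x y). Qed.

Lemma is_derive_cos_mulr (R : realType) (x y : R) :
  is_derive x 1 (fun x => cos (x * y)) (- sin (x * y) * y).
Proof. by have := @is_derive1_comp R (@cos R) (fun x => x * y) x _ _ (is_derive_cos (x * y)) (is_derive_mulr x y). Qed.

Definition leb (R : realType) : {sigma_finite_measure set (measurableTypeR R) -> \bar R} :=
  @lebesgue_measure R.
Arguments leb {R}.

(** * The Hartley transform on the line and on the space *)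

Section lebesgue_line.
Context {R : realType}.
Local Notation lam := (@leb R).
Local Notation L := (measurableTypeR R).

Lemma lebesgue_preserves_opp : preserves lam (fun x : R => - x).
Proof. by split; [exact: oppr_measurable|move=> A mA; exact: lebesgue_measureN]. Qed.

Lemma lebesgue_preserves_shift (a : R) : preserves lam (fun x : R => x + a).
Proof.
have ms : measurable_fun setT (fun x : R => x + a) by apply: measurable_funD.
split=> // A mA; rewrite -[LHS]/(pushforward lam ((fun x : R => x + a) : _ -> L) A).
apply/esym/lebesgue_measure_unique => //= _ [[u v]] _ <-.
rewrite /pushforward.
rewrite (_ : _ @^-1` _ = `]u - a, v - a]%classic); last first.
  by apply/seteqP; split=> x /=; rewrite !in_itv/= ltrBlDr lerBrDr.
rewrite !lebesgue_measure_itv/= !lte_fin ltrD2r.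
by case: ifP => // _; rewrite -!EFinB opprB addrA subrK.
Qed.

Lemma lebesgue_scale (a : R) (f : L -> \bar R) : 0 < a -> measurable_fun setT f ->
  (forall x, 0 <= f x)%E -> (\int[lam]_x f x = a%:E * \int[lam]_x f (a * x)%R)%E.
Proof.
move=> a0 mf f0.
pose sc : L -> L := fun x => a * x.
have ms : measurable_fun setT sc by exact: measurable_funM.
pose a' : {nonneg R} := NngNum (ltW a0).
have /= <- := @ge0_integral_pushforward _ _ _ _ _ sc ms lam setT f measurableT mf (fun x _ => f0 x).
have /= <- := ge0_integral_mscale (pushforward lam sc) measurableT a' mf (fun x _ => f0 x).
apply: eq_measure_integral => A mA _; apply: lebesgue_measure_unique => //= _ [[u v]] _ <-.
rewrite /mscale/= /pushforward.
rewrite (_ : _ @^-1` _ = `]u / a, v / a]%classic); last first.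
  by apply/seteqP; split=> x /=; rewrite !in_itv/= ltr_pdivrMr// ler_pdivlMr// ![x * a]mulrC.
rewrite !lebesgue_measure_itv/= !lte_fin ltr_pM2r ?invr_gt0//.
case: ifP => _; last by rewrite mule0.
by rewrite -!EFinB -EFinM; congr EFin; field; rewrite gt_eqF.
Qed.

Lemma ae_neq (a : R) : {ae lam, forall x : R, x != a}.
Proof.
exists [set a]; split; [exact: measurable_set1|exact: lebesgue_measure_set1|].
by move=> x /= /negP/negPn/eqP.
Qed.

(** The integral over the positive half-line is known; the reflection x -> -x handles the negative
    one. *)
Lemma integrable_oneDsqrV : lam.-integrable setT (EFin \o (fun x : L => (1 + x ^+ 2)^-1)).
Proof.
rewrite /comp.
have m : measurable_fun setT (fun x : L => (1 + x ^+ 2)^-1%:E).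
  apply/measurable_EFinP; apply: (measurableT_comp (@measurable_inv R)).
  by apply: measurable_funD => //; exact: measurable_funX.
apply/integrableP; split => //.
have g0 (x : R) : (0 <= (1 + x ^+ 2)^-1%:E)%E.
  by rewrite lee_fin invr_ge0 addr_ge0 ?sqr_ge0.
under eq_integral do rewrite gee0_abs//.
rewrite (_ : setT = `]-oo, 0%R[ `|` `[0, +oo[ :> set R); last first.
  by apply/esym; rewrite -subTset => x _ /=; rewrite !in_itv/= andbT; case: (ltP x 0); [left|right].
rewrite ge0_integral_setU//; last 2 first.
- exact: measurable_funTS.
- apply/disj_setPS => x []/=; rewrite !in_itv/= andbT => x0 x1.
  by move: (lt_le_trans x0 x1); rewrite ltxx.
have h : (\int[lam]_(x in `[0%R, +oo[) (1 + x ^+ 2)^-1%:E < +oo)%E.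
  by have := @integral0y_oneDsqr R; rewrite /oneDsqr => ->; rewrite ltry.
rewrite lte_add_pinfty//.
move: h; rewrite (ge0_integration_by_substitution0 m)//; apply: le_lt_trans.
under [leRHS]eq_integral do rewrite sqrrN.
apply: ge0_subset_integral => //; first exact: measurable_funTS.
by move=> x /=; rewrite !in_itv/=; exact: ltW.
Qed.

Lemma leb_itv (i : interval R) : lam [set` i] = (if i.1 < i.2 then (i.2 : \bar R) - i.1 else 0)%E.
Proof. exact: lebesgue_measure_itv. Qed.

(** Products of transforms of interval indicators are combinations of these kernels, whose integral
    is proportional to |a|. The value at x = 0 is 0. *)
Definition ddcos (a : R) (x : L) : R := (1 - cos (x * a)) / x ^+ 2.

Lemma ddcos_ge0 a x : 0 <= ddcos a x.
Proof. by rewrite divr_ge0 ?sqr_ge0// subr_ge0 cos_le1. Qed.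

Lemma measurable_ddcos a : measurable_fun setT (ddcos a).
Proof.
apply: measurable_funM.
  apply: measurable_funB => //; apply: (measurableT_comp (@measurable_cos R)).
  exact: measurable_funM.
by apply: (measurableT_comp (@measurable_inv R)); exact: measurable_funX.
Qed.

Lemma sin_le_norm (x : R) : `|sin x| <= `|x|.
Proof.
wlog x0 : x / 0 <= x.
  move=> H; have [/H//|/ltW x0] := leP 0 x.
  by have := H (- x); rewrite oppr_ge0 sinN !normrN; apply.
have [->|xn0] := eqVneq x 0; first by rewrite sin0.
have {}x0 : 0 < x by rewrite lt_neqAle eq_sym xn0.
have [|c _] := @MVT R (@sin R) (@cos R) 0 x x0 (fun y _ => is_derive_sin y).
  by apply: continuous_subspaceT; exact: continuous_sin.
rewrite sin0 !subr0 => ->; rewrite normrM ler_piMl//; exact: cos_max.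
Qed.

Lemma cos_ge_quadratic (x : R) : 1 - cos x <= x ^+ 2.
Proof.
have -> : cos x = 1 - 2 * sin (x / 2) ^+ 2.
  rewrite {1}(_ : x = x / 2 + x / 2); last by field.
  rewrite cosD -!expr2 cos2sin2; lra.
have : sin (x / 2) ^+ 2 <= (x / 2) ^+ 2.
  rewrite -[sin _ ^+ 2]real_normK ?num_real// -[(x / 2) ^+ 2]real_normK ?num_real//.
  by rewrite ler_pXn2r// ?nnegrE//; exact: sin_le_norm.
rewrite expr_div_n (_ : 2 ^+ 2 = 4 :> R); last by rewrite expr2; lra.
have := sqr_ge0 x; lra.
Qed.

Lemma integrable_ddcos1 : lam.-integrable setT (EFin \o ddcos 1).
Proof.
(* The constant comes from (1 - cos x)(1 + x^2) <= x^2 + 2 x^2. *)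
apply: (le_integrable_EFin (measurable_ddcos 1) _ (integrable_EFinZ 3 integrable_oneDsqrV)).
move=> x; rewrite ger0_norm ?ddcos_ge0// /ddcos mulr1.
have x2 := sqr_ge0 x.
have [->|x0] := eqVneq x 0.
  by rewrite expr0n/= invr0 mulr0 mulr_ge0// invr_ge0 addr_ge0.
have x20 : 0 < x ^+ 2 by rewrite lt_neqAle eq_sym expf_eq0/= x0.
rewrite ler_pdivrMr// mulrAC ler_pdivlMr; last by rewrite ltr_wpDr.
have := cos_ge_quadratic x; have := cos_geN1 x; have := cos_le1 x.
move: (cos x) (x ^+ 2) x20 => c q q0 *; nra.
Qed.

(** Its value is pi; only positivity is used. *)
Definition ddcos_const : R := \int[lam]_x ddcos 1 x.

(** The integrand is positive on ]0, pi], because cosine is injective on [0, pi]. *)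
Lemma ddcos_const_gt0 : 0 < ddcos_const.
Proof.
have c0 : 0 <= ddcos_const by apply: Rintegral_ge0 => x _; exact: ddcos_ge0.
rewrite lt_neqAle c0 andbT; apply/negP => /eqP cE.
have i0 : (\int[lam]_x `|(EFin \o ddcos 1) x| = 0)%E.
  under eq_integral do rewrite gee0_abs ?lee_fin ?ddcos_ge0//.
  by rewrite -(fineK (integrable_fin_num measurableT integrable_ddcos1)); congr EFin; exact/esym.
have md : measurable_fun setT (EFin \o ddcos 1) by apply/measurable_EFinP; exact: measurable_ddcos.
have [N [mN N0 Nsub]] := (ae_eq_integral_abs lam measurableT md).1 i0.
have : (lam `]0%R, pi[%classic <= lam N)%E.
  have m0 : measurable (`]0%R, pi[%classic : set L) by exact: measurable_itv.
  apply: (@le_measure _ _ _ lam); rewrite ?inE//.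
  move=> x /=; rewrite in_itv/= => /andP[x0 xpi]; apply: Nsub => /= /(_ I) [].
  apply/eqP; rewrite /ddcos mulr1 mulf_neq0 ?invr_neq0 ?expf_neq0 ?(gt_eqF x0)//.
  rewrite subr_eq0; apply/eqP => c1.
  have : 0 = x.
    by apply: cos_inj; rewrite ?in_itv/= ?lexx ?pi_ge0 ?(ltW x0) ?(ltW xpi)// cos0.
  by move=> x0'; rewrite -x0' ltxx in x0.
by rewrite N0 leb_itv/= lte_fin pi_gt0 -EFinB subr0 lee_fin leNgt pi_gt0.
Qed.

(** A change of scale, as [ddcos 1] at a x is [ddcos a] at x divided by a^2. *)
Lemma integral_ddcos_pos (a : R) : 0 < a ->
  (\int[lam]_x (ddcos a x)%:E = (a * ddcos_const)%:E)%E.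
Proof.
move=> a0.
have -> : (a * ddcos_const)%:E = (a%:E * \int[lam]_x (ddcos 1 x)%:E)%E.
  by rewrite EFinM /ddcos_const /Rintegral fineK//; exact: integrable_fin_num integrable_ddcos1.
rewrite (lebesgue_scale (f := fun x => (ddcos 1 x)%:E) a0); last 2 first.
- by apply/measurable_EFinP; exact: measurable_ddcos.
- by move=> x; rewrite lee_fin ddcos_ge0.
rewrite muleA -EFinM -ge0_integralZl//; last 3 first.
- by apply/measurable_EFinP; apply: (measurableT_comp (measurable_ddcos 1)); exact: measurable_funM.
- by move=> x _; rewrite lee_fin ddcos_ge0.
- by rewrite lee_fin mulr_ge0// ltW.
apply: eq_integral => x _; rewrite -EFinM; congr EFin.
rewrite /ddcos mulr1 (mulrC x) exprMn invfM.
have [->|x0] := eqVneq x 0; first by rewrite mulr0 cos0 subrr !mul0r mulr0.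
by field; rewrite x0 gt_eqF.
Qed.

Lemma integrable_ddcos a : lam.-integrable setT (EFin \o ddcos a) /\
  \int[lam]_x ddcos a x = `|a| * ddcos_const.
Proof.
have key b : 0 < b -> lam.-integrable setT (EFin \o ddcos b) /\
    \int[lam]_x ddcos b x = b * ddcos_const.
  move=> b0; have E := integral_ddcos_pos b0; split; last by rewrite /Rintegral E.
  apply/integrableP; split; first by apply/measurable_EFinP; exact: measurable_ddcos.
  under eq_integral do rewrite gee0_abs ?lee_fin ?ddcos_ge0//.
  by rewrite E ltry.
have [a0|a0|->] := ltgtP a 0.
- rewrite (_ : ddcos a = ddcos (- a)); last first.
    by apply/funext => x; rewrite /ddcos mulrN cosN.
  by rewrite ltr0_norm//; apply: key; rewrite oppr_gt0.
- by rewrite gtr0_norm//; exact: key.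
- rewrite (_ : ddcos 0 = fun=> 0); last by apply/funext => x; rewrite /ddcos mulr0 cos0 subrr mul0r.
  rewrite normr0 mul0r; split; first exact: integrable0.
  by rewrite /Rintegral integral0.
Qed.

(* The transforms of the indicator of an interval with endpoints a and b, away
   from the origin; the division by 0 makes them vanish there. *)
Definition citv (a b : R) (y : L) : R := (sin (b * y) - sin (a * y)) / y.
Definition sitv (a b : R) (y : L) : R := (cos (a * y) - cos (b * y)) / y.

Definition kcos (x y : L) : R := cos (x * y).
Definition ksin (x y : L) : R := sin (x * y).

(** All kinds of bounded intervals at once: the exhausting sets are closed while the generators of
    the sigma-algebra are half-open. The case a = b admits the empty set, so that intersections stay
    in the class. *)
Definition itv_like (A : set L) := measurable A /\
  exists a b, [/\ a <= b, `]a, b[ `<=` A & A `<=` `[a, b]].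

Lemma Rintegral_itv_like (A : set L) (a b : R) (f : L -> R) : measurable A -> a <= b ->
  `]a, b[ `<=` A -> A `<=` `[a, b] -> measurable_fun setT f ->
  \int[lam]_x (\1_A x * f x) = \int[lam]_(x in `[a, b]) f x.
Proof.
move=> mA ab Al Au mf; rewrite [RHS]Rintegral_mkcond /Rintegral; congr fine.
apply: ae_eq_integral => //.
- by apply/measurable_EFinP; apply: measurable_funM => //; exact: measurable_indic.
- apply/measurable_EFinP; rewrite -measurable_restrictT//; exact: measurable_funTS.
apply: (ae_mono2 (ae_neq a) (ae_neq b)) => x xa xb _.
congr EFin; rewrite /patch indicE; case: ifPn => xab.
  rewrite mem_set ?mul1r//; apply: Al; move: xab; rewrite inE/= !in_itv/= => /andP[ax xb'].
  by rewrite !lt_neqAle ax xb' xb eq_sym xa.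
rewrite memNset ?mul0r// => /Au xab'; move/negP: xab; apply; exact: mem_set.
Qed.

Lemma ktr_kcos (A : set L) (a b y : R) : measurable A -> a <= b ->
  `]a, b[ `<=` A -> A `<=` `[a, b] -> y != 0 -> ktr lam kcos \1_A y = citv a b y.
Proof.
move=> mA ab Al Au y0; rewrite /ktr (@Rintegral_itv_like _ a b)//; last first.
  by apply: (measurableT_comp (@measurable_cos R)); exact: measurable_funM.
move: ab; rewrite le_eqVlt => /predU1P[->|ab].
  by rewrite set_itv1 Rintegral_set1 /citv subrr mul0r.
have dF (x : R) : is_derive x 1 (fun x => sin (x * y) / y) (cos (x * y)).
  have h := is_derive_sin_mulr x y.
  apply: is_derive_eq; rewrite scaler0 add0r /GRing.scale/=.
  by rewrite mulrC mulfK.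
have cF (x : R) : {for x, continuous (fun z : R => sin (z * y) / y)}.
  by apply: differentiable_continuous; apply/derivable1_diffP; case: (dF x).
rewrite /Rintegral (@continuous_FTC2 _ _ (fun x => sin (x * y) / y))//.
- by rewrite -EFinB/= /citv mulrBl.
- apply: continuous_subspaceT => x.
  by apply: continuous_comp; [exact: mulrr_continuous|exact: continuous_cos].
- split; first by move=> x _; case: (dF x).
    by apply: cvg_at_right_filter; exact: cF.
  by apply: cvg_at_left_filter; exact: cF.
- by move=> x _; rewrite derive1E; case: (dF x).
Qed.

Lemma ktr_ksin (A : set L) (a b y : R) : measurable A -> a <= b ->
  `]a, b[ `<=` A -> A `<=` `[a, b] -> y != 0 -> ktr lam ksin \1_A y = sitv a b y.
Proof.
move=> mA ab Al Au y0; rewrite /ktr (@Rintegral_itv_like _ a b)//; last first.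
  by apply: (measurableT_comp (@measurable_sin R)); exact: measurable_funM.
move: ab; rewrite le_eqVlt => /predU1P[->|ab].
  by rewrite set_itv1 Rintegral_set1 /sitv subrr mul0r.
have dF (x : R) : is_derive x 1 (fun x => - cos (x * y) / y) (sin (x * y)).
  have h := is_derive_cos_mulr x y.
  apply: is_derive_eq; rewrite scaler0 add0r /GRing.scale/=.
  by rewrite mulNr opprK mulrC mulfK.
have cF (x : R) : {for x, continuous (fun z : R => - cos (z * y) / y)}.
  by apply: differentiable_continuous; apply/derivable1_diffP; case: (dF x).
rewrite /Rintegral (@continuous_FTC2 _ _ (fun x => - cos (x * y) / y))//.
- by rewrite -EFinB/= /sitv; ring.
- apply: continuous_subspaceT => x.
  by apply: continuous_comp; [exact: mulrr_continuous|exact: continuous_sin].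
- split; first by move=> x _; case: (dF x).
    by apply: cvg_at_right_filter; exact: cF.
  by apply: cvg_at_left_filter; exact: cF.
- by move=> x _; rewrite derive1E; case: (dF x).
Qed.

Lemma measurable_citv a b : measurable_fun setT (citv a b).
Proof.
apply: measurable_funM; last exact: measurable_inv.
by apply: measurable_funB; apply: (measurableT_comp (@measurable_sin R)); exact: measurable_funM.
Qed.

Lemma measurable_sitv a b : measurable_fun setT (sitv a b).
Proof.
apply: measurable_funM; last exact: measurable_inv.
by apply: measurable_funB; apply: (measurableT_comp (@measurable_cos R)); exact: measurable_funM.
Qed.

(** Product-to-sum formulas; with division by 0 giving 0 the identity holds at y = 0 too. *)
Lemma csitvE a b c d y : citv a b y * citv c d y + sitv a b y * sitv c d y =
  ddcos (b - c) y + ddcos (a - d) y - ddcos (b - d) y - ddcos (a - c) y.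
Proof.
rewrite /citv /sitv /ddcos ![y * (_ - _)]mulrBr !cosB ![y * _]mulrC.
have [->|y0] := eqVneq y 0; first by rewrite expr0n/= invr0 !mulr0; ring.
by field.
Qed.

Lemma sqint_csitv a b : sqint lam (citv a b) /\ sqint lam (sitv a b).
Proof.
have h : lam.-integrable setT (EFin \o (fun y => 2 * ddcos (b - a) y)).
  exact: integrable_EFinZ (integrable_ddcos (b - a)).1.
have E y : citv a b y ^+ 2 + sitv a b y ^+ 2 = 2 * ddcos (b - a) y.
  rewrite !expr2 csitvE (_ : ddcos (a - b) y = ddcos (b - a) y); last first.
    by rewrite /ddcos -(opprB b a) mulrN cosN.
  by rewrite !subrr (_ : ddcos 0 y = 0); [ring|rewrite /ddcos mulr0 cos0 subrr mul0r].
split; split.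
- exact: measurable_citv.
- apply: (le_integrable_EFin _ _ h); first by apply: measurable_funX; exact: measurable_citv.
  by move=> y; rewrite ger0_norm ?sqr_ge0// -E lerDl sqr_ge0.
- exact: measurable_sitv.
- apply: (le_integrable_EFin _ _ h); first by apply: measurable_funX; exact: measurable_sitv.
  by move=> y; rewrite ger0_norm ?sqr_ge0// -E lerDr sqr_ge0.
Qed.

Lemma ip_indic_itv_like (A A' : set L) (a b c d : R) : a <= b -> c <= d ->
  measurable A -> measurable A' ->
  `]a, b[ `<=` A -> A `<=` `[a, b] -> `]c, d[ `<=` A' -> A' `<=` `[c, d] ->
  ip lam \1_A \1_A' = Num.max 0 (Num.min b d - Num.max a c).
Proof.
move=> ab cd mA mA' Al Au A'l A'u.
have -> : ip lam \1_A \1_A' = \int[lam]_x (\1_(A `&` A') x * 1).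
  by apply: eq_Rintegral => x _; rewrite indicI mulr1.
have mI := measurableI _ _ mA mA'.
have [le|lt] := leP (Num.max a c) (Num.min b d).
  rewrite (@Rintegral_itv_like _ (Num.max a c) (Num.min b d))//.
  - rewrite Rintegral_cst//= mul1r lebesgue_measure_itv/= lte_fin.
    rewrite [RHS]max_r ?subr_ge0//; case: ifPn => [_//|].
    rewrite -leNgt => ge; rewrite [LHS]/=; apply/eqP.
    by rewrite eq_sym subr_eq0 eq_le le ge.
  - move=> x /=; rewrite in_itv/= lt_min gt_max => /andP[/andP[ax cx] /andP[xb xd]].
    by split; [apply: Al|apply: A'l]; rewrite /= in_itv/= ?ax ?cx.
  - move=> x [/Au + /A'u]; rewrite /= !in_itv/= => /andP[ax xb] /andP[cx xd].
    by rewrite ge_max le_min ax cx xb xd.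
rewrite (_ : A `&` A' = set0).
  rewrite max_l ?subr_le0 ?ltW//.
  by under eq_Rintegral do rewrite indic0 mul0r; rewrite /Rintegral integral0.
rewrite -subset0 => x [/Au + /A'u]; rewrite /= !in_itv/= => /andP[ax xb] /andP[cx xd].
suff /(lt_le_trans lt) : Num.max a c <= Num.min b d by rewrite ltxx.
by rewrite ge_max !le_min (le_trans ax xb) (le_trans ax xd) (le_trans cx xb) (le_trans cx xd).
Qed.

(** The right-hand side is twice the length of the intersection of the two intervals; with each
    absolute value written as an integral of [ddcos], this is Parseval's identity for their
    indicators. *)
Lemma sum_dist_endpoints (a b c d : R) : a <= b -> c <= d ->
  `|b - c| + `|a - d| - `|b - d| - `|a - c| = 2 * Num.max 0 (Num.min b d - Num.max a c).
Proof.
move=> ab cd.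
have N1 (x y : R) : x <= y -> `|x - y| = y - x by move=> xy; rewrite ler0_norm ?subr_le0// opprB.
have N2 (x y : R) : x <= y -> `|y - x| = y - x by move=> xy; rewrite ger0_norm ?subr_ge0.
have [ac|ca] := leP a c; have [bd|db] := leP b d.
- rewrite (N1 _ _ ac) (N1 _ _ bd) (N1 a d); last lra.
  case: (leP b c) => bc; [rewrite (N1 _ _ bc) max_l|rewrite (N2 _ _ (ltW bc)) max_r]; lra.
- rewrite (N1 _ _ ac) (N2 _ _ (ltW db)) (N2 c b) ?(N1 a d); [|lra|lra].
  rewrite max_r; lra.
- rewrite (N2 _ _ (ltW ca)) (N1 _ _ bd) (N2 c b) ?(N1 a d); [|lra|lra].
  rewrite max_r; lra.
- rewrite (N2 _ _ (ltW ca)) (N2 _ _ (ltW db)) (N2 c b); last lra.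
  case: (leP a d) => ad; [rewrite (N1 _ _ ad) max_r|rewrite (N2 _ _ (ltW ad)) max_l]; lra.
Qed.

(** The isometry comes from [csitvE], the integrals of [ddcos] and [sum_dist_endpoints]; the
    orthogonality from [citv] being even and [sitv] odd. *)
Lemma trig_kernel_line :
  trig_kernel lam kcos ksin (fun n => `[- n%:R, n%:R]%classic) itv_like (2 * ddcos_const).
Proof.
have mmul : measurable_fun setT (fun p : R * R => p.1 * p.2) by exact: measurable_funM.
have mC : measurable_fun setT (fun p : R * R => kcos p.1 p.2).
  exact: (measurableT_comp (@measurable_cos R) mmul).
have mS : measurable_fun setT (fun p : R * R => ksin p.1 p.2).
  exact: (measurableT_comp (@measurable_sin R) mmul).
have aeC (A : set L) (a b : R) : measurable A -> a <= b -> `]a, b[ `<=` A -> A `<=` `[a, b] ->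
    {ae lam, forall y, citv a b y = ktr lam kcos \1_A y}.
  by move=> mA ab Al Au; apply: (ae_mono (ae_neq 0)) => y y0; rewrite (@ktr_kcos _ a b).
have aeS (A : set L) (a b : R) : measurable A -> a <= b -> `]a, b[ `<=` A -> A `<=` `[a, b] ->
    {ae lam, forall y, sitv a b y = ktr lam ksin \1_A y}.
  by move=> mA ab Al Au; apply: (ae_mono (ae_neq 0)) => y y0; rewrite (@ktr_ksin _ a b).
have mkC (A : set L) : measurable A -> measurable_fun setT (ktr lam kcos \1_A).
  by move=> mA; apply: ktr_measurable => //; exact: measurable_indic.
have mkS (A : set L) : measurable A -> measurable_fun setT (ktr lam ksin \1_A).
  by move=> mA; apply: ktr_measurable => //; exact: measurable_indic.
split => //.
- by move=> x y; rewrite /kcos mulrC.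
- by move=> x y; rewrite /ksin mulrC.
- by move=> x y; rewrite cos2Dsin2.
- move=> n; split; first exact: measurable_itv.
  exists (- n%:R), n%:R; split => //; first by rewrite (@le_trans _ _ 0)// oppr_le0.
  by move=> x /=; rewrite !in_itv/= => /andP[/ltW -> /ltW ->].
- move=> m n mn x /=; rewrite !in_itv/= => /andP[mx xm].
  have : m%:R <= n%:R :> R by rewrite ler_nat.
  by move=> mn'; rewrite (le_trans xm mn') (le_trans _ mx)// lerN2.
- move=> x; exists (Num.bound `|(x : R)|); rewrite /= in_itv/= -ler_norml.
  by apply/ltW/archi_boundP; exact: normr_ge0.
- by move=> A [].
- move=> A [mA [a [b [ab _ Au]]]]; apply: (@le_lt_trans _ _ (lam `[a, b]%classic)).
    have m0 : measurable (`[a, b]%classic : set L) by exact: measurable_itv.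
    by apply: (@le_measure _ _ _ lam); rewrite ?inE.
  by rewrite leb_itv/=; case: ifP => // _; rewrite -EFinB ltry.
- move=> A A' [mA [a [b [ab Al Au]]]] [mA' [c [d [cd A'l A'u]]]].
  split; first exact: measurableI.
  have [le|lt] := leP (Num.max a c) (Num.min b d).
    exists (Num.max a c), (Num.min b d); split => //.
      move=> x /=; rewrite in_itv/= lt_min gt_max => /andP[/andP[ax cx] /andP[xb xd]].
      by split; [apply: Al|apply: A'l]; rewrite /= in_itv/= ?ax ?cx.
    move=> x [/Au + /A'u]; rewrite /= !in_itv/= => /andP[ax xb] /andP[cx xd].
    by rewrite ge_max le_min ax cx xb xd.
  (* The intersection is empty here, so a degenerate interval serves. *)
  exists 0, 0; split => //; first by move=> x /=; rewrite in_itv/= lt_asym.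
  move=> x [/Au + /A'u]; rewrite /= !in_itv/= => /andP[ax xb] /andP[cx xd].
  suff /(lt_le_trans lt) : Num.max a c <= Num.min b d by rewrite ltxx.
  by rewrite ge_max !le_min (le_trans ax xb) (le_trans ax xd) (le_trans cx xb) (le_trans cx xd).
- apply/seteqP; split; last first.
    by apply: smallest_sub; [exact: sigma_algebra_measurable|move=> A []].
  apply: smallest_sub; first exact: smallest_sigma_algebra.
  move=> _ [[a b] _ <-]; apply: sub_sigma_algebra; split; first exact: measurable_itv.
  have [ab|ba] := leP a b.
    exists a, b; split => // x /=; rewrite !in_itv/= => /andP[ax xb]; first by rewrite ax ltW.
    by rewrite (ltW ax) xb.
  exists 0, 0; split => // x /=; first by rewrite in_itv/= lt_asym.
  by rewrite !in_itv/= => /andP[ax /(lt_le_trans ax)]; rewrite ltNge (ltW ba).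
- by rewrite mulr_gt0// ddcos_const_gt0.
- move=> A [mA [a [b [ab Al Au]]]].
  exact: (sqint_ae (mkC _ mA) (aeC _ _ _ mA ab Al Au) (sqint_csitv a b).1).
- move=> A [mA [a [b [ab Al Au]]]].
  exact: (sqint_ae (mkS _ mA) (aeS _ _ _ mA ab Al Au) (sqint_csitv a b).2).
- move=> A A' [mA [a [b [ab Al Au]]]] [mA' [c [d [cd A'l A'u]]]].
  rewrite (ip_indic_itv_like ab cd)//.
  rewrite -(ae_eq_ip (measurable_citv a b) (mkC _ mA) (mkC _ mA') (aeC _ _ _ mA ab Al Au)).
  rewrite ipC -(ae_eq_ip (measurable_citv c d) (mkC _ mA') (measurable_citv a b) (aeC _ _ _ mA' cd A'l A'u)).
  rewrite -(ae_eq_ip (measurable_sitv a b) (mkS _ mA) (mkS _ mA') (aeS _ _ _ mA ab Al Au)).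
  rewrite [X in _ + X]ipC -(ae_eq_ip (measurable_sitv c d) (mkS _ mA') (measurable_sitv a b) (aeS _ _ _ mA' cd A'l A'u)).
  rewrite ipC [X in _ + X]ipC /ip.
  have [c1 s1] := sqint_csitv a b; have [c2 s2] := sqint_csitv c d.
  rewrite -RintegralD//; last 2 first.
  + exact: integrable_sqintM c1 c2.
  + exact: integrable_sqintM s1 s2.
  under eq_Rintegral do rewrite csitvE.
  have i1 := integrable_ddcos (b - c); have i2 := integrable_ddcos (a - d).
  have i3 := integrable_ddcos (b - d); have i4 := integrable_ddcos (a - c).
  rewrite RintegralB//; [|by apply: integrable_EFinB; [apply: integrable_EFinD; [exact: i1.1|exact: i2.1]|exact: i3.1]|exact: i4.1].
  rewrite RintegralB//; [|by apply: integrable_EFinD; [exact: i1.1|exact: i2.1]|exact: i3.1].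
  rewrite RintegralD//; [|exact: i1.1|exact: i2.1].
  rewrite i1.2 i2.2 i3.2 i4.2 -mulrDl -!mulrBl [2 * _]mulrC -mulrA [RHS]mulrC.
  congr (_ * _).
  exact: sum_dist_endpoints.
- move=> A A' [mA [a [b [ab Al Au]]]] [mA' [c [d [cd A'l A'u]]]].
  rewrite -(ae_eq_ip (measurable_citv a b) (mkC _ mA) (mkS _ mA') (aeC _ _ _ mA ab Al Au)).
  rewrite ipC -(ae_eq_ip (measurable_sitv c d) (mkS _ mA') (measurable_citv a b) (aeS _ _ _ mA' cd A'l A'u)).
  have mf : measurable_fun setT (fun y => sitv c d y * citv a b y).
    by apply: measurable_funM; [exact: measurable_sitv|exact: measurable_citv].
  have := preserves_Rintegral lebesgue_preserves_opp mf.
  rewrite /ip => E.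
  have N : \int[lam]_y (sitv c d (- y) * citv a b (- y)) = - \int[lam]_y (sitv c d y * citv a b y).
    rewrite -mulN1r -RintegralZl//; last exact: integrable_sqintM (sqint_csitv c d).2 (sqint_csitv a b).1.
    apply: eq_Rintegral => y _; rewrite /sitv /citv !mulrN !cosN !sinN invrN; ring.
  by move: E; rewrite N; lra.
Qed.

End lebesgue_line.

Definition mu3 (R : realType) :
    {sigma_finite_measure set (measurableTypeR R * measurableTypeR R * measurableTypeR R)%type -> \bar R} :=
  prod_measure (prod_measure leb leb) leb.
Arguments mu3 {R}.

Section lebesgue_space.
Context {R : realType}.
Local Notation L := (measurableTypeR R).
Local Notation L3 := (L * L * L)%type.
Local Notation mu := (@mu3 R).

Lemma Lfun3P (f : R3 R -> R) : (f \in Lfun leb3 2%:E) <-> sqint mu f.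
Proof. exact: (Lfun2P mu f). Qed.

Lemma dotE (x y : R3 R) : dot x y = x.1.1 * y.1.1 + x.1.2 * y.1.2 + x.2 * y.2.
Proof. by rewrite /dot !big_ord_recl big_ord0 addr0 addrA. Qed.

Lemma dotC (x y : R3 R) : dot x y = dot y x.
Proof. by apply: eq_bigr => i _; rewrite mulrC. Qed.

Lemma I3_ind (P : 'I_3 -> Prop) : P 0 -> P 1 -> P (1 + 1) -> forall i, P i.
Proof.
move=> P0 P1 P2 [[|[|[|]]] // hi].
- by rewrite (_ : Ordinal hi = 0)//; apply/val_inj.
- by rewrite (_ : Ordinal hi = 1)//; apply/val_inj.
- by rewrite (_ : Ordinal hi = 1 + 1)//; apply/val_inj.
Qed.

Lemma sum3E (V : zmodType) (f : 'I_3 -> V) : \sum_i f i = f 0 + f 1 + f (1 + 1).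
Proof.
rewrite !big_ord_recl big_ord0 addr0 addrA; congr (f _ + f _ + f _); exact/val_inj.
Qed.

Lemma crdD (x y : R3 R) i : crd (x + y) i = crd x i + crd y i.
Proof. by elim/I3_ind: i. Qed.

Lemma crdN (x : R3 R) i : crd (- x) i = - crd x i.
Proof. by elim/I3_ind: i. Qed.

Lemma dotDl (x y z : R3 R) : dot (x + y) z = dot x z + dot y z.
Proof. by rewrite /dot -big_split; apply: eq_bigr => i _; rewrite crdD mulrDl. Qed.

Lemma dotNl (x z : R3 R) : dot (- x) z = - dot x z.
Proof. by rewrite /dot -sumrN; apply: eq_bigr => i _; rewrite crdN mulNr. Qed.

Lemma dotNr (x z : R3 R) : dot x (- z) = - dot x z.
Proof. by rewrite dotC dotNl dotC. Qed.

Lemma measurable_crd i : measurable_fun setT (fun x : L3 => crd x i).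
Proof.
elim/I3_ind: i; rewrite /crd /=.
- exact: (measurableT_comp measurable_fst measurable_fst).
- exact: (measurableT_comp measurable_snd measurable_fst).
- exact: measurable_snd.
Qed.

Definition cas3 (x y : L3) : R := cos (dot x y) + sin (dot x y).

Definition cube (n : nat) : set L3 := [set x : R3 R | `|x| <= n%:R].

Definition const3 : R := 2 * ddcos_const * (2 * ddcos_const) * (2 * ddcos_const).

Definition box2 : set (set (L * L)) := [set A `*` B | A in itv_like & B in itv_like].
Definition box3 : set (set L3) := [set A `*` B | A in box2 & B in itv_like].

(** [cas3] is the cosine plus the sine of the twofold product kernel, and a ball of the sup norm is
    a product of intervals. *)
Lemma isometric_kernel3 : isometric_kernel mu cas3 cube box3 const3.
Proof.
have K2 := trig_kernel_prod (@trig_kernel_line R) (@trig_kernel_line R).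
have K3 := isometric_kernel_trig (trig_kernel_prod K2 (@trig_kernel_line R)).
have -> : cas3 = (fun x y : L3 => prodC (prodC (@kcos R) (@ksin R) (@kcos R) (@ksin R))
    (prodS (@kcos R) (@ksin R) (@kcos R) (@ksin R)) (@kcos R) (@ksin R) x y +
    prodS (prodC (@kcos R) (@ksin R) (@kcos R) (@ksin R))
    (prodS (@kcos R) (@ksin R) (@kcos R) (@ksin R)) (@kcos R) (@ksin R) x y).
  apply/funext => x; apply/funext => y.
  by rewrite /cas3 dotE !(cosD, sinD).
rewrite (_ : cube = (fun n => (`[- n%:R, n%:R] `*` `[- n%:R, n%:R]) `*` `[- n%:R, n%:R] :> set L3))//.
apply/funext => n; apply/seteqP; split=> -[[x y] z] /=;
  rewrite /cube/= !prod_normE/= !ge_max !in_itv/= -!ler_norml.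
  by move=> /andP[/andP[-> ->] ->].
by move=> [[-> ->] ->].
Qed.

Lemma preserves3 (s1 s2 s3 : L -> L) : preserves leb s1 -> preserves leb s2 -> preserves leb s3 ->
  preserves mu (fun x => (s1 x.1.1, s2 x.1.2, s3 x.2)).
Proof.
move=> h1 h2 h3; exact: (preserves_prod (preserves_prod h1 h2 : preserves (prod_measure _ _) _) h3).
Qed.

Lemma preserves3_opp : preserves mu (fun x : R3 R => - x).
Proof.
by have := preserves3 lebesgue_preserves_opp lebesgue_preserves_opp (@lebesgue_preserves_opp R).
Qed.

Lemma preserves3_shift (a : R3 R) : preserves mu (fun x : R3 R => x + a).
Proof.
by have := preserves3 (lebesgue_preserves_shift a.1.1) (lebesgue_preserves_shift a.1.2)
  (lebesgue_preserves_shift a.2).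
Qed.

Lemma measurable_opp3 : measurable_fun setT (fun x : L3 => - (x : R3 R) : L3).
Proof. by have [] := preserves3_opp. Qed.

End lebesgue_space.

(** * Measurability of open sets and continuous functions in space *)

Section continuous_measurable.
Context {R : realType}.
Local Notation L := (measurableTypeR R).
Local Notation L3 := (L * L * L)%type.

(** [U] is the union of the countably many boxes with rational centre and half-side 1/(n+1) that it
    contains. *)
Lemma open3_measurable (U : set (R3 R)) : open U -> measurable (U : set L3).
Proof.
move=> oU.
pose B (k : rat * rat * rat * nat) : set (R3 R) :=
  [set x : R3 R | [/\ `|x.1.1 - ratr k.1.1.1| < k.2.+1%:R^-1,
    `|x.1.2 - ratr k.1.1.2| < k.2.+1%:R^-1 & `|x.2 - ratr k.1.2| < k.2.+1%:R^-1]].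
pose F (k : rat * rat * rat * nat) : set L3 := if `[< B k `<=` U >] then B k else set0.
have mB k : measurable (B k : set L3).
  rewrite (_ : B k = (ball (ratr k.1.1.1 : R) k.2.+1%:R^-1 `*` ball (ratr k.1.1.2 : R) k.2.+1%:R^-1)
     `*` ball (ratr k.1.2 : R) k.2.+1%:R^-1).
    by apply: measurableX; [apply: measurableX|]; exact: measurable_ball.
  apply/seteqP; split=> -[[x y] z] /=; rewrite /ball/=.
    by move=> [h1 h2 h3]; split; [split|]; rewrite distrC.
  by move=> [[h1 h2] h3]; split; rewrite distrC.
have mF k : measurable (F k) by rewrite /F; case: ifP => // _; exact: measurable0.
have -> : U = \bigcup_k F k.
  apply/seteqP; split=> [x Ux|x [k _]]; last by rewrite /F; case: ifPn => // /asboolP; apply.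
  have /nbhs_ballP[e /= e0 eU] : nbhs x U by exact: open_nbhs_nbhs.
  have [n] := @ltr_add_invr R 0 (e / 2) ltac:(by rewrite divr_gt0).
  rewrite add0r => ne.
  have app (t : R) : exists q : rat, `|t - ratr q| < n.+1%:R^-1.
    have [||y [yb [q _ qy]]] := @dense_rat R (ball t n.+1%:R^-1).
    - by exists t; apply: ballxx.
    - exact: ball_open.
    by exists q; rewrite qy.
  have [q1 h1] := app x.1.1; have [q2 h2] := app x.1.2; have [q3 h3] := app x.2.
  exists (q1, q2, q3, n) => //; rewrite /F asboolT//= => y [/= g1 g2 g3].
  apply: eU.
  have tri (s t q : R) : `|s - q| < n.+1%:R^-1 -> `|t - q| < n.+1%:R^-1 -> `|s - t| < e.
    move=> sq tq; rewrite (splitr e); apply: (le_lt_trans _ (ltrD (lt_trans sq ne) (lt_trans tq ne))).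
    by rewrite (distrC t q); apply: le_trans (ler_normD _ _); rewrite addrA subrK.
  by split; [split|]; rewrite /ball/=; [apply: tri h1 g1|apply: tri h2 g2|apply: tri h3 g3].
by apply: countable_bigcupT_measurable => //; exact: countableP.
Qed.

Lemma continuous3_measurable (f : R3 R -> R) : continuous f -> measurable_fun setT (f : L3 -> R).
Proof.
move=> cf; apply: (measurability (@RGenOInfty.G R)); first exact: RGenOInfty.measurableE.
move=> _ [_ [a ->] <-]; rewrite setTI; apply: open3_measurable.
by apply: open_comp => // x _; exact: cf.
Qed.

End continuous_measurable.

(** A directional derivative sees only the restriction to a line; this exchanges a function of three
    variables for one of a single variable, or for a translate. *)
Lemma derive_line_eq (R : realType) (U V W : normedModType R) (f : U -> W) (g : V -> W)
    (x v : U) (y w : V) : (forall h : R, f (h *: v + x) = g (h *: w + y)) ->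
  'D_v f x = 'D_w g y /\ (derivable f x v <-> derivable g y w).
Proof.
move=> fg; have E : (fun h : R => h^-1 *: ((f \o shift x) (h *: v) - f x)) =
    (fun h : R => h^-1 *: ((g \o shift y) (h *: w) - g y)).
  apply/funext => h /=; rewrite fg; have := fg 0; rewrite !scale0r !add0r => ->; done.
by rewrite /derive /derivable E.
Qed.

(** * Test functions and symbols of distributions *)

Section test_functions.
Context {R : realType}.
Local Notation L := (measurableTypeR R).
Local Notation L3 := (L * L * L)%type.
Local Notation mu := (@mu3 R).
Local Notation kt := (ktr (@mu3 R) (@cas3 R)).
Local Notation K3 := (@isometric_kernel3 R).
Implicit Types (phi : R3 R -> R) (x y : R3 R).

Lemma test_function_cont phi : test_function phi -> continuous phi.
Proof. by move=> [/(_ [::])[]]. Qed.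

Lemma test_function_derivable phi i x : test_function phi -> derivable phi x (bvec i).
Proof. by move=> [/(_ [::])[_]]. Qed.

Lemma near_gt_norm (M : R) x : M < `|x| -> \forall y \near x, M < `|y|.
Proof. by move=> Mx; have := @norm_continuous _ _ x; move/cvgr_gt; apply. Qed.

Lemma test_function_partial phi i : test_function phi -> test_function ('D_(bvec i) phi).
Proof.
move=> [sm [M sM]]; split.
  move=> s; have := sm (rcons s i).
  by rewrite /iter_partial foldr_rcons.
exists M => x Mx; rewrite (@near_eq_derive _ _ _ phi (cst 0)) ?derive_cst//.
by near=> y; apply: sM; near: y; exact: near_gt_norm.
Unshelve. all: by end_near. Qed.

Lemma test_function_cube phi : test_function phi -> exists n, forall x, ~ cube n x -> phi x = 0.
Proof.
move=> [_ [M sM]]; exists (Num.bound `|M|) => x /negP; rewrite -ltNge => nx.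
apply: sM; apply: le_lt_trans (ler_norm M) _; apply: lt_trans nx.
by apply: archi_boundP; exact: normr_ge0.
Qed.

Lemma compact_cube (n : nat) : compact (cube n : set (R3 R)).
Proof.
rewrite (_ : cube n = (`[- n%:R, n%:R] `*` `[- n%:R, n%:R]) `*` `[- n%:R, n%:R] :> set (R3 R)).
  by apply: compact_setX; [apply: compact_setX|]; exact: segment_compact.
apply/seteqP; split=> -[[x y] z] /=;
  rewrite /cube/= !prod_normE/= !ge_max !in_itv/= -!ler_norml.
  by move=> /andP[/andP[-> ->] ->].
by move=> [[-> ->] ->].
Qed.

Lemma test_function_bounded phi : test_function phi -> exists M, forall x, `|phi x| <= M.
Proof.
move=> tphi; have [n n0] := test_function_cube tphi.
have cn : continuous (fun x => `|phi x|).
  by move=> x; apply: cvg_norm; exact: test_function_cont.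
have [] := @compact_EVT_max _ R (fun x => `|phi x|) (cube n).
- by exists 0; rewrite /cube/= normr0 ler0n.
- exact: compact_cube.
- exact: continuous_subspaceT.
move=> c _ cP; exists `|phi c| => x.
have [xn|xn] := pselect (cube n x); first exact/cP/mem_set.
by rewrite n0// normr0.
Qed.

Lemma test_function_bsupp phi : test_function phi -> exists n, bsupp mu (@cube R) n phi.
Proof.
move=> tphi; have [n n0] := test_function_cube tphi; have [M MP] := test_function_bounded tphi.
have mphi := continuous3_measurable (test_function_cont tphi).
exists n; split => //.
have hn := sqint_indic K3 (ik_Q K3 n).
apply: (sqint_le mphi _ (sqintZ M hn)) => x.
have M0 : 0 <= M by apply: le_trans (MP x).
rewrite indicE; have [xn|xn] := pselect (cube n x).
  by rewrite mem_set// mulr1 (ger0_norm M0).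
by rewrite n0// normr0.
Qed.

Lemma test_function_sqint phi : test_function phi -> sqint mu phi.
Proof. by move=> /test_function_bsupp[n []]. Qed.

Lemma test_function_measurable phi : test_function phi -> measurable_fun setT (phi : L3 -> R).
Proof. by move=> /test_function_sqint[]. Qed.

Lemma test_function_integrable phi : test_function phi -> mu.-integrable setT (EFin \o phi).
Proof. by move=> /test_function_bsupp[n]; exact: (bsupp_integrable K3). Qed.

Lemma test_function_hart phi : test_function phi -> hart mu cas3 (@cube R) phi (kt phi).
Proof. by move=> /test_function_bsupp[n]; exact: (hart_bsupp K3). Qed.

Lemma cas3D x a y : cas3 (x + a) y = cos (dot a y) * cas3 x y + sin (dot a y) * cas3 x (- y).
Proof. by rewrite /cas3 dotDl dotNr cosD sinD cosN sinN; ring. Qed.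

(** Both y and -y occur, where the Fourier transform would have a phase factor; differentiation in
    [a] makes this the source of the reflections in symbols. *)
Lemma kt_shift phi a y : test_function phi ->
  kt (fun x => phi (x + a)) y = cos (dot a y) * kt phi y - sin (dot a y) * kt phi (- y).
Proof.
move=> tphi; have iphi := test_function_integrable tphi.
have mphi := test_function_measurable tphi.
have mcas z : measurable_fun setT (fun x : L3 => cas3 x z).
  exact: measurableT_comp (ik_meas K3) (measurable_pair2 z).
rewrite /ktr -(preserves_Rintegral (preserves3_shift (- a))); last first.
  apply: measurable_funM => //.
  by apply: measurableT_comp => //; case: (preserves3_shift a).
rewrite -!RintegralZl//; [|exact: integrable_Mk K3 _ _ iphi..].
rewrite -RintegralB//; last 2 first.
- exact: integrable_EFinZ (integrable_Mk K3 _ iphi).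
- exact: integrable_EFinZ (integrable_Mk K3 _ iphi).
apply: eq_Rintegral => x _; rewrite subrK cas3D dotNl cosN sinN; ring.
Qed.

Lemma derive_line phi v x t : derivable phi (t *: v + x) v ->
  is_derive t 1 (fun s : R => phi (s *: v + x)) ('D_v phi (t *: v + x)).
Proof.
move=> /derivable1P dphi.
have E : (fun s : R => phi (s *: v + x)) =
    (fun h : R => phi (h *: v + (t *: v + x))) \o shift (- t).
  by apply/funext => s /=; rewrite addrA -scalerDl subrK.
have d0 : is_derive (0 : R) 1 (fun h : R => phi (h *: v + (t *: v + x))) ('D_v phi (t *: v + x)).
  have -> : 'D_v phi (t *: v + x) = 'D_1 (fun h : R => phi (h *: v + (t *: v + x))) 0.
    by apply: (derive_line_eq _).1 => h; rewrite scaler1 addr0.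
  exact: derivableP.
rewrite E -[X in is_derive _ _ _ X]mulr1; apply: is_derive1_comp.
  by rewrite /= subrr.
exact: is_derive_shift.
Qed.

Lemma crd_bvec (y : R3 R) i : dot (bvec i) y = crd y i.
Proof. by elim/I3_ind: i; rewrite dotE /bvec /crd/=; ring. Qed.

Lemma dotZl (t : R) x y : dot (t *: x) y = t * dot x y.
Proof. by rewrite !dotE /=; rewrite !mulrDr !mulrA. Qed.

Lemma norm_bvec i : `|bvec i : R3 R| <= 1.
Proof. by elim/I3_ind: i; rewrite !prod_normE /= ?(normr0, normr1) !ge_max ?lexx ?ler01. Qed.

(* Both sides are the derivative at 0 of the transform of [phi] translated along [bvec i]. *)
Lemma kt_partial phi i y : test_function phi ->
  kt ('D_(bvec i) phi) y = - crd y i * kt phi (- y).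
Proof.
move=> tphi; have tD := test_function_partial i tphi.
have [M MP] := test_function_bounded tD.
have [n n0] := test_function_cube tD.
pose f (t : R) (x : L3) : R := phi (t *: bvec i + (x : R3 R)) * cas3 x y.
have df (t : R) (x : L3) : is_derive t 1 (f ^~ x) ('D_(bvec i) phi (t *: bvec i + (x : R3 R)) * cas3 x y).
  have h := @derive_line phi (bvec i) x t (@test_function_derivable _ _ _ tphi).
  rewrite /f; apply: is_derive_eq; rewrite scaler0 add0r /GRing.scale/= mulrC; done.
have I01 : `]-1, 1[%classic (0:R) by rewrite /= in_itv/= ltrN10 ltr01.
have tsh t : mu.-integrable setT (EFin \o f t).
  apply: (integrable_Mk K3).
  have := preserves_integrable (preserves3_shift (t *: bvec i)) (test_function_integrable tphi).
  by congr (_.-integrable _ _); apply/funext => x /=; rewrite addrC.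
(* For |t| < 1 the support of the translate stays in the cube of half-side n + 1; the factor 2
   bounds the kernel. *)
have iG : mu.-integrable setT (EFin \o (fun x => 2 * M * \1_(@cube R n.+1) x)).
  apply: integrable_EFinZ; apply: (bsupp_integrable K3 (n := n.+1)); split.
    exact: (sqint_indic K3 (ik_Q K3 n.+1)).
  by move=> x xn; rewrite indicE memNset.
have M0 : 0 <= M by apply: le_trans (MP 0).
have G0 (x : L3) : 0 <= 2 * M * \1_(@cube R n.+1) x by rewrite !mulr_ge0.
have D t (x : L3) : partial1of2 f t x = 'D_(bvec i) phi (t *: bvec i + (x : R3 R)) * cas3 x y.
  by rewrite partial1of2E; case: (df t x).
have Gb t (x : L3) : `]-1, 1[%classic t -> setT x -> `|partial1of2 f t x| <= 2 * M * \1_(@cube R n.+1) x.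
  rewrite /= in_itv/= => /andP[t1 t2] _; rewrite D normrM.
  have [xn|xn] := pselect (@cube R n.+1 x).
    rewrite indicE mem_set// mulr1 mulrC ler_pM//; exact: (ik_le K3).
  rewrite n0 ?normr0 ?mul0r// => tx; apply: xn; rewrite /cube/= -[x : R3 R](addKr (t *: bvec i)).
  apply: le_trans (ler_normD _ _) _; rewrite normrN prod_norm_scale -natr1 addrC lerD//.
  rewrite -[leRHS]mulr1 ler_pM ?norm_bvec// ltW// ltr_norml t1 t2//.
have := differentiation_under_integral measurableT I01 (fun t _ => tsh t)
  (fun t x _ _ => let: DeriveDef h _ := df t x in h) G0 iG Gb.
have -> : \int[mu]_x partial1of2 f 0 x = kt ('D_(bvec i) phi) y.
  by apply: eq_Rintegral => x _; rewrite D scale0r add0r.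
move=> <-.
rewrite (_ : (fun t => _) = fun t => cos (t * crd y i) * kt phi y - sin (t * crd y i) * kt phi (- y)).
  have h1 := is_derive_cos_mulr 0 (crd y i); have h2 := is_derive_sin_mulr 0 (crd y i).
  rewrite derive1E; apply: derive_val; apply: is_derive_eq.
  rewrite !scaler0 !add0r /GRing.scale/= mul0r cos0 sin0; ring.
apply/funext => t; have := kt_shift (t *: bvec i) y tphi.
rewrite dotZl crd_bvec => <-.
by apply: eq_Rintegral => x _; rewrite /f addrC.
Qed.

End test_functions.

(** * Smooth bumps *)

Section smooth.
Context {R : realType}.
Implicit Types f g : R -> R.

Fixpoint diffn (n : nat) f : Prop :=
  if n is n'.+1 then exists2 g, (forall x, is_derive (x : R) 1 f (g x)) & diffn n' g else True.

Definition smooth f := forall n, diffn n f.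

Lemma diffnW n f : diffn n.+1 f -> diffn n f.
Proof. by elim: n f => // n IH f [g fg /IH gn]; exists g. Qed.

Lemma diffnD n f g : diffn n f -> diffn n g -> diffn n (f \+ g).
Proof.
elim: n f g => // n IH f g [f' ff' f'n] [g' gg' g'n]; exists (f' \+ g'); last exact: IH.
by move=> x /=; apply: is_deriveD.
Qed.

Lemma diffnZ n a f : diffn n f -> diffn n (fun x => a * f x).
Proof.
elim: n f => // n IH f [f' ff' f'n]; exists (fun x => a * f' x); last exact: IH.
by move=> x /=; apply: (is_deriveZ _ (ff' x)).
Qed.

Lemma diffnM n f g : diffn n f -> diffn n g -> diffn n (f \* g).
Proof.
elim: n f g => // n IH f g fn gn; have [f' ff' f'n] := fn; have [g' gg' g'n] := gn.
exists ((f' \* g) \+ (f \* g')); last by apply: diffnD; apply: IH => //; exact: diffnW.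
move=> x; have := ff' x; have := gg' x => h1 h2.
by apply: is_derive_eq; rewrite /GRing.scale/= addrC mulrC.
Qed.

Lemma diffn_shift n a f : diffn n f -> diffn n (fun x => f (x + a)).
Proof.
elim: n f => // n IH f [f' ff' f'n]; exists (fun x => f' (x + a)); last exact: IH.
move=> x; rewrite -[X in is_derive _ _ _ X]mulr1.
by apply: (@is_derive1_comp _ f (fun x => x + a)); exact: is_derive_shift.
Qed.

Lemma diffn_opp n f : diffn n f -> diffn n (fun x => f (- x)).
Proof.
elim: n f => // n IH f [f' ff' f'n]; exists (fun x => -1 * f' (- x)).
  move=> x; rewrite mulrC; apply: (@is_derive1_comp _ f (fun x => - x)).
by apply: diffnZ; exact: IH.
Qed.

Lemma smooth_derive f : smooth f -> (forall x, is_derive (x : R) 1 f (f^`()%classic x)) /\ smooth f^`()%classic.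
Proof.
move=> sf; have df x : is_derive (x : R) 1 f (f^`()%classic x).
  by have [g fg _] := sf 1; rewrite derive1E; apply: derivableP; case: (fg x).
split=> // n; have [g fg gn] := sf n.+1.
by rewrite (_ : f^`()%classic = g)//; apply/funext => x; rewrite derive1E; case: (fg x).
Qed.

Lemma smooth_continuous f : smooth f -> continuous f.
Proof.
move=> /(_ 1)[g fg _] x; apply: differentiable_continuous.
by apply/derivable1_diffP; case: (fg x).
Qed.

(** Used at the point where the flat function [expV] is glued to 0. *)
Lemma is_derive0_quadratic f C : (forall x, `|f x| <= C * x ^+ 2) -> is_derive (0 : R) 1 f 0.
Proof.
move=> fC; have f0 : f 0 = 0.
  by apply/normr0_eq0/eqP; rewrite eq_le normr_ge0 andbT (le_trans (fC 0))// expr0n mulr0.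
have C0 : 0 <= C by have := fC 1; rewrite expr1n mulr1; apply: le_trans.
have cv : h^-1 *: ((f \o shift 0) (h *: 1) - f 0) @[h --> (0:R)^'] --> (0 : R).
  apply/cvgr0Pnorm_le => e e0; near=> h.
  rewrite /= addr0 f0 subr0 /GRing.scale/= mulr1 normrM normfV.
  have h0 : h != 0 by near: h; exact: nbhs_dnbhs_neq.
  rewrite ler_pdivrMl ?normr_gt0//; apply: (le_trans (fC h)).
  rewrite -[h ^+ 2]real_normK ?num_real// expr2 mulrA mulrC ler_wpM2l//.
  have : `|h| <= e / (C + 1).
    near: h; apply: dnbhs0_le; by rewrite divr_gt0// ltr_wpDl.
  rewrite ler_pdivlMr ?ltr_wpDl// => h1.
  by apply: le_trans h1; rewrite mulrC ler_wpM2l// lerDl.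
by split; [apply/cvg_ex; exists 0|rewrite /derive; apply/cvg_lim].
Unshelve. all: by end_near. Qed.

(** The flat functions x^-k exp(-1/x). Carrying all powers k makes the family stable under
    differentiation up to linear combinations, so that smoothness follows by induction. *)
Definition expV (k : nat) (x : R) : R := if 0 < x then x^-1 ^+ k * expR (- x^-1) else 0.

(** From e^z >= z^(k+2) / (k+2)! at z = 1/x. *)
Lemma expV_quadratic k x : `|expV k x| <= (k.+2)`!%:R * x ^+ 2.
Proof.
rewrite /expV; case: ifPn => [x0|_]; last by rewrite normr0 mulr_ge0// sqr_ge0.
have xV0 : 0 <= x^-1 by rewrite invr_ge0 ltW.
rewrite ger0_norm ?mulr_ge0 ?exprn_ge0 ?expR_ge0//.
have f0 : 0 < (k.+2)`!%:R :> R by rewrite ltr0n fact_gt0.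
have := expR_ge1Dxn k.+1 xV0; rewrite expRN => ge.
rewrite ler_pdivrMr ?expR_gt0//.
have : x^-1 ^+ k.+2 <= (k.+2)`!%:R * expR x^-1.
  by rewrite mulrC -ler_pdivrMr//; apply: le_trans ge; rewrite lerDr.
have -> : x^-1 ^+ k = x ^+ 2 * x^-1 ^+ k.+2.
  by rewrite -[k.+2]addn2 exprD mulrCA -exprMn mulfV ?gt_eqF// expr1n mulr1.
by move=> le; apply: (le_trans (ler_wpM2l (sqr_ge0 x) le)); rewrite mulrCA mulrA.
Qed.

Lemma is_derive_expV k x : is_derive (x : R) 1 (expV k) (- k%:R * expV k.+1 x + expV k.+2 x).
Proof.
have [x0|x0|->] := ltgtP x 0.
- rewrite /expV ltNge (ltW x0)/= mulr0 addr0.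
  apply: (@near_eq_is_derive _ _ _ (cst 0)).
  by near=> y; rewrite ltNge ltW//; near: y; exact: lt_nbhsl.
- rewrite /expV x0; have xn0 : x != 0 by rewrite gt_eqF.
  apply: (@near_eq_is_derive _ _ _ (fun y : R => y^-1 ^+ k * expR (- y^-1))).
    by near=> y; rewrite ifT//; near: y; exact: lt_nbhsr.
  have h1 : is_derive (x : R) 1 (fun y : R => y^-1) (- x^-1 ^+ 2).
    have := @is_deriveV R (@idfun R) x 1 1 xn0 (is_derive_id x 1).
    by rewrite /GRing.scale/= mulr1 exprVn.
  have h2 : is_derive (x : R) 1 (fun y : R => expR (- y^-1)) (expR (- x^-1) * x^-1 ^+ 2).
    apply: (@is_derive1_comp _ expR (fun y => - y^-1)).
    by apply: is_derive_eq; rewrite opprK.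
  have h3 : is_derive x 1 (fun y : R => y^-1 ^+ k) ((k%:R * x^-1 ^+ k.-1) * - x^-1 ^+ 2).
    by have := @is_deriveX _ _ _ k x 1 _ h1; rewrite exprfctE.
  have h4 : is_derive x 1 (fun y : R => y^-1 ^+ k * expR (- y^-1)) _ := is_deriveM h3 h2.
  apply: (is_derive_eq h4).
  rewrite /GRing.scale/=.
  case: k {h3 h4} => [|k] /=.
    by rewrite !mul0r oppr0 !mul0r !expr0; ring.
  by rewrite -mulr_natl !exprS; ring.
- have h := @is_derive0_quadratic (expV k) _ (expV_quadratic k).
  by apply: is_derive_eq; rewrite /expV ltxx mulr0 addr0.
Unshelve. all: by end_near. Qed.

Lemma diffn_expV n k : diffn n (expV k).
Proof.
elim: n k => // n IH k; exists ((fun x => - k%:R * expV k.+1 x) \+ expV k.+2).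
  exact: is_derive_expV.
by apply: diffnD; [apply: diffnZ|].
Qed.

Definition bump1 (e x : R) : R := expV 0 (e + x) * expV 0 (e - x).

Lemma smooth_bump1 e : smooth (bump1 e).
Proof.
move=> n; apply: diffnM.
  rewrite (_ : (fun _ => _) = (fun x => expV 0 (x + e))).
    exact/diffn_shift/diffn_expV.
  by apply/funext => x; rewrite addrC.
rewrite (_ : (fun _ => _) = (fun x => (fun y => expV 0 (y + e)) (- x))).
  by apply: (@diffn_opp n (fun y => expV 0 (y + e))); exact/diffn_shift/diffn_expV.
by apply/funext => x; rewrite addrC.
Qed.

Lemma bump1_ge0 e x : 0 <= bump1 e x.
Proof.
by rewrite /bump1 /expV; do 2 case: ifP => _; rewrite ?(mul0r, mulr0)// !mulr_ge0 ?expR_ge0.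
Qed.

Lemma bump1_gt0 e x : `|x| < e -> 0 < bump1 e x.
Proof.
rewrite ltr_norml => /andP[x1 x2]; rewrite /bump1 /expV !ifT; [|lra|lra].
by rewrite !expr0 !mul1r mulr_gt0 ?expR_gt0.
Qed.

Lemma bump1_eq0 e x : e <= `|x| -> bump1 e x = 0.
Proof.
rewrite ler_normr /bump1 /expV => /orP[] ex.
  by rewrite [X in _ * X]ifF ?mulr0//; apply/negbTE; rewrite -leNgt; lra.
by rewrite ifF ?mul0r//; apply/negbTE; rewrite -leNgt; lra.
Qed.

Lemma bump1N e x : bump1 e (- x) = bump1 e x.
Proof. by rewrite /bump1 opprK mulrC. Qed.

End smooth.

Section bumps.
Context {R : realType}.
Implicit Types (phi : R3 R -> R) (f g h : R -> R).

(** Partial derivatives of such products are again such products, which reduces smoothness in three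
    variables to one. *)
Definition tensor f g h (x : R3 R) : R := f x.1.1 * g x.1.2 * h x.2.

Lemma is_derive_from_line phi (x v : R3 R) d :
  is_derive (0 : R) 1 (fun s : R => phi (s *: v + x)) d -> is_derive x v phi d.
Proof.
move=> [dr <-]; suff <- : 'D_v phi x = 'D_1 (fun s : R => phi (s *: v + x)) 0.
  by apply: derivableP; exact/derivable1P.
by apply: (derive_line_eq _).1 => t; rewrite scaler1 addr0.
Qed.

Lemma is_derive_shift_line f (a x : R) : is_derive (x : R) 1 f a ->
  is_derive (0 : R) 1 (fun s => f (s + x)) a.
Proof.
move=> fa; rewrite -[a]mulr1; apply: (@is_derive1_comp _ f (fun s => s + x)); last exact: is_derive_shift.
by rewrite add0r.
Qed.

Lemma is_derive_tensor f g h i : smooth f -> smooth g -> smooth h ->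
  exists f' g' h', [/\ smooth f', smooth g', smooth h' &
    forall x, is_derive x (bvec i) (tensor f g h) (tensor f' g' h' x)].
Proof.
move=> sf sg sh; have [df sf'] := smooth_derive sf; have [dg sg'] := smooth_derive sg.
have [dh sh'] := smooth_derive sh.
elim/I3_ind: i.
- exists f^`()%classic, g, h; split=> // y; apply: is_derive_from_line.
  rewrite (_ : (fun s => _) = (fun s => (g y.1.2 * h y.2) * f (s + y.1.1))); last first.
    by apply/funext => s; rewrite /tensor/= /GRing.scale/= !(mulr0, mulr1, add0r); ring.
  rewrite (_ : tensor _ _ _ y = (g y.1.2 * h y.2) * f^`()%classic y.1.1); last by rewrite /tensor; ring.
  exact: is_deriveZ (is_derive_shift_line (df _)).
- exists f, g^`()%classic, h; split=> // y; apply: is_derive_from_line.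
  rewrite (_ : (fun s => _) = (fun s => (f y.1.1 * h y.2) * g (s + y.1.2))); last first.
    by apply/funext => s; rewrite /tensor/= /GRing.scale/= !(mulr0, mulr1, add0r); ring.
  rewrite (_ : tensor _ _ _ y = (f y.1.1 * h y.2) * g^`()%classic y.1.2); last by rewrite /tensor; ring.
  exact: is_deriveZ (is_derive_shift_line (dg _)).
- exists f, g, h^`()%classic; split=> // y; apply: is_derive_from_line.
  rewrite (_ : (fun s => _) = (fun s => (f y.1.1 * g y.1.2) * h (s + y.2))); last first.
    by apply/funext => s; rewrite /tensor/= /GRing.scale/= !(mulr0, mulr1, add0r); ring.
  rewrite (_ : tensor _ _ _ y = (f y.1.1 * g y.1.2) * h^`()%classic y.2); last by rewrite /tensor; ring.
  exact: is_deriveZ (is_derive_shift_line (dh _)).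
Qed.

Lemma iter_partial_tensor f g h s : smooth f -> smooth g -> smooth h ->
  exists f' g' h', [/\ smooth f', smooth g', smooth h' & iter_partial s (tensor f g h) = tensor f' g' h'].
Proof.
move=> sf sg sh; elim: s => [|i s [f1 [g1 [h1 [sf1 sg1 sh1 E]]]]]; first by exists f, g, h.
have [f' [g' [h' [sf' sg' sh' D]]]] := is_derive_tensor i sf1 sg1 sh1.
exists f', g', h'; split=> //=; rewrite -/(iter_partial s _) E.
by apply/funext => x; case: (D x).
Qed.

Lemma continuous_tensor f g h : smooth f -> smooth g -> smooth h -> continuous (tensor f g h).
Proof.
move=> /smooth_continuous cf /smooth_continuous cg /smooth_continuous ch x.
have c1 : f y.1.1 @[y --> x] --> f x.1.1.
  apply: (@continuous_comp _ _ _ (fun y : R3 R => y.1.1) f x); last exact: cf.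
  by apply: (@continuous_comp _ _ _ (fun y : R3 R => y.1) fst); exact: cvg_fst.
have c2 : g y.1.2 @[y --> x] --> g x.1.2.
  apply: (@continuous_comp _ _ _ (fun y : R3 R => y.1.2) g x); last exact: cg.
  by apply: (@continuous_comp _ _ _ (fun y : R3 R => y.1) snd); [exact: cvg_fst|exact: cvg_snd].
have c3 : h y.2 @[y --> x] --> h x.2.
  by apply: (@continuous_comp _ _ _ (fun y : R3 R => y.2) h x); [exact: cvg_snd|exact: ch].
exact: cvgM (cvgM c1 c2) c3.
Qed.

Definition bump3 (e : R) := tensor (bump1 e) (bump1 e) (bump1 e).

Lemma test_function_bump3 e : test_function (bump3 e).
Proof.
split=> [s|].
  have sb := smooth_bump1 e.
  have [f' [g' [h' [sf' sg' sh' ->]]]] := iter_partial_tensor s sb sb sb.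
  split; first exact: continuous_tensor.
  move=> x i; have [? [? [? [_ _ _ D]]]] := is_derive_tensor i sf' sg' sh'.
  by case: (D x).
exists e => x; rewrite !prod_normE !lt_max /bump3 /tensor => /orP[/orP[]|] /ltW/bump1_eq0 ->;
  by rewrite ?(mul0r, mulr0).
Qed.

Lemma bump3_ge0 e x : 0 <= bump3 e x.
Proof. by apply: mulr_ge0; [apply: mulr_ge0|]; exact: bump1_ge0. Qed.

Lemma bump3_gt0 e (x : R3 R) : `|x| < e -> 0 < bump3 e x.
Proof.
rewrite !prod_normE !gt_max => /andP[/andP[h1 h2] h3].
by apply: mulr_gt0; [apply: mulr_gt0|]; exact: bump1_gt0.
Qed.

Lemma bump3_eq0 e (x : R3 R) : e <= `|x| -> bump3 e x = 0.
Proof.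
rewrite !prod_normE !le_max /bump3 /tensor => /orP[/orP[]|] /bump1_eq0 ->;
  by rewrite ?(mul0r, mulr0).
Qed.

Lemma bump3N e x : bump3 e (- x) = bump3 e x.
Proof. by rewrite /bump3 /tensor !bump1N. Qed.

Lemma iter_partial_shift s phi (a : R3 R) :
  iter_partial s (fun x => phi (x + a)) = fun x => iter_partial s phi (x + a).
Proof.
elim: s => //= i s; rewrite -!/(iter_partial s _) => ->; apply/funext => x.
by apply: (derive_line_eq _).1 => h; rewrite addrA.
Qed.

Lemma test_function_shift phi (a : R3 R) : test_function phi -> test_function (fun x => phi (x + a)).
Proof.
move=> [sm [M sM]]; split.
  move=> s; rewrite iter_partial_shift; have [cs ds] := sm s; split.
    move=> x; apply: (@continuous_comp _ _ _ (fun x : R3 R => x + a)); last exact: cs.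
    by apply: cvgD; [exact: cvg_id|exact: cvg_cst].
  move=> x i; apply: (@derive_line_eq R _ _ _ _ (iter_partial s phi) _ _ (x + a) (bvec i) _).2.2.
    by move=> h; rewrite addrA.
  exact: ds.
exists (M + `|a|) => x Mx; apply: sM.
by rewrite -(ltrD2r `|a|); apply: (lt_le_trans Mx); rewrite -[X in `|X|](addrK a) -[`|a|]normrN; exact: ler_normD.
Qed.

End bumps.

(** * Separation of symbols by test functions *)

Section test_separation.
Context {R : realType}.
Local Notation L := (measurableTypeR R).
Local Notation L3 := (L * L * L)%type.
Local Notation mu := (@mu3 R).
Local Notation kt := (ktr (@mu3 R) (@cas3 R)).
Local Notation K3 := (@isometric_kernel3 R).
Implicit Types (phi : R3 R -> R) (x y : R3 R).

Lemma norm_dot_le x y : `|dot x y| <= 3 * (`|x| * `|y|).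
Proof.
have h i : `|crd x i * crd y i| <= `|x| * `|y|.
  rewrite normrM ler_pM// !prod_normE !le_max.
    by elim/I3_ind: i; rewrite /crd/= lexx ?orbT.
  by elim/I3_ind: i; rewrite /crd/= lexx ?orbT.
rewrite /dot sum3E; have h0 := h 0; have h1 := h 1; have h2 := h (1 + 1).
apply: (le_trans (ler_normD _ _)); have := ler_normD (crd x 0 * crd y 0) (crd x 1 * crd y 1).
lra.
Qed.

(** For |t| <= 1/2, cos t >= 1 - t^2 >= 3/4 and sin t >= -1/2. *)
Lemma cas3_ge (x y : R3 R) : `|dot x y| <= 2^-1 -> 4^-1 <= cas3 x y.
Proof.
rewrite /cas3; set t := dot x y => t2; have := cos_ge_quadratic t.
have := sin_le_norm t; rewrite ler_norml => /andP[s1 _].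
rewrite -[t ^+ 2]real_normK ?num_real// expr2; have := normr_ge0 t; nra.
Qed.

Lemma kt_bump3N e y : kt (bump3 e) (- y) = kt (bump3 e) y.
Proof.
rewrite /ktr -(preserves_Rintegral preserves3_opp); last first.
  apply: measurable_funM; first exact: test_function_measurable (test_function_bump3 e).
  exact: measurableT_comp (ik_meas K3) (measurable_pair2 _).
by apply: eq_Rintegral => x _; rewrite bump3N /cas3 dotNl dotNr opprK.
Qed.

(** On the support |x.y| <= 3 e |y| <= 1/2, so the kernel is at least 1/4 there, and the bump is
    positive on a cube of positive measure. *)
Lemma kt_bump3_gt0 e y : 0 < e -> 3 * (e * `|y|) <= 2^-1 -> 0 < kt (bump3 e) y.
Proof.
move=> e0 ey; have tb := test_function_bump3 e.
have ib := test_function_integrable tb; have mb := test_function_measurable tb.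
have ib4 : mu.-integrable setT (EFin \o (fun x => 4^-1 * bump3 e x)) by exact: integrable_EFinZ.
have le4 : \int[mu]_x (4^-1 * bump3 e x) <= kt (bump3 e) y.
  apply: le_Rintegral => //; first exact: (integrable_Mk K3).
  move=> x _; have [xe|xe] := leP e `|x : R3 R|; first by rewrite bump3_eq0// mulr0 mul0r.
  rewrite mulrC ler_wpM2l ?bump3_ge0//; apply: cas3_ge.
  apply: (le_trans (norm_dot_le _ _)); apply: le_trans ey.
  by rewrite ler_pM2l// ler_wpM2r// ltW.
apply: lt_le_trans le4; rewrite lt_neqAle Rintegral_ge0 ?andbT; last first.
  by move=> x _; rewrite mulr_ge0 ?bump3_ge0.
apply/eqP => I0.
have h4 : (\int[mu]_x `|(EFin \o (fun x => 4^-1 * bump3 e x)%R) x| = 0)%E.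
  have b4 (x : L3) : 0 <= 4^-1 * bump3 e x by apply: mulr_ge0 => //; exact: bump3_ge0.
  under eq_integral do rewrite gee0_abs ?lee_fin ?b4//.
  by rewrite -(fineK (integrable_fin_num measurableT ib4)); congr EFin; exact/esym.
have [N [mN N0 Nsub]] := (ae_eq_integral_abs mu measurableT (measurable_int _ ib4)).1 h4.
pose I : set L := `]- e, e[%classic.
have mI : measurable I by exact: measurable_itv.
have : (mu ((I `*` I) `*` I) <= mu N)%E.
  apply: le_measure; rewrite ?inE//; first by do 2 apply: measurableX => //.
  move=> [[x1 x2] x3] /= [[]]; rewrite /I/= !in_itv/= -!ltr_norml => h1 h2 h3.
  apply: Nsub => /= /(_ Logic.I) [] /eqP.
  by rewrite mulf_eq0 invr_eq0 pnatr_eq0/= gt_eqF// bump3_gt0// !prod_normE/= !gt_max h1 h2 h3.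
rewrite N0 prod_measureE//; last by apply: measurableX.
rewrite prod_measureE// leb_itv/= lte_fin gtrN// -EFinB opprK -!EFinM lee_fin leNgt.
by rewrite !mulr_gt0// addr_gt0.
Qed.

(** Evenness merges the two terms of [kt_shift]. Testing [M] against all translates therefore
    computes the Hartley transform of [M] times the transform of the bump. *)
Lemma kt_bump3_shift e a y :
  kt (fun x => bump3 e (x + a)) y = kt (bump3 e) y * cas3 y (- a).
Proof.
by rewrite (kt_shift _ _ (test_function_bump3 e)) kt_bump3N /cas3 dotNr cosN sinN dotC; ring.
Qed.

(* Tests with the translates of a small even bump, whose transform is positive near
   any given point. *)
Lemma test_separates (M : L3 -> R) : measurable_fun setT M ->
  (forall phi, test_function phi -> sqint mu (fun y => M y * kt phi y)) ->
  (forall phi, test_function phi -> mu.-integrable setT (EFin \o (fun y => M y * kt phi y))) ->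
  (forall phi, test_function phi -> \int[mu]_y (M y * kt phi y) = 0) ->
  {ae mu, forall y, M y = 0}.
Proof.
move=> mM sM iM M0.
(* Chosen so that 3 e |y| <= 1/2 as soon as |y| <= n + 1. *)
pose e (n : nat) : R := (6 * n.+1%:R)^-1.
have e0 n : 0 < e n by rewrite invr_gt0 mulr_gt0.
have key n : {ae mu, forall y, M y * kt (bump3 (e n)) y = 0}.
  have tb := test_function_bump3 (e n).
  (* The value of the Hartley transform at [a] is the test against a translate of the bump, hence
     0. *)
  apply: (ktr_eq0 K3 (sM _ tb) (iM _ tb)) => a.
  rewrite /ktr -[RHS](M0 _ (test_function_shift (- a) tb)).
  by apply: eq_Rintegral => y _; rewrite kt_bump3_shift opprK mulrA.
have : {ae mu, forall y n, M y * kt (bump3 (e n)) y = 0} by exact/ae_foralln.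
move=> h; apply: (ae_mono h) => y yP.
have [n ny] : exists n : nat, `|y : R3 R| <= n.+1%:R.
  exists (Num.bound `|y : R3 R|); apply/ltW.
  apply: (lt_le_trans (archi_boundP (normr_ge0 _))); by rewrite ler_nat.
have := yP n; move/eqP; rewrite mulf_eq0 => /orP[/eqP//|].
rewrite gt_eqF// kt_bump3_gt0// /e.
have n0 : 0 < n.+1%:R :> R by [].
rewrite (_ : 3 * _ = (`|y : R3 R| / n.+1%:R) * 2^-1); last by field; rewrite gt_eqF.
by rewrite -[leRHS]mul1r ler_pM2r ?invr_gt0// ler_pdivrMr// mul1r.
Qed.

End test_separation.

(** * Symbols of distributions *)

Section symbols.
Context {R : realType}.
Local Notation L := (measurableTypeR R).
Local Notation L3 := (L * L * L)%type.
Local Notation mu := (@mu3 R).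
Local Notation kt := (ktr (@mu3 R) (@cas3 R)).
Local Notation K3 := (@isometric_kernel3 R).
Local Notation c := (@const3 R).
Local Notation hart3 := (hart mu (@cas3 R) (@cube R)).
Implicit Types (phi : R3 R -> R) (x y xi : R3 R) (T : distr R) (m f g : L3 -> R).

Lemma const3_gt0 : 0 < c. Proof. exact: ik_c K3. Qed.

(** Derivatives multiply symbols by coordinates of xi and leave L^2, so integrability is asked only
    against transforms of test functions. *)
Definition symbol T m := measurable_fun setT m /\ forall phi, test_function phi ->
  mu.-integrable setT (EFin \o (fun xi => m xi * kt phi xi)) /\
  T phi = c^-1 * \int[mu]_xi (m xi * kt phi xi).

Lemma kt_sqint phi : test_function phi -> sqint mu (kt phi).
Proof. by move=> /test_function_hart[]. Qed.

Lemma kt_bounded phi : test_function phi -> exists M, forall y, `|kt phi y| <= M.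
Proof.
move=> /test_function_integrable iphi; exists (2 * \int[mu]_x `|phi x|) => y.
exact: (ktr_le K3).
Qed.

Lemma sqint_mul_bounded f g (M : R) : sqint mu f -> measurable_fun setT g -> (forall y, `|g y| <= M) ->
  sqint mu (fun y => f y * g y).
Proof.
move=> hf mg gM; apply: (sqint_le _ _ (sqintZ M hf)); first by apply: measurable_funM => //; case: hf.
have M0 : 0 <= M by apply: le_trans (gM 0).
by move=> y; rewrite !normrM mulrC ler_wpM2r// (ger0_norm M0).
Qed.

Lemma symbol_dist_of (f g : L3 -> R) : hart3 f g -> symbol (dist_of f) g.
Proof.
move=> fg; have [hf hg _] := fg; split; first by case: hg.
move=> phi tphi; split; first exact: integrable_sqintM hg (kt_sqint tphi).
have := hart_ip K3 fg (test_function_hart tphi).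
by rewrite /ip => ->; rewrite mulKf// gt_eqF// const3_gt0.
Qed.

Lemma symbolD T1 T2 m1 m2 : symbol T1 m1 -> symbol T2 m2 -> symbol (T1 + T2) (m1 \+ m2).
Proof.
move=> [mm1 h1] [mm2 h2]; split; first exact: measurable_funD.
move=> phi tphi; have [i1 e1] := h1 _ tphi; have [i2 e2] := h2 _ tphi.
have E : (fun xi => (m1 \+ m2) xi * kt phi xi) =
    (fun xi => m1 xi * kt phi xi) \+ (fun xi => m2 xi * kt phi xi).
  by apply/funext => xi /=; rewrite mulrDl.
rewrite E; split; first exact: integrable_EFinD.
by rewrite RintegralD// mulrDr -e1 -e2.
Qed.

Lemma symbolZ a T m : symbol T m -> symbol (a *: T) (fun xi => a * m xi).
Proof.
move=> [mm h]; split; first exact: measurable_funM.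
move=> phi tphi; have [i e] := h _ tphi.
have E : (fun xi => a * m xi * kt phi xi) = (fun xi => a * (m xi * kt phi xi)).
  by apply/funext => xi; rewrite mulrA.
rewrite E; split; first exact: integrable_EFinZ.
by rewrite RintegralZl// mulrCA -e.
Qed.

Lemma symbolB T1 T2 m1 m2 : symbol T1 m1 -> symbol T2 m2 -> symbol (T1 - T2) (m1 \- m2).
Proof.
move=> h1 /(symbolZ (-1)) /(symbolD h1); rewrite scaleN1r.
by congr symbol; apply/funext => xi /=; rewrite mulN1r.
Qed.

(** [kt_partial] turns the derivative of the test function into a factor and a reflection; the
    substitution xi -> -xi carries the reflection over to [m]. *)
Lemma symbol_partial i T m : symbol T m -> symbol (dpartial i T) (fun xi => - crd xi i * m (- (xi : R3 R))).
Proof.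
move=> [mm h].
have mc := @measurable_crd R i.
have mmN : measurable_fun setT (fun xi : L3 => m (- (xi : R3 R))) by exact: measurableT_comp mm measurable_opp3.
split.
  by apply: measurable_funM => //; exact: measurableT_comp.
move=> phi tphi; have [im em] := h _ (test_function_partial i tphi).
have E : (fun xi => - crd xi i * m (- (xi : R3 R)) * kt phi xi) =
    (fun xi : L3 => -1 * (fun z => m z * kt ('D_(bvec i) phi) z) (- (xi : R3 R))).
  by apply/funext => xi; rewrite kt_partial// crdN !opprK; ring.
rewrite E; have ip' := preserves_integrable preserves3_opp im.
split; first exact: integrable_EFinZ ip'.
rewrite /dpartial em RintegralZl//.
rewrite (preserves_Rintegral (f := fun z => m z * kt ('D_(bvec i) phi) z) preserves3_opp).
  by rewrite mulN1r mulrN.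
apply: measurable_funM => //; case: (kt_sqint (test_function_partial i tphi)) => //.
Qed.

(** Surjectivity from [hart_inv]: c^-1 times the transform of [m] is a preimage. *)
Lemma hart3_exists_inv m : sqint mu m -> exists g, hart3 g m.
Proof.
move=> hm; have [g0 hg0] := hart_exists K3 hm; exists (fun x => c^-1 * g0 x).
have := hartZ K3 c^-1 (hart_inv K3 hg0).
by congr hart; apply/funext => x; rewrite mulKf// gt_eqF// const3_gt0.
Qed.

Lemma hart3_zero_test m : sqint mu m ->
  (forall phi, test_function phi -> \int[mu]_y (m y * kt phi y) = 0) -> {ae mu, forall y, m y = 0}.
Proof.
move=> hm m0; apply: test_separates => //; first by case: hm.
- move=> phi tphi; have [M MP] := kt_bounded tphi.
  by apply: sqint_mul_bounded hm _ MP; case: (kt_sqint tphi).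
- by move=> phi tphi; exact: integrable_sqintM hm (kt_sqint tphi).
Qed.

(** The set under the infimum is a singleton: separation forces the transform of any L^2
    representative to be [m] almost everywhere, and [hart3_exists_inv] provides a representative. *)
Lemma dist_sqL2_symbol T m : symbol T m -> sqint mu m -> dist_sqL2 T = (c^-1 * ip mu m m)%:E.
Proof.
move=> [mm hT] hm.
have sq1 (g g' : L3 -> R) : hart3 g g' -> sqL2 g = (c^-1 * ip mu g' g')%:E.
  move=> gg'; have [hg _ _] := gg'.
  have := integral_sqr hg; rewrite /sqL2 => ->.
  by rewrite (hart_norm K3 gg') mulKf// gt_eqF// const3_gt0.
rewrite /dist_sqL2 (_ : [set sqL2 g | g in _] = [set (c^-1 * ip mu m m)%:E]) ?ereal_inf1//.
apply/seteqP; split=> [_ [g [/Lfun3P hg gT] <-]|_ ->] /=.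
  have [g' gg'] := hart_exists K3 hg; have [_ hg' _] := gg'.
  rewrite (sq1 _ _ gg'); congr (_ * _)%:E.
  have mg : {ae mu, forall y, g' y = m y}.
    have hB := sqintB hg' hm.
    apply: (ae_mono (hart3_zero_test hB _)); last first.
      by move=> y /eqP; rewrite subr_eq0 => /eqP.
    move=> phi tphi; have hk := kt_sqint tphi.
    have [_ e1] := hT _ tphi; have [_ e2] := (symbol_dist_of gg').2 _ tphi.
    rewrite -/(ip mu _ _) ipBl//; apply/eqP; rewrite subr_eq0; apply/eqP.
    have c0 : c^-1 != 0 by rewrite invr_eq0 gt_eqF// const3_gt0.
    apply: (mulfI c0); rewrite -[LHS]e2 -[RHS]e1; exact/esym/gT.
  have [mg' _] := hg'.
  by rewrite (ae_eq_ip mg' mm mg' mg) ipC (ae_eq_ip mg' mm mm mg).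
have [g gm] := hart3_exists_inv hm; have [hg _ _] := gm.
exists g; last exact: sq1.
split; first exact/Lfun3P.
move=> phi tphi; have [_ ->] := hT _ tphi.
by have [_ ->] := (symbol_dist_of gm).2 _ tphi.
Qed.

(** The function xi.u need not be in L^2, so [hart3_zero_test] does not apply. Against the transform
    of a test function each factor xi_i becomes a derivative of that function, whose transform is
    bounded and square-integrable. *)
Lemma test_zero_first_order (u : 'I_3 -> L3 -> R) : (forall i, sqint mu (u i)) ->
  (forall phi, test_function phi -> \int[mu]_y ((\sum_i crd y i * u i y) * kt phi y) = 0) ->
  {ae mu, forall y, \sum_i crd y i * u i y = 0}.
Proof.
move=> hu h0.
have E phi y : test_function phi -> (\sum_i crd y i * u i y) * kt phi y =
    \sum_i u i y * kt ('D_(bvec i) phi) (- (y : R3 R)).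
  move=> tphi; rewrite mulr_suml; apply: eq_bigr => i _.
  by rewrite kt_partial// crdN !opprK; ring.
have tk i phi : test_function phi -> sqint mu (fun y => kt ('D_(bvec i) phi) (- (y : R3 R))).
  by move=> tphi; exact: preserves_sqint preserves3_opp (kt_sqint (test_function_partial i tphi)).
apply: test_separates => //.
- rewrite (_ : (fun y => _) = (fun y => \sum_(i < 3) crd y i * u i y))//.
  by apply: measurable_sum => i; apply: measurable_funM; [exact: measurable_crd|case: (hu i)].
- move=> phi tphi; rewrite (_ : (fun y => _) = (fun y => \sum_i u i y * kt ('D_(bvec i) phi) (- (y : R3 R)))); last first.
    by apply/funext => y; exact: E.
  have hi i : sqint mu (fun y => u i y * kt ('D_(bvec i) phi) (- (y : R3 R))).
    have [M MP] := kt_bounded (test_function_partial i tphi).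
    by apply: (sqint_mul_bounded (hu i)) => //; case: (tk i _ tphi).
  under eq_fun do rewrite sum3E.
  exact: (sqintD (sqintD (hi 0) (hi 1)) (hi (1 + 1))).
- move=> phi tphi; rewrite (_ : (fun y => _) = (fun y => \sum_i u i y * kt ('D_(bvec i) phi) (- (y : R3 R)))); last first.
    by apply/funext => y; exact: E.
  have hi i : mu.-integrable setT (EFin \o (fun y => u i y * kt ('D_(bvec i) phi) (- (y : R3 R)))).
    exact: integrable_sqintM (hu i) (tk i _ tphi).
  under [X in _.-integrable _ (_ \o X)]eq_fun do rewrite sum3E.
  exact: (integrable_EFinD (integrable_EFinD (hi 0) (hi 1)) (hi (1 + 1))).
Qed.

End symbols.

(** * The Leray projection on symbols *)

Section vectors.
Context {R : realType}.
Implicit Types (x y z xi b : R3 R) (f : 'I_3 -> R).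

Definition vec f : R3 R := (f 0, f 1, f (1 + 1)).

Lemma crd_vec f i : crd (vec f) i = f i.
Proof. by elim/I3_ind: i. Qed.

Lemma crd_inj x y : (forall i, crd x i = crd y i) -> x = y.
Proof.
move=> E; have E0 : x.1.1 = y.1.1 := E 0; have E1 : x.1.2 = y.1.2 := E 1.
have E2 : x.2 = y.2 := E (1 + 1).
by case: x y E0 E1 E2 {E} => -[? ?] ? [[? ?] ?] /= -> -> ->.
Qed.

Lemma crdZ (k : R) x i : crd (k *: x) i = k * crd x i.
Proof. by elim/I3_ind: i. Qed.

Lemma crdB x y i : crd (x - y) i = crd x i - crd y i.
Proof. by rewrite crdD crdN. Qed.

Lemma dotDr x y z : dot z (x + y) = dot z x + dot z y.
Proof. by rewrite dotC dotDl !(dotC z). Qed.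

Lemma dotZr (k : R) x z : dot z (k *: x) = k * dot z x.
Proof. by rewrite dotC dotZl (dotC z). Qed.

Lemma dotBl x y z : dot (x - y) z = dot x z - dot y z.
Proof. by rewrite dotDl dotNl. Qed.

Lemma dotBr x y z : dot z (x - y) = dot z x - dot z y.
Proof. by rewrite dotDr dotNr. Qed.

Lemma dot_ge0 x : 0 <= dot x x.
Proof. by apply: sumr_ge0 => i _; rewrite -expr2 sqr_ge0. Qed.

Lemma dot_eq0 x : dot x x = 0 -> x = 0.
Proof.
move=> x0; apply: crd_inj => i; apply/eqP; rewrite (_ : crd 0 i = 0); last by elim/I3_ind: i.
have h j : 0 <= crd x j * crd x j by rewrite -expr2 sqr_ge0.
have := x0; rewrite /dot => /eqP; rewrite psumr_eq0// => /allP /(_ i).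
by rewrite mem_index_enum => /(_ isT); rewrite mulf_eq0 orbb.
Qed.

Lemma dot0l x : dot 0 x = 0.
Proof. by rewrite dotE/= !mul0r !addr0. Qed.

Lemma sqr_crd_le x i : crd x i ^+ 2 <= dot x x.
Proof.
rewrite /dot (bigD1 i)//= expr2 lerDl; apply: sumr_ge0 => j _.
by rewrite -expr2 sqr_ge0.
Qed.

(* The orthogonal projection onto the plane orthogonal to [xi]; it is the
   identity for [xi = 0], where the division gives 0. *)
Definition tproj xi b : R3 R := b - (dot xi b / dot xi xi) *: xi.

Lemma tproj_self xi : tproj xi xi = 0.
Proof.
rewrite /tproj; have [s0|s0] := eqVneq (dot xi xi) 0.
  by rewrite (dot_eq0 s0) scaler0 subrr.
by rewrite divff// scale1r subrr.
Qed.

Lemma tproj_is_linear xi : forall k x y, tproj xi (k *: x + y) = k *: tproj xi x + tproj xi y.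
Proof.
move=> k x y; apply: crd_inj => i.
by rewrite /tproj !(crdD, crdN, crdZ) dotDr dotZr; ring.
Qed.

Lemma tprojD xi x y : tproj xi (x + y) = tproj xi x + tproj xi y.
Proof. by rewrite -[x]scale1r tproj_is_linear !scale1r. Qed.

Lemma tprojZ xi k x : tproj xi (k *: x) = k *: tproj xi x.
Proof.
by apply: crd_inj => i; rewrite /tproj !(crdD, crdN, crdZ) dotZr; ring.
Qed.

Lemma tprojB xi x y : tproj xi (x - y) = tproj xi x - tproj xi y.
Proof. by rewrite -scaleN1r tprojD tprojZ scaleN1r. Qed.

Lemma dot_tproj xi b : dot xi (tproj xi b) = 0.
Proof.
rewrite /tproj; have [s0|s0] := eqVneq (dot xi xi) 0.
  by rewrite (dot_eq0 s0) dot0l.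
by rewrite dotBr dotZr; field.
Qed.

Lemma tproj_id xi b : dot xi b = 0 -> tproj xi b = b.
Proof. by move=> h; rewrite /tproj h mul0r scale0r subr0. Qed.

Lemma dot_tprojl xi b z : dot xi z = 0 -> dot (tproj xi b) z = dot b z.
Proof. by move=> h; rewrite /tproj dotBl dotZl h mulr0 subr0. Qed.

Lemma dot_tproj_le xi b : dot (tproj xi b) (tproj xi b) <= dot b b.
Proof.
rewrite dot_tprojl ?dot_tproj// /tproj dotBr dotZr lerBlDr lerDl (dotC b xi) mulrAC.
by rewrite divr_ge0 ?dot_ge0// -expr2 sqr_ge0.
Qed.

End vectors.

Section measure_extras.
Context {R : realType}.

Lemma preserves_ae d (Z : measurableType d) (m : {measure set Z -> \bar R}) (s : Z -> Z) (P : Z -> Prop) :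
  preserves m s -> {ae m, forall x, P x} -> {ae m, forall x, P (s x)}.
Proof.
move=> [ms sP] [N [mN N0 PN]]; exists (s @^-1` N); split.
- by rewrite -[X in measurable X]setTI; exact: ms.
- by rewrite sP.
- by move=> x /= nP; apply: PN.
Qed.

Lemma sqint_le_sqr d (Z : measurableType d) (m : {measure set Z -> \bar R}) (f G : Z -> R) :
  measurable_fun setT f -> (forall x, f x ^+ 2 <= G x) -> m.-integrable setT (EFin \o G) -> sqint m f.
Proof.
move=> mf fG iG; split=> //.
apply: (le_integrable_EFin (f := fun x => f x ^+ 2) _ _ iG); first exact: measurable_funX.
by move=> x; rewrite ger0_norm ?sqr_ge0.
Qed.

End measure_extras.

Section leray.
Context {R : realType}.
Local Notation L := (measurableTypeR R).
Local Notation L3 := (L * L * L)%type.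
Local Notation mu := (@mu3 R).
Local Notation kt := (ktr (@mu3 R) (@cas3 R)).
Local Notation K3 := (@isometric_kernel3 R).
Local Notation c := (@const3 R).
Local Notation hart3 := (hart mu (@cas3 R) (@cube R)).
Implicit Types (phi : R3 R -> R) (x y xi : R3 R).

Lemma symbol_ddiv (V : 'I_3 -> distr R) (m : 'I_3 -> L3 -> R) : (forall i, symbol (V i) (m i)) ->
  symbol (ddiv V) (fun xi => - (\sum_i crd xi i * m i (- (xi : R3 R)))).
Proof.
move=> h; rewrite /ddiv sum3E.
have := symbolD (symbolD (symbol_partial 0 (h 0)) (symbol_partial 1 (h 1))) (symbol_partial (1 + 1) (h (1 + 1))).
by congr symbol; apply/funext => xi /=; rewrite sum3E; ring.
Qed.

Lemma hart3_choice (v : vfield R) : L2 v -> exists vh : 'I_3 -> L3 -> R, forall i, hart3 (v i) (vh i).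
Proof.
move=> hv; have /choice[vh] : forall i, exists g, hart3 (v i) g; last by exists vh.
by move=> i; apply: (hart_exists K3); exact/Lfun3P.
Qed.

(** The symbol of the divergence carries a reflection, which is undone by a substitution that
    preserves null sets. *)
Lemma L2sigma_hart (v : vfield R) (vh : 'I_3 -> L3 -> R) : (forall i, hart3 (v i) (vh i)) ->
  L2sigma v <-> {ae mu, forall xi, \sum_i crd xi i * vh i xi = 0}.
Proof.
move=> hv; have [mS S] := symbol_ddiv (fun i => symbol_dist_of (hv i)).
have hvh i : sqint mu (vh i) by case: (hv i).
have c0 : c^-1 != 0 by rewrite invr_eq0 gt_eqF// const3_gt0.
split=> [[_ dv]|ae0].
  have h0 : {ae mu, forall xi, \sum_i crd xi i * vh i (- (xi : R3 R)) = 0}.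
    apply: test_zero_first_order.
      by move=> i; exact: preserves_sqint preserves3_opp (hvh i).
    move=> phi tphi; have [iS] := S _ tphi; rewrite dv// => /esym/eqP.
    rewrite mulf_eq0 (negbTE c0)/= => /eqP I0; apply/eqP; rewrite -oppr_eq0 -mulN1r -RintegralZl//.
      by apply/eqP; rewrite -[RHS]I0; apply: eq_Rintegral => xi _; ring.
    have := integrable_EFinZ (-1) iS; congr (_.-integrable _ (_ \o _)).
    by apply/funext => xi; ring.
  apply: (ae_mono (preserves_ae preserves3_opp h0)) => xi; rewrite opprK => E.
  by apply/eqP; rewrite -oppr_eq0 -sumrN -[X in _ == X]E; apply/eqP/eq_bigr => i _; rewrite crdN mulNr.
split=> [i|phi tphi]; first by apply/Lfun3P; case: (hv i).
have [_ ->] := S _ tphi; rewrite -/(ip mu _ (kt phi)).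
have [mk _] := kt_sqint tphi.
have m0 : measurable_fun setT (fun _ : L3 => 0 : R) by exact: measurable_cst.
rewrite (ae_eq_ip mS m0 mk).
  by rewrite ipC /ip; under eq_Rintegral do rewrite mulr0; rewrite /Rintegral integral0 mulr0.
apply: (ae_mono (preserves_ae preserves3_opp ae0)) => xi E.
rewrite -[RHS]E -sumrN; apply: eq_bigr => i _; rewrite crdN mulNr.
done.
Qed.

Lemma measurable_vec_comb (b : 'I_3 -> L3 -> R) i : (forall j, measurable_fun setT (b j)) ->
  measurable_fun setT (fun xi : L3 => crd (tproj xi (vec (b ^~ xi))) i).
Proof.
move=> mb; have mc j := @measurable_crd R j.
rewrite (_ : (fun xi => _) = (fun xi : L3 => b i xi -
   ((crd xi 0 * b 0 xi + crd xi 1 * b 1 xi + crd xi (1 + 1) * b (1 + 1) xi) *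
   (crd xi 0 * crd xi 0 + crd xi 1 * crd xi 1 + crd xi (1 + 1) * crd xi (1 + 1))^-1) * crd xi i)); last first.
  apply/funext => xi; rewrite /tproj crdB crdZ crd_vec /dot !sum3E.
  by rewrite !crd_vec.
apply: measurable_funB => //; apply: measurable_funM => //; apply: measurable_funM.
  by do ?[apply: measurable_funD]; exact: measurable_funM.
apply: (measurableT_comp (@measurable_inv R)).
by do ?[apply: measurable_funD]; exact: measurable_funM.
Qed.

Lemma integrable_dot (b : 'I_3 -> L3 -> R) : (forall j, sqint mu (b j)) ->
  mu.-integrable setT (EFin \o (fun xi => dot (vec (b ^~ xi)) (vec (b ^~ xi)))).
Proof.
move=> hb.
have h j := integrable_sqintM (hb j) (hb j).
have := integrable_EFinD (integrable_EFinD (h 0) (h 1)) (h (1 + 1)).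
by congr (_.-integrable _ (_ \o _)); apply/funext => xi; rewrite /dot sum3E !crd_vec.
Qed.

Lemma sqint_tproj (b : 'I_3 -> L3 -> R) i : (forall j, sqint mu (b j)) ->
  sqint mu (fun xi : L3 => crd (tproj xi (vec (b ^~ xi))) i).
Proof.
move=> hb; apply: sqint_le_sqr (integrable_dot hb).
  by apply: measurable_vec_comb => j; case: (hb j).
move=> xi; apply: le_trans (dot_tproj_le xi _); exact: sqr_crd_le.
Qed.

(** Let z be the pointwise projection of the transform of [w] minus the transform of [h]. It is
    orthogonal to xi, so its inverse transform is an admissible test field; by orthogonality of z to
    xi the resulting pairing is int |z|^2, which is therefore 0. *)
Lemma hart_leray (w h : vfield R) (wh : 'I_3 -> L3 -> R) : leray_projection w h ->
  (forall i, hart3 (w i) (wh i)) ->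
  forall i, hart3 (h i) (fun xi => crd (tproj xi (vec (wh ^~ xi))) i).
Proof.
move=> [sh orth] hw.
have [hh hhP] := hart3_choice sh.1.
have divh := (L2sigma_hart hhP).1 sh.
have hwh i : sqint mu (wh i) by case: (hw i).
have hhh i : sqint mu (hh i) by case: (hhP i).
pose p i (xi : L3) := crd (tproj xi (vec (wh ^~ xi))) i.
have hp i : sqint mu (p i) by exact: sqint_tproj.
pose z i := p i \- hh i.
have hz i : sqint mu (z i) by exact: sqintB.
have /choice[v vz] : forall i, exists g, hart3 g (z i) by move=> i; exact: hart3_exists_inv.
have divz : {ae mu, forall xi, \sum_i crd xi i * z i xi = 0}.
  apply: (ae_mono divh) => xi E.
  have := dot_tproj (xi : R3 R) (vec (wh ^~ xi)); rewrite /dot => F.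
  rewrite -[RHS](subr0 0) -[X in X - _]F -[X in _ - X]E -sumrB.
  by apply: eq_bigr => i _; rewrite -mulrBr.
have sv := (L2sigma_hart vz).2 divz.
have zz : \sum_i ip mu (z i) (z i) = 0.
  have := orth _ sv.
  have -> : \sum_i \int[leb3]_x ((w i x - h i x) * v i x) =
      c^-1 * \sum_i ip mu (wh i \- hh i) (z i).
    rewrite mulr_sumr; apply: eq_bigr => i _.
    have := hart_ip K3 (hartB K3 (hw i) (hhP i)) (vz i) => ->.
    by rewrite mulKf// gt_eqF// const3_gt0.
  move/eqP; rewrite mulf_eq0 invr_eq0 gt_eqF ?const3_gt0//= => /eqP Z0; rewrite -[RHS]Z0.
  have hd i : sqint mu (wh i \- hh i) by exact: sqintB.
  have i1 i := integrable_sqintM (hz i) (hz i).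
  have i2 i := integrable_sqintM (hd i) (hz i).
  have j1 := integrable_EFinD (i1 0) (i1 1); have j2 := integrable_EFinD (i2 0) (i2 1).
  rewrite !sum3E /ip -!RintegralD//; try first [exact: i1|exact: i2|exact: j1|exact: j2].
  rewrite /Rintegral; congr fine; apply: ae_eq_integral => //.
  - by apply: measurable_int; exact: (integrable_EFinD (integrable_EFinD (i1 0) (i1 1)) (i1 (1 + 1))).
  - by apply: measurable_int; exact: (integrable_EFinD (integrable_EFinD (i2 0) (i2 1)) (i2 (1 + 1))).
  apply: (ae_mono divz) => xi E _; congr EFin.
  have E3 : dot (xi : R3 R) (vec (z ^~ xi)) = 0.
    by rewrite -[RHS]E; apply: eq_bigr => i _; rewrite crd_vec.
  have := dot_tprojl (vec (wh ^~ xi)) E3.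
  rewrite /dot !sum3E !crd_vec /z /p /= => E4.
  by apply/eqP; rewrite -subr_eq0; apply/eqP; move: E4; lra.
move=> i; apply: (hart_ae K3 (hhP i)); first by case: (hp i).
have zi : ip mu (z i) (z i) = 0.
  have g0 j : 0 <= ip mu (z j) (z j) by exact: ip_ge0.
  move/eqP: zz; rewrite psumr_eq0// => /allP /(_ i).
  by rewrite mem_index_enum => /(_ isT)/eqP.
by apply: (ae_mono (ip_eq0 (hz i) zi)) => xi /eqP; rewrite subr_eq0 => /eqP/esym.
Qed.

End leray.

(** * Calculus of vector-valued curves *)

Section vector_derivatives.
Context {R : realType}.
Implicit Types (f g : R -> R3 R) (t : R) (x y z xi : R3 R).

Definition cross x y : R3 R :=
  (x.1.2 * y.2 - x.2 * y.1.2, x.2 * y.1.1 - x.1.1 * y.2, x.1.1 * y.1.2 - x.1.2 * y.1.1).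

Lemma crd_cross x y i : crd (cross x y) i =
  crd x (i + 1) * crd y (i + 2) - crd x (i + 2) * crd y (i + 1).
Proof. by elim/I3_ind: i. Qed.

Lemma R3_eq x y : x.1.1 = y.1.1 -> x.1.2 = y.1.2 -> x.2 = y.2 -> x = y.
Proof. by case: x y => -[? ?] ? [[? ?] ?] /= -> -> ->. Qed.

Lemma dot_cross x y : dot x (cross x y) = 0.
Proof. by rewrite dotE /=; ring. Qed.

Lemma crossDr x y z : cross z (x + y) = cross z x + cross z y.
Proof. by apply: crd_inj => i; rewrite !(crd_cross, crdD); ring. Qed.

Lemma crossZr (k : R) x z : cross z (k *: x) = k *: cross z x.
Proof. by apply: crd_inj => i; rewrite !(crd_cross, crdZ); ring. Qed.

Lemma cross_self x : cross x x = 0.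
Proof. by apply: R3_eq => /=; ring. Qed.

Lemma cross_cross x y : cross x (cross x y) = dot x y *: x - dot x x *: y.
Proof.
by apply: R3_eq; rewrite /= !dotE /GRing.scale/=; ring.
Qed.

Lemma dot_cross_cross x y : dot (cross x y) (cross x y) = dot x x * dot y y - dot x y ^+ 2.
Proof. by rewrite !dotE /=; ring. Qed.

Definition vd f t (df : R3 R) := forall i, is_derive t 1 (fun s : R => crd (f s) i) (crd df i).

Lemma vdD f g t df dg : vd f t df -> vd g t dg -> vd (fun s => f s + g s) t (df + dg).
Proof.
move=> hf hg i; rewrite crdD (_ : (fun s => _) = (fun s : R => crd (f s) i) \+ (fun s : R => crd (g s) i)).
  exact: is_deriveD (hf i) (hg i).
by apply/funext => s; rewrite crdD.
Qed.

Lemma vdZ (k : R) f t df : vd f t df -> vd (fun s => k *: f s) t (k *: df).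
Proof.
move=> hf i; rewrite crdZ (_ : (fun s => _) = k \*: (fun s : R => crd (f s) i)).
  exact: is_deriveZ (hf i).
by apply/funext => s; rewrite crdZ.
Qed.

Lemma vdN f t df : vd f t df -> vd (fun s => - f s) t (- df).
Proof.
move=> hf i; rewrite crdN (_ : (fun s => _) = - (fun s : R => crd (f s) i)).
  exact: is_deriveN (hf i).
by apply/funext => s; rewrite crdN.
Qed.

Lemma vdB f g t df dg : vd f t df -> vd g t dg -> vd (fun s => f s - g s) t (df - dg).
Proof. by move=> hf /vdN; exact: vdD. Qed.

Lemma vd_dot f g t df dg : vd f t df -> vd g t dg ->
  is_derive t 1 (fun s : R => dot (f s) (g s)) (dot df (g t) + dot (f t) dg).
Proof.
move=> hf hg.
have h i := is_deriveM (hf i) (hg i).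
have E : (fun s => dot (f s) (g s)) = (fun s : R => crd (f s) 0) * (fun s : R => crd (g s) 0) +
    (fun s : R => crd (f s) 1) * (fun s : R => crd (g s) 1) +
    (fun s : R => crd (f s) (1 + 1)) * (fun s : R => crd (g s) (1 + 1)).
  by apply/funext => s; rewrite /dot sum3E.
rewrite E; apply: (is_derive_eq (is_deriveD (is_deriveD (h 0) (h 1)) (h (1 + 1)))).
by rewrite /dot !sum3E /GRing.scale/=; ring.
Qed.

Lemma vd_cst x t : vd (fun=> x) t 0.
Proof.
move=> i; rewrite (_ : crd 0 i = 0); first exact: is_derive_cst.
by elim/I3_ind: i.
Qed.

Lemma vd_scale (g : R -> R) t dg x : is_derive t 1 g dg -> vd (fun s => g s *: x) t (dg *: x).
Proof.
move=> hg i; rewrite crdZ (_ : (fun s => _) = (crd x i) \*: g).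
  by rewrite mulrC; exact: is_deriveZ hg.
by apply/funext => s; rewrite crdZ mulrC.
Qed.

Lemma vd_dotl xi f t df : vd f t df -> is_derive t 1 (fun s : R => dot xi (f s)) (dot xi df).
Proof.
by move=> hf; have := vd_dot (vd_cst xi t) hf; rewrite dot0l add0r.
Qed.

Lemma vd_cross xi f t df : vd f t df -> vd (fun s => cross xi (f s)) t (cross xi df).
Proof.
move=> hf i; rewrite crd_cross.
rewrite (_ : (fun s => _) = (crd xi (i + 1)) \*: (fun s : R => crd (f s) (i + 2)) -
    (crd xi (i + 2)) \*: (fun s : R => crd (f s) (i + 1))).
  exact: is_deriveB (is_deriveZ _ (hf _)) (is_deriveZ _ (hf _)).
by apply/funext => s; rewrite crd_cross.
Qed.

Lemma vd_tproj xi f t df : vd f t df -> vd (fun s => tproj xi (f s)) t (tproj xi df).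
Proof.
move=> hf; apply: vdB => //; apply: vd_scale.
have := is_deriveZ (dot xi xi)^-1 (vd_dotl xi hf).
by rewrite /GRing.scale/= mulrC; congr is_derive; apply/funext => s; rewrite mulrC.
Qed.

Lemma mvt_pos (f df : R -> R) (x y : R) : (forall t : R, 0 < t -> is_derive t 1 f (df t)) ->
  0 < x -> x < y -> exists2 c, x < c < y & f y - f x = df c * (y - x).
Proof.
move=> hf x0 xy.
have [t||c /[!in_itv]/= cxy E] := @MVT R f df x y xy.
- by rewrite in_itv/= => /andP[xt _]; apply: hf; exact: lt_trans xt.
- apply: derivable_within_continuous => t; rewrite in_itv/= => /andP[xt _].
  by case: (hf t (lt_le_trans x0 xt)).
by exists c.
Qed.

End vector_derivatives.

Ltac nonneg := repeat first [done | exact: dot_ge0 | exact: sqr_ge0 | exact: ltW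
  | apply: addr_ge0 | apply: mulr_ge0 | rewrite invr_ge0 | exact: exprn_ge0].

(** * The linear system at a fixed frequency *)

Section symbol_ode.
Context {R : realType}.
Variables (mu chi gamma kappa : R).
Hypotheses (mu0 : 0 < mu) (chi0 : 0 < chi) (gamma0 : 0 <= gamma) (kappa0 : 0 <= kappa).
Variable xi : R3 R.
Implicit Types (t : R) (x y z u v : R3 R).
Local Notation s := (dot xi xi).

(** The Fourier system in the real unknowns of [hartley_fields]: the factor i of the curl is gone
    and leaves opposite signs in front of the two cross products. *)
Definition odeA u v : R3 R := - ((mu + chi) * s) *: u + (2 * chi) *: cross xi v.
Definition odeB u v : R3 R := - (gamma * s) *: v - (kappa * dot xi v) *: xi
  - (2 * chi) *: cross xi u - (4 * chi) *: v.

Definition dissip u v : R := -2 * (dot u (odeA u v) + dot v (odeB u v)).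

(** The map z -> xi x z is antisymmetric, and its two occurrences have opposite signs. *)
Lemma ode_sym u v y z :
  dot u (odeA y z) + dot v (odeB y z) = dot y (odeA u v) + dot z (odeB u v).
Proof. by rewrite /odeA /odeB !dotE /= /GRing.scale/=; ring. Qed.

(** Lagrange's identity s |u|^2 = |xi x u|^2 + (xi.u)^2, then completion of the square in the terms
    with factor chi. *)
Lemma dissipE u v : dissip u v = 2 * mu * dot (cross xi u) (cross xi u)
  + 2 * chi * dot (cross xi u + 2 *: v) (cross xi u + 2 *: v)
  + 2 * (mu + chi) * dot xi u ^+ 2 + 2 * gamma * (s * dot v v) + 2 * kappa * dot xi v ^+ 2.
Proof. by rewrite /dissip /odeA /odeB !dotE /= /GRing.scale/=; ring. Qed.

Lemma dissip_ge u v : 2 * mu * dot (cross xi u) (cross xi u)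
  + 2 * chi * dot (cross xi u + 2 *: v) (cross xi u + 2 *: v) <= dissip u v.
Proof.
by rewrite dissipE -!addrA lerD2l lerDl; nonneg.
Qed.

Lemma dissip_ge0 u v : 0 <= dissip u v.
Proof.
apply: le_trans (dissip_ge u v).
by rewrite addr_ge0// !mulr_ge0 ?dot_ge0// ltW.
Qed.

Definition kk : R := mu / (2 * chi).
Definition alpha : R := (gamma * chi + mu * chi + 2 * mu * gamma) / (4 * chi ^+ 2).
Definition rho : R := mu * gamma / (4 * chi ^+ 2) * (mu + chi).

(** The sign is that of [symbol_partial]; [u] stands for the transform of the velocity at -xi. *)
Definition symO u : R3 R := - cross xi u.
Definition symE u v : R3 R := tproj xi v - 2^-1 *: symO u.
Definition symK u v : R3 R := symE u v - kk *: symO u.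

Definition enstrophy u v : R := dot (symE u v) (symE u v) + alpha * dot (symO u) (symO u).

Definition palinstrophy u v : R := 4 * chi * dot (symE u v) (symE u v)
  + (gamma + chi) * (s * dot (symK u v) (symK u v)) + rho * (s * dot (symO u) (symO u)).

Lemma alpha_ge0 : 0 <= alpha.
Proof.
by rewrite /alpha; nonneg.
Qed.

Lemma alpha_gt0 : 0 < alpha.
Proof.
apply: divr_gt0; last by rewrite mulr_gt0// exprn_gt0.
by apply: ltr_wpDr; [nonneg|apply: ltr_wpDl; [nonneg|exact: mulr_gt0]].
Qed.

Lemma rho_ge0 : 0 <= rho.
Proof.
by rewrite /rho; nonneg.
Qed.

Lemma palinstrophy_ge0 u v : 0 <= palinstrophy u v.
Proof.
by have r0 := rho_ge0; rewrite /palinstrophy; nonneg.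
Qed.

Lemma enstrophy_ge0 u v : 0 <= enstrophy u v.
Proof. by rewrite addr_ge0 ?dot_ge0// mulr_ge0 ?dot_ge0 ?alpha_ge0. Qed.

Lemma dot_symO u : dot xi (symO u) = 0.
Proof. by rewrite /symO dotNr dot_cross oppr0. Qed.

Lemma dot_symE u v : dot xi (symE u v) = 0.
Proof. by rewrite /symE dotBr dotZr dot_symO mulr0 subr0 dot_tproj. Qed.

Lemma symE_tproj u v : symE u v = tproj xi (v - 2^-1 *: symO u).
Proof.
rewrite tprojD -scaleN1r tprojZ tprojZ (tproj_id (dot_symO u)).
by rewrite scaleN1r.
Qed.

(** [symE] is the projection of v - O/2, and twice that vector is the xi x u + 2 v of [dissip_ge];
    hence 8 chi = 2 chi times 2^2. *)
Lemma dot_symE_le u v : dot (symE u v) (symE u v) <= dissip u v / (8 * chi).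
Proof.
rewrite ler_pdivlMr ?mulr_gt0//; apply: le_trans (dissip_ge u v).
apply: (@le_trans _ _ (2 * chi * dot (cross xi u + 2 *: v) (cross xi u + 2 *: v))); last first.
  by rewrite lerDr !mulr_ge0 ?dot_ge0// ltW.
have := dot_tproj_le xi (v - 2^-1 *: symO u); rewrite -symE_tproj => h.
have -> : cross xi u + 2 *: v = 2 *: (v - 2^-1 *: symO u).
  by apply: crd_inj => i; rewrite /symO !(crdD, crdN, crdZ); field.
rewrite dotZl dotZr; move: h; move: (dot (symE u v) _) (dot (v - _) _) => p q pq.
have := chi0; nra.
Qed.

Lemma dot_symO_le u v : dot (symO u) (symO u) <= dissip u v / (2 * mu).
Proof.
rewrite ler_pdivlMr ?mulr_gt0//; apply: le_trans (dissip_ge u v).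
rewrite /symO dotNl dotNr opprK mulrC lerDl.
by rewrite !mulr_ge0 ?dot_ge0// ltW.
Qed.

Lemma enstrophy_le u v : enstrophy u v <= ((8 * chi)^-1 + alpha / (2 * mu)) * dissip u v.
Proof.
rewrite /enstrophy mulrDl lerD//; first by rewrite mulrC; exact: dot_symE_le.
by rewrite -[alpha / _ * _]mulrA; apply: ler_wpM2l; [exact: alpha_ge0|rewrite mulrC; exact: dot_symO_le].
Qed.

Lemma tproj_odeB u v : tproj xi (odeB u v) =
  - (gamma * s) *: tproj xi v + (2 * chi) *: symO u - (4 * chi) *: tproj xi v.
Proof.
rewrite /odeB !tprojB !tprojZ tproj_self scaler0 subr0.
rewrite (tproj_id (dot_cross _ _)) /symO.
by apply: crd_inj => i; rewrite !(crdD, crdN, crdZ); ring.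
Qed.

Lemma scale_dot_tproj v : s *: tproj xi v = s *: v - dot xi v *: xi.
Proof.
rewrite /tproj scalerBr scalerA; have [s0|s0] := eqVneq s 0.
  by rewrite (dot_eq0 s0) !dot0l !mul0r.
by rewrite mulrCA divff// mulr1.
Qed.

Lemma symO_odeA u v : symO (odeA u v) = - ((mu + chi) * s) *: symO u + (2 * chi * s) *: tproj xi v.
Proof.
rewrite -[(2 * chi * s) *: _]scalerA scale_dot_tproj /symO /odeA crossDr !crossZr cross_cross.
by apply: crd_inj => i; rewrite !(crdD, crdN, crdZ); ring.
Qed.

(** As xi.u = 0, s u = xi x O, so viscosity becomes a cross product with O too. Its coefficient mu +
    chi equals 2 chi (kk + 1/2), which is the reason for [kk]. *)
Lemma odeA_symK u v : dot xi u = 0 -> odeA u v = (2 * chi) *: cross xi (symK u v).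
Proof.
move=> xu; rewrite /symK /symE /symO /tproj /odeA /kk.
have -> : v - (dot xi v / s) *: xi - 2^-1 *: - cross xi u - (mu / (2 * chi)) *: - cross xi u =
   v + (- (dot xi v / s) *: xi + (2^-1 + mu / (2 * chi)) *: cross xi u).
  by apply: crd_inj => i; rewrite !(crdD, crdN, crdZ); ring.
rewrite !crossDr !crossZr cross_self cross_cross xu.
apply: crd_inj => i; rewrite !(crdD, crdN, crdZ).
rewrite (_ : crd 0 i = 0); last by elim/I3_ind: i.
by rewrite mulr0 mul0r !add0r; field; rewrite gt_eqF.
Qed.

Lemma dot_symK u v : dot xi (symK u v) = 0.
Proof. by rewrite /symK dotBr dot_symE dotZr dot_symO mulr0 subr0. Qed.

(** K is orthogonal to xi, so |xi x K| = |xi| |K|: the time derivative of u controls this term. *)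
Lemma symK_le u v : dot xi u = 0 ->
  s * dot (symK u v) (symK u v) = dot (odeA u v) (odeA u v) / (4 * chi ^+ 2).
Proof.
move=> xu; rewrite (odeA_symK v xu) dotZl dotZr dot_cross_cross dot_symK.
by field; rewrite gt_eqF.
Qed.

Lemma sumr_crd (x y : R3 R) : dot x y = crd x 0 * crd y 0 + crd x 1 * crd y 1 + crd x (1+1) * crd y (1+1).
Proof. by rewrite /dot sum3E. Qed.

Definition odeE u v : R3 R := tproj xi (odeB u v) - 2^-1 *: symO (odeA u v).

(** Along the flow O' = 2 chi s K and E' = - gamma s (E + O/2) - 4 chi E - chi s K. In E.E' + alpha
    O.O' the value of [alpha] is the one that gives E.O the coefficient required by (gamma + chi) s
    |K|^2, and [rho] is what then remains of s |O|^2. *)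
Lemma enstrophy_balance u v :
  2 * dot (symE u v) (odeE u v) + 2 * alpha * dot (symO u) (symO (odeA u v)) = -2 * palinstrophy u v.
Proof.
rewrite /palinstrophy /odeE tproj_odeB symO_odeA.
(* All terms are sums over components with the same scalar coefficients, so an identity for scalars
   suffices. *)
have key (O H : R) : 2 * ((H - 2^-1 * O) * (- (gamma * s) * H + 2 * chi * O - 4 * chi * H
     - 2^-1 * (- ((mu + chi) * s) * O + 2 * chi * s * H)))
   + 2 * alpha * (O * (- ((mu + chi) * s) * O + 2 * chi * s * H))
   = -2 * (4 * chi * ((H - 2^-1 * O) * (H - 2^-1 * O)) + (gamma + chi) * (s * ((H - 2^-1 * O - kk * O) * (H - 2^-1 * O - kk * O)))
    + rho * (s * (O * O))).
  by rewrite /alpha /rho /kk; field; rewrite gt_eqF.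
rewrite /symK /symE; move: key; move: (symO u) (tproj xi v) s alpha rho kk => O H s' al r k key.
rewrite !sumr_crd !(crdD, crdN, crdZ).
move: (key (crd O 0) (crd H 0)) (key (crd O 1) (crd H 1)) (key (crd O (1 + 1)) (crd H (1 + 1))); lra.
Qed.

Definition accel u v : R := 4 * (dot (odeA u v) (odeA u v) + dot (odeB u v) (odeB u v)).

Lemma accel_ge0 u v : 0 <= accel u v.
Proof. by rewrite /accel; nonneg. Qed.

Lemma kk_gt0 : 0 < kk.
Proof. by rewrite divr_gt0// mulr_gt0. Qed.

(* For gamma > 0 the term gamma |xi|^2 |O|^2 is not bounded by the dissipation in
   an evident way: the second equation trades it for the time derivative of h. *)
Lemma symO_palin_le u v : rho * (s * dot (symO u) (symO u)) <=
  kk * (dot (tproj xi (odeB u v)) (tproj xi (odeB u v)) + dot (symO u) (symO u)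
  + 4 * chi * (dot (symE u v) (symE u v) + dot (symO u) (symO u))
  + gamma / (kk + 2^-1) * (s * dot (symK u v) (symK u v))).
Proof.
have k0 := kk_gt0; have s0 : 0 <= s by exact: dot_ge0.
have kh : 0 < kk + 2^-1 by rewrite addr_gt0.
have -> : rho = kk * (gamma * (kk + 2^-1)) by rewrite /rho /kk; field; rewrite gt_eqF.
rewrite -mulrA (ler_pM2l k0) tproj_odeB /symK /symE.
have key (O H : R) : gamma * (kk + 2^-1) * (s * (O * O)) <=
    (- (gamma * s) * H + 2 * chi * O - 4 * chi * H) * (- (gamma * s) * H + 2 * chi * O - 4 * chi * H)
    + O * O + 4 * chi * ((H - 2^-1 * O) * (H - 2^-1 * O) + O * O)
    + gamma / (kk + 2^-1) * (s * ((H - 2^-1 * O - kk * O) * (H - 2^-1 * O - kk * O))).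
  have g0 : 0 <= gamma * s by rewrite mulr_ge0.
  pose E := H - 2^-1 * O; pose K := E - kk * O; pose D := - (gamma * s) * H - 4 * chi * E.
  have -> : - (gamma * s) * H + 2 * chi * O - 4 * chi * H = D by rewrite /D /E; field.
  rewrite -/E -/K.
  (* H = K + (kk + 1/2) O, so D contains - gamma s (kk + 1/2) O; multiplication by O isolates the
     term to be bounded. *)
  have E1 : gamma * (kk + 2^-1) * (s * (O * O)) = - (D * O) - 4 * chi * (E * O) - gamma * s * (K * O).
    by rewrite /D /K /E; field.
  have h1 : - (D * O) <= 2^-1 * (D * D + O * O) by have := sqr_ge0 (D + O); rewrite expr2; lra.
  have h2 : - (4 * chi * (E * O)) <= 4 * chi * (2^-1 * (E * E + O * O)).
    rewrite -mulrN ler_pM2l ?mulr_gt0//; have := sqr_ge0 (E + O); rewrite expr2; lra.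
  (* Young's inequality with weight kk + 1/2, which lets half of the left-hand side be absorbed. *)
  have h3 : - (gamma * s * (K * O)) <= gamma * s * (2^-1 * ((kk + 2^-1) * (O * O) + (kk + 2^-1)^-1 * (K * K))).
    rewrite -mulrN; apply: ler_wpM2l => //.
    have -> : 2^-1 * ((kk + 2^-1) * (O * O) + (kk + 2^-1)^-1 * (K * K)) =
      - (K * O) + ((kk + 2^-1) * O + K) ^+ 2 / (2 * (kk + 2^-1)).
      by field; rewrite gt_eqF//; lra.
    by rewrite lerDl; rewrite divr_ge0 ?sqr_ge0// mulr_ge0// ltW.
  have h4 : gamma / (kk + 2^-1) * (s * (K * K)) = gamma * s * ((kk + 2^-1)^-1 * (K * K)) by ring.
  have h5 : gamma * (kk + 2^-1) * (s * (O * O)) = gamma * s * ((kk + 2^-1) * (O * O)) by ring.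
  rewrite h4; rewrite h5 in E1 *.
  have d0 : 0 <= D * D by rewrite -expr2 sqr_ge0.
  have o0 : 0 <= O * O by rewrite -expr2 sqr_ge0.
  have h6 : 0 <= 4 * chi * (E * E + O * O) by rewrite -!expr2; nonneg.
  move: h3; rewrite (mulrCA (gamma * s)) mulrDr => h3.
  move: h2; rewrite (mulrCA (4 * chi)) => h2.
  lra.
move: key; move: (symO u) (tproj xi v) s kk (gamma / _) => O H s' k gk key.
rewrite !sumr_crd !(crdD, crdN, crdZ).
move: (key (crd O 0) (crd H 0)) (key (crd O 1) (crd H 1)) (key (crd O (1 + 1)) (crd H (1 + 1))); lra.
Qed.

Definition cE : R := (8 * chi)^-1 + alpha / (2 * mu).

(** All coefficients that [dissip] and [accel] receive in the bounds on the terms of [palinstrophy],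
    added up without optimization. *)
Definition cD : R := 2^-1 + (gamma + chi) / (16 * chi ^+ 2) +
  kk * (4^-1 + (1 + 4 * chi) / (2 * mu) + 2^-1 + gamma / (kk + 2^-1) / (16 * chi ^+ 2)).

Lemma cE_ge0 : 0 <= cE.
Proof. by have := alpha_ge0 => a0; rewrite /cE; nonneg. Qed.

Lemma cD_ge0 : 0 <= cD.
Proof.
have k0 := ltW kk_gt0.
have kh : 0 <= (kk + 2^-1)^-1 by rewrite invr_ge0 addr_ge0.
by rewrite /cD; move: kk ((kk + 2^-1)^-1) k0 kh => k k' k0 kh; nonneg.
Qed.

Lemma palinstrophy_le u v : dot xi u = 0 -> palinstrophy u v <= cD * (dissip u v + accel u v).
Proof.
move=> xu; have k0 := kk_gt0.
have kh : 0 < kk + 2^-1 by rewrite addr_gt0.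
have p0 := dissip_ge0 u v; have q0 := accel_ge0 u v.
have hE := dot_symE_le u v; have hO := dot_symO_le u v.
have hB : dot (tproj xi (odeB u v)) (tproj xi (odeB u v)) <= accel u v / 4.
  apply: (le_trans (dot_tproj_le _ _)); have := dot_ge0 (odeA u v); rewrite /accel; lra.
have hK : s * dot (symK u v) (symK u v) <= accel u v / (16 * chi ^+ 2).
  rewrite symK_le// ler_pdivrMr ?mulr_gt0 ?exprn_gt0//.
  rewrite (_ : accel u v / (16 * chi ^+ 2) * (4 * chi ^+ 2) = accel u v / 4); last by field; rewrite gt_eqF.
  have := dot_ge0 (odeB u v); rewrite /accel; lra.
have h1 : 4 * chi * dot (symE u v) (symE u v) <= 2^-1 * dissip u v.
  have -> : 2^-1 * dissip u v = 4 * chi * (dissip u v / (8 * chi)) by field; rewrite gt_eqF.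
  by rewrite ler_pM2l ?mulr_gt0.
have h2 : (gamma + chi) * (s * dot (symK u v) (symK u v)) <= (gamma + chi) / (16 * chi ^+ 2) * accel u v.
  rewrite -[_ / _ * _]mulrA [X in _ <= _ * X]mulrC; apply: ler_wpM2l => //.
  by rewrite addr_ge0// ltW.
have g0 : 0 <= gamma / (kk + 2^-1) by rewrite divr_ge0// ltW.
have h3 : gamma / (kk + 2^-1) * (s * dot (symK u v) (symK u v)) <= gamma / (kk + 2^-1) / (16 * chi ^+ 2) * accel u v.
  by rewrite -[X in _ <= X]mulrA [X in _ <= _ * X]mulrC; apply: ler_wpM2l.
have h4 : (1 + 4 * chi) * dot (symO u) (symO u) <= (1 + 4 * chi) / (2 * mu) * dissip u v.
  rewrite -[X in _ <= X]mulrA [X in _ <= _ * X]mulrC; apply: ler_wpM2l => //.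
  by rewrite addr_ge0// mulr_ge0// ltW.
have h5 := symO_palin_le u v.
have h6 : kk * (dot (tproj xi (odeB u v)) (tproj xi (odeB u v)) + dot (symO u) (symO u)
  + 4 * chi * (dot (symE u v) (symE u v) + dot (symO u) (symO u))
  + gamma / (kk + 2^-1) * (s * dot (symK u v) (symK u v))) <=
  kk * (4^-1 * accel u v + (1 + 4 * chi) / (2 * mu) * dissip u v + 2^-1 * dissip u v +
    gamma / (kk + 2^-1) / (16 * chi ^+ 2) * accel u v).
  rewrite ler_pM2l//; lra.
have c1 : 0 <= (gamma + chi) / (16 * chi ^+ 2) by nonneg.
have c2 : 0 <= (1 + 4 * chi) / (2 * mu) by nonneg.
have c3 : 0 <= gamma / (kk + 2^-1) / (16 * chi ^+ 2) by move: (gamma / _) g0 => ? ?; nonneg.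
apply: (@le_trans _ _ (2^-1 * dissip u v + (gamma + chi) / (16 * chi ^+ 2) * accel u v +
  kk * (4^-1 * accel u v + (1 + 4 * chi) / (2 * mu) * dissip u v + 2^-1 * dissip u v +
    gamma / (kk + 2^-1) / (16 * chi ^+ 2) * accel u v))).
  rewrite /palinstrophy; lra.
rewrite /cD; move: (dissip u v) (accel u v) p0 q0 => p q p0 q0.
clear -k0 c1 c2 c3 p0 q0.
move: kk (_ / (16 * chi ^+ 2)) (_ / (16 * chi ^+ 2)) (_ / (2 * mu)) k0 c1 c2 c3 => k x y z k0 c1 c2 c3.
rewrite -subr_ge0 (_ : _ - _ = 2^-1 * q + y * p + k * (4^-1 * p + z * q + 2^-1 * q + x * p)); last by field.
by move: (ltW k0) => k0'; nonneg.
Qed.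

Variables a b : R -> R3 R.
Hypothesis dA : forall t, 0 < t -> vd a t (odeA (a t) (b t)).
Hypothesis dB : forall t, 0 < t -> vd b t (odeB (a t) (b t)).
Hypothesis diva : forall t, 0 < t -> dot xi (a t) = 0.

Definition energy t : R := dot (a t) (a t) + dot (b t) (b t).

Lemma vd_odeA f g t df dg : vd f t df -> vd g t dg ->
  vd (fun r => odeA (f r) (g r)) t (odeA df dg).
Proof. by move=> hf hg; apply: vdD; apply: vdZ => //; exact: vd_cross. Qed.

Lemma vd_odeB f g t df dg : vd f t df -> vd g t dg ->
  vd (fun r => odeB (f r) (g r)) t (odeB df dg).
Proof.
move=> hf hg; apply: vdB; last exact: vdZ.
apply: vdB; last by apply: vdZ; exact: vd_cross.
apply: vdB; first exact: vdZ.
apply: vd_scale; have := is_deriveZ kappa (vd_dotl xi hg).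
by rewrite /GRing.scale.
Qed.

Lemma is_derive_energy t : 0 < t -> is_derive t 1 energy (- dissip (a t) (b t)).
Proof.
move=> t0; have hA := dA t0; have hB := dB t0.
apply: (is_derive_eq (is_deriveD (vd_dot hA hA) (vd_dot hB hB))).
by rewrite /dissip (dotC (odeA _ _)) (dotC (odeB _ _)); ring.
Qed.

(** By symmetry of the system the two terms of the product rule for <X, FX> coincide. *)
Lemma is_derive_dissip t : 0 < t ->
  is_derive t 1 (fun r => dissip (a r) (b r)) (- accel (a t) (b t)).
Proof.
move=> t0; have hA := dA t0; have hB := dB t0.
have := is_deriveZ (-2) (is_deriveD (vd_dot hA (vd_odeA hA hB)) (vd_dot hB (vd_odeB hA hB))).
move/is_derive_eq; apply.
have := ode_sym (a t) (b t) (odeA (a t) (b t)) (odeB (a t) (b t)).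
by rewrite /accel /GRing.scale/=; lra.
Qed.

(** FX solves the same linear system as X, so this is [is_derive_energy] for FX, times 4. *)
Lemma is_derive_accel t : 0 < t ->
  is_derive t 1 (fun r => accel (a r) (b r)) (- 4 * dissip (odeA (a t) (b t)) (odeB (a t) (b t))).
Proof.
move=> t0; have hA := vd_odeA (dA t0) (dB t0); have hB := vd_odeB (dA t0) (dB t0).
have := is_deriveZ 4 (is_deriveD (vd_dot hA hA) (vd_dot hB hB)).
move/is_derive_eq; apply.
rewrite /dissip /GRing.scale/= (dotC (odeA (odeA _ _) _)) (dotC (odeB (odeA _ _) _)); ring.
Qed.

Lemma dissip_nonincr r t : 0 < r -> r < t -> dissip (a t) (b t) <= dissip (a r) (b r).
Proof.
move=> r0 rt; have [c /andP[rc _] E] := mvt_pos is_derive_dissip r0 rt.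
have : 0 <= accel (a c) (b c) * (t - r) by rewrite mulr_ge0 ?accel_ge0// subr_ge0 ltW.
by move: E; lra.
Qed.

Lemma accel_nonincr r t : 0 < r -> r < t -> accel (a t) (b t) <= accel (a r) (b r).
Proof.
move=> r0 rt; have [c /andP[rc _] E] := mvt_pos is_derive_accel r0 rt.
have : 0 <= dissip (odeA (a c) (b c)) (odeB (a c) (b c)) * (t - r).
  by rewrite mulr_ge0 ?dissip_ge0// subr_ge0 ltW.
by move: E; lra.
Qed.

Lemma energy_ge0 t : 0 <= energy t.
Proof. by rewrite /energy; nonneg. Qed.

Lemma dissip_le_energy r t : 0 < r -> r < t ->
  (t - r) * dissip (a t) (b t) <= energy r - energy t.
Proof.
move=> r0 rt; have [c /andP[rc ct] E] := mvt_pos is_derive_energy r0 rt.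
have : (t - r) * dissip (a t) (b t) <= (t - r) * dissip (a c) (b c).
  by rewrite ler_pM2l ?subr_gt0//; apply: dissip_nonincr => //; exact: lt_trans rc.
by move: E; lra.
Qed.

Lemma accel_le_energy r t : 0 < r -> r < t ->
  (t - r) ^+ 2 * accel (a t) (b t) <= 4 * energy r.
Proof.
(* Half of the interval passes from [accel] to [dissip], the other half from [dissip] to [energy];
   the two halves produce the factor 4. *)
move=> r0 rt; pose m := (r + t) / 2.
have rm : r < m by rewrite /m; lra.
have mt : m < t by rewrite /m; lra.
have m0 : 0 < m by exact: lt_trans rm.
have [c /andP[mc ct] E] := mvt_pos is_derive_dissip m0 mt.
have h1 : accel (a t) (b t) <= accel (a c) (b c) by apply: accel_nonincr => //; exact: lt_trans mc.
have h2 := dissip_le_energy r0 rm; have h3 := energy_ge0 m; have h4 := dissip_ge0 (a t) (b t).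
have tm : t - m = (t - r) / 2 by rewrite /m; field.
have mr : m - r = (t - r) / 2 by rewrite /m; field.
move: E h2; rewrite tm mr => E h2.
have d0 : 0 < t - r by rewrite subr_gt0.
have h5 : (t - r) / 2 * accel (a t) (b t) <= dissip (a m) (b m).
  have : (t - r) / 2 * accel (a t) (b t) <= (t - r) / 2 * accel (a c) (b c).
    by rewrite ler_pM2l// divr_gt0.
  lra.
have : (t - r) / 2 * ((t - r) / 2 * accel (a t) (b t)) <= (t - r) / 2 * dissip (a m) (b m).
  by rewrite ler_pM2l// divr_gt0.
rewrite expr2; lra.
Qed.

Lemma is_derive_enstrophy t : 0 < t ->
  is_derive t 1 (fun r => enstrophy (a r) (b r)) (-2 * palinstrophy (a t) (b t)).
Proof.
move=> t0; have hO : vd (fun r => symO (a r)) t (symO (odeA (a t) (b t))).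
  by apply: vdN; apply: vd_cross; exact: dA.
have hE : vd (fun r => symE (a r) (b r)) t (odeE (a t) (b t)).
  by apply: vdB; [apply: vd_tproj; exact: dB|exact: vdZ].
have := is_deriveD (vd_dot hE hE) (is_deriveZ alpha (vd_dot hO hO)).
move/is_derive_eq; apply.
rewrite -enstrophy_balance /GRing.scale/= (dotC (odeE _ _)) (dotC (symO (odeA _ _))); ring.
Qed.

Lemma enstrophy_le_energy r t : 0 < r -> r < t -> enstrophy (a t) (b t) <= cE / (t - r) * energy r.
Proof.
move=> r0 rt; have d0 : 0 < t - r by rewrite subr_gt0.
apply: (le_trans (enstrophy_le _ _)); rewrite -/cE -mulrA; apply: ler_wpM2l; first exact: cE_ge0.
rewrite mulrC ler_pdivlMr// mulrC; apply: (le_trans (dissip_le_energy r0 rt)).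
by rewrite gerBl energy_ge0.
Qed.

(** Keeps the energy drop, which becomes small at late times and yields o(1/t);
    [enstrophy_le_energy] serves for domination. *)
Lemma enstrophy_le_drop r t : 0 < r -> r < t ->
  (t - r) * enstrophy (a t) (b t) <= cE * (energy r - energy t).
Proof.
move=> r0 rt; have d0 : 0 < t - r by rewrite subr_gt0.
apply: le_trans (ler_wpM2l cE_ge0 (dissip_le_energy r0 rt)).
by rewrite mulrCA ler_pM2l//; exact: enstrophy_le.
Qed.

Lemma palinstrophy_le_energy r t : 0 < r -> r < t ->
  palinstrophy (a t) (b t) <= cD * ((t - r)^-1 + 4 / (t - r) ^+ 2) * energy r.
Proof.
move=> r0 rt; have d0 : 0 < t - r by rewrite subr_gt0.
have t0 : 0 < t by exact: lt_trans rt.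
apply: (le_trans (palinstrophy_le _ (diva t0))); rewrite -mulrA; apply: ler_wpM2l; first exact: cD_ge0.
rewrite mulrDl; apply: lerD.
  rewrite mulrC ler_pdivlMr// mulrC; apply: (le_trans (dissip_le_energy r0 rt)).
  by rewrite gerBl energy_ge0.
rewrite mulrAC ler_pdivlMr ?exprn_gt0// mulrC; exact: accel_le_energy.
Qed.

End symbol_ode.

(** * The enstrophy identity *)

Section fourier_hartley.
Context {R : realType}.
Local Notation L := (measurableTypeR R).
Local Notation L3 := (L * L * L)%type.
Local Notation mu := (@mu3 R).
Local Notation kt := (ktr (@mu3 R) (@cas3 R)).
Local Notation K3 := (@isometric_kernel3 R).
Local Notation hart3 := (hart mu (@cas3 R) (@cube R)).
Local Notation tr := (trunc (@cube R)).

(** [is_fourier] controls the real and imaginary residuals [r] and [q], and the Hartley residual is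
    a signed sum of the two; the factor 2 is from (x + y)^2 <= 2 (x^2 + y^2). *)
Lemma hart3_of_cvg (f g : L3 -> R) (r q : nat -> L3 -> R) : sqint mu f -> sqint mu g ->
  (forall n, measurable_fun setT (r n)) -> (forall n, measurable_fun setT (q n)) ->
  (forall n xi, (kt (tr n f) xi - g xi) ^+ 2 <= 2 * (r n xi ^+ 2 + q n xi ^+ 2)) ->
  (\int[mu]_xi ((r n xi) ^+ 2)%:E + \int[mu]_xi ((q n xi) ^+ 2)%:E)%E @[n --> \oo] --> 0%E ->
  hart3 f g.
Proof.
move=> hf hg mr mq le2 cv; split => //.
have hk n : sqint mu (kt (tr n f) \- g).
  by apply: sqintB => //; exact: (ktr_bsupp_iso K3 (trunc_bsupp K3 n hf)).1.
have m2 (u : L3 -> R) : measurable_fun setT u -> measurable_fun setT (fun xi => ((u xi) ^+ 2)%:E).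
  by move=> mu_; apply/measurable_EFinP; exact: measurable_funX.
have bound n : ((ip mu (kt (tr n f) \- g) (kt (tr n f) \- g))%:E <=
    2%:E * (\int[mu]_xi ((r n xi) ^+ 2)%:E + \int[mu]_xi ((q n xi) ^+ 2)%:E))%E.
  rewrite -integral_sqr// -ge0_integralD//; [|by move=> x _; rewrite lee_fin sqr_ge0|exact: m2|
    by move=> x _; rewrite lee_fin sqr_ge0|exact: m2].
  rewrite -ge0_integralZl//; [|by apply: emeasurable_funD; exact: m2|
    by move=> x _; rewrite -EFinD lee_fin addr_ge0 ?sqr_ge0].
  apply: ge0_le_integral => //.
  - by move=> x _; rewrite lee_fin sqr_ge0.
  - by apply: m2; case: (hk n).
  - apply: emeasurable_funM; first exact: measurable_cst.
    by apply: emeasurable_funD; exact: m2.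
  - by move=> xi _; rewrite -EFinD -EFinM lee_fin /=; exact: le2.
have : (ip mu (kt (tr n f) \- g) (kt (tr n f) \- g))%:E @[n --> \oo] --> 0%E.
  apply: (@squeeze_cvge _ _ _ _ (cst 0%E) _ (fun n => 2%:E * (\int[mu]_xi ((r n xi) ^+ 2)%:E + \int[mu]_xi ((q n xi) ^+ 2)%:E))%E).
  - by apply: nearW => n; rewrite bound andbT lee_fin ip_ge0.
  - exact: cvg_cst.
  - by rewrite -[X in _ --> X](mule0 2%:E); apply: cvgeZl.
by move/fine_cvgP => [_].
Qed.

Definition cos3 (x y : L3) : R := cos (dot x y).
Definition sin3 (x y : L3) : R := sin (dot x y).

Lemma measurable_dot : measurable_fun setT (fun p : L3 * L3 => dot (p.1 : R3 R) (p.2 : R3 R)).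
Proof.
have h i : measurable_fun setT (fun p : L3 * L3 => crd (p.1 : R3 R) i * crd (p.2 : R3 R) i).
  apply: measurable_funM; first exact: (measurableT_comp (measurable_crd i) measurable_fst).
  exact: (measurableT_comp (measurable_crd i) measurable_snd).
rewrite (_ : (fun _ => _) = (fun p : L3 * L3 => crd (p.1 : R3 R) 0 * crd (p.2 : R3 R) 0 +
   crd (p.1 : R3 R) 1 * crd (p.2 : R3 R) 1 + crd (p.1 : R3 R) (1 + 1) * crd (p.2 : R3 R) (1 + 1))).
  exact: measurable_funD (measurable_funD (h 0) (h 1)) (h (1 + 1)).
by apply/funext => p; rewrite sumr_crd.
Qed.

Lemma measurable_cos3 : measurable_fun setT (fun p : L3 * L3 => cos3 p.1 p.2).
Proof. exact: measurableT_comp (@measurable_cos R) measurable_dot. Qed.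

Lemma measurable_sin3 : measurable_fun setT (fun p : L3 * L3 => sin3 p.1 p.2).
Proof. exact: measurableT_comp (@measurable_sin R) measurable_dot. Qed.

Lemma trunc_fourierE (f : L3 -> R) n xi : sqint mu f ->
  [/\ complex.Re (trunc_fourier f n xi) = ktr mu cos3 (tr n f) xi,
      complex.Im (trunc_fourier f n xi) = - ktr mu sin3 (tr n f) xi &
      kt (tr n f) xi = ktr mu cos3 (tr n f) xi + ktr mu sin3 (tr n f) xi].
Proof.
move=> hf; have tb := trunc_bsupp K3 n hf; have ti := bsupp_integrable K3 tb.
have mt : measurable_fun setT (tr n f) by case: tb => -[].
have E (k : L3 -> R) : \int[leb3]_(x in [set x : R3 R | `|x| <= n%:R]) (f x * k x) =
    \int[mu]_x (tr n f x * k x).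
  rewrite Rintegral_mkcond; apply: eq_Rintegral => x _.
  rewrite /trunc patchE indicE; case: ifPn => h; first by rewrite mul1r.
  by rewrite !mul0r.
split; rewrite /trunc_fourier/=.
- exact: (E (fun x => cos (dot (x : R3 R) (xi : R3 R)))).
- exact: (congr1 -%R (E (fun x => sin (dot (x : R3 R) (xi : R3 R))))).
have i1 : mu.-integrable setT (EFin \o (fun x => tr n f x * cos3 x xi)).
  apply: (le_integrable_EFin _ _ (integrable_norm ti)).
    apply: measurable_funM => //; exact: measurableT_comp measurable_cos3 (measurable_pair2 xi).
  by move=> x; rewrite normrM ler_piMr//; exact: cos_max.
have i2 : mu.-integrable setT (EFin \o (fun x => tr n f x * sin3 x xi)).
  apply: (le_integrable_EFin _ _ (integrable_norm ti)).
    apply: measurable_funM => //; exact: measurableT_comp measurable_sin3 (measurable_pair2 xi).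
  by move=> x; rewrite normrM ler_piMr//; exact: sin_max.
by rewrite /ktr -RintegralD//; apply: eq_Rintegral => x _; rewrite -mulrDr.
Qed.

(** The imaginary part of exp(- i x.xi) is - sin(x.xi), so cosine plus sine is Re - Im; at -xi the
    sine changes sign, which gives the second form. *)
Lemma fourier_hart (f : R3 R -> R) (F : R3 R -> R[i]) : is_fourier f F ->
  hart3 f (fun xi => complex.Re (F xi) - complex.Im (F xi)) /\
  hart3 f (fun xi => complex.Re (F (- xi)) + complex.Im (F (- xi))).
Proof.
move=> [/Lfun3P hf /Lfun3P hr /Lfun3P hi cv].
pose r n (xi : L3) : R := complex.Re (F xi - trunc_fourier f n xi).
pose q n (xi : L3) : R := complex.Im (F xi - trunc_fourier f n xi).
have mt n : measurable_fun setT (tr n f) by case: (trunc_bsupp K3 n hf) => -[].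
have rE n xi : r n xi = complex.Re (F xi) - ktr mu cos3 (tr n f) xi.
  by have [<- _ _] := trunc_fourierE n xi hf; rewrite /r raddfB.
have qE n xi : q n xi = complex.Im (F xi) + ktr mu sin3 (tr n f) xi.
  by have [_ e _] := trunc_fourierE n xi hf; rewrite /q raddfB [X in _ - X]e opprK.
have mr n : measurable_fun setT (r n).
  rewrite (_ : r n = fun xi => complex.Re (F xi) - ktr mu cos3 (tr n f) xi); last exact/funext.
  by apply: measurable_funB; [case: hr|apply: ktr_measurable => //; exact: measurable_cos3].
have mq n : measurable_fun setT (q n).
  rewrite (_ : q n = fun xi => complex.Im (F xi) + ktr mu sin3 (tr n f) xi); last exact/funext.
  by apply: measurable_funD; [case: hi|apply: ktr_measurable => //; exact: measurable_sin3].
have {}cv : (\int[mu]_xi ((r n xi) ^+ 2)%:E + \int[mu]_xi ((q n xi) ^+ 2)%:E)%E @[n --> \oo] --> 0%E := cv.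
clearbody r q.
have sq2 (x y : R) : (x + y) ^+ 2 <= 2 * (x ^+ 2 + y ^+ 2).
  by have := sqr_ge0 (x - y); rewrite !expr2; lra.
split.
  apply: (@hart3_of_cvg _ _ r q) => //; first exact: sqintB.
  move=> n xi; have [_ _ ->] := trunc_fourierE n xi hf.
  rewrite -[r n xi ^+ 2]sqrrN; apply: le_trans (sq2 _ _).
  by rewrite rE qE le_eqVlt; apply/orP; left; apply/eqP; congr (_ ^+ 2); ring.
have mN (u : L3 -> R) : measurable_fun setT u -> measurable_fun setT (fun xi : L3 => u (- (xi : R3 R))).
  by move=> mu_; exact: measurableT_comp mu_ measurable_opp3.
apply: (@hart3_of_cvg _ _ (fun n (xi : L3) => r n (- (xi : R3 R))) (fun n (xi : L3) => q n (- (xi : R3 R)))) => //.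
- by have := preserves_sqint preserves3_opp (sqintD hr hi).
- by move=> n; exact: mN.
- by move=> n; exact: mN.
- move=> n xi; have [_ _ ->] := trunc_fourierE n xi hf.
  rewrite -[r n _ ^+ 2]sqrrN -[q n _ ^+ 2]sqrrN; apply: le_trans (sq2 _ _).
  rewrite rE qE le_eqVlt; apply/orP; left; apply/eqP; congr (_ ^+ 2).
  have -> : ktr mu cos3 (tr n f) (- (xi : R3 R)) = ktr mu cos3 (tr n f) xi.
    by apply: eq_Rintegral => x _; rewrite /cos3 dotNr cosN.
  have -> : ktr mu sin3 (tr n f) (- (xi : R3 R)) = - ktr mu sin3 (tr n f) xi.
    rewrite -[RHS]mulN1r /ktr -RintegralZl//; last first.
      apply: (le_integrable_EFin _ _ (integrable_norm (bsupp_integrable K3 (trunc_bsupp K3 n hf)))).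
        by apply: measurable_funM => //; exact: measurableT_comp measurable_sin3 (measurable_pair2 _).
      by move=> x; rewrite normrM ler_piMr//; exact: sin_max.
    by apply: eq_Rintegral => x _; rewrite /sin3 dotNr sinN mulN1r mulrN.
  by ring.
- have E (u : nat -> L3 -> R) n : measurable_fun setT (u n) ->
     (\int[mu]_xi ((u n (- (xi : R3 R))) ^+ 2)%:E = \int[mu]_xi ((u n xi) ^+ 2)%:E)%E.
    move=> mun; apply: (preserves_integral (f := fun xi => ((u n xi) ^+ 2)%:E) preserves3_opp).
    by apply/measurable_EFinP; exact: measurable_funX.
  under eq_cvg do rewrite (E r _ (mr _)) (E q _ (mq _)).
  exact: cv.
Qed.

End fourier_hartley.

Section hartley_fields.
Context {R : realType}.
Local Notation L := (measurableTypeR R).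
Local Notation L3 := (L * L * L)%type.
Local Notation mu3 := (@mu3 R).
Local Notation K3 := (@isometric_kernel3 R).
Local Notation hart3 := (hart mu3 (@cas3 R) (@cube R)).
Local Notation Re := complex.Re.
Local Notation Im := complex.Im.
Implicit Types (xi : R3 R) (Z : 'I_3 -> R[i]) (z : R[i]).

Lemma crd0 i : crd (0 : R3 R) i = 0.
Proof. by elim/I3_ind: i. Qed.

Lemma ReIm_realM (k : R) z : Re (k%:C%C * z) = k * Re z /\ Im (k%:C%C * z) = k * Im z.
Proof. by case: z => x y; split; rewrite /=; ring. Qed.

Lemma ReIm_realNM (k : R) z : Re (- k%:C%C * z) = - (k * Re z) /\ Im (- k%:C%C * z) = - (k * Im z).
Proof. by case: z => x y; split; rewrite /=; ring. Qed.

Lemma ReD (x y : R[i]) : Re (x + y) = Re x + Re y. Proof. by case: x y => ? ? []. Qed.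

Lemma ImD (x y : R[i]) : Im (x + y) = Im x + Im y. Proof. by case: x y => ? ? []. Qed.

Lemma ReB (x y : R[i]) : Re (x - y) = Re x - Re y. Proof. by case: x y => ? ? []. Qed.

Lemma ImB (x y : R[i]) : Im (x - y) = Im x - Im y. Proof. by case: x y => ? ? []. Qed.

Lemma ReIm_iM z : Re ('i%C * z) = - Im z /\ Im ('i%C * z) = Re z.
Proof. by case: z => x y; split; rewrite /=; ring. Qed.

Lemma ReIm_fcurl xi Z i :
  Re (fcurl xi Z i) = - crd (cross xi (vec (fun j => Im (Z j)))) i /\
  Im (fcurl xi Z i) = crd (cross xi (vec (fun j => Re (Z j)))) i.
Proof.
rewrite /fcurl crd_cross crd_vec; have [-> ->] := ReIm_iM ((crd xi (i + 1))%:C%C * Z (i + 2) - (crd xi (i + 2))%:C%C * Z (i + 1)).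
rewrite ReB ImB.
have [e1 e2] := ReIm_realM (crd xi (i + 1)) (Z (i + 2)).
have [e3 e4] := ReIm_realM (crd xi (i + 2)) (Z (i + 1)).
by rewrite crd_cross !crd_vec e1 e2 e3 e4; split.
Qed.

Lemma ReIm_fdiv xi Z :
  Re (fdiv xi Z) = - dot xi (vec (fun j => Im (Z j))) /\
  Im (fdiv xi Z) = dot xi (vec (fun j => Re (Z j))).
Proof.
have [e1 e2] := ReIm_iM (\sum_j (crd xi j)%:C%C * Z j).
have h j := ReIm_realM (crd xi j) (Z j).
have [[r0 i0] [r1 i1] [r2 i2]] := And3 (h 0) (h 1) (h (1 + 1)).
by rewrite /fdiv e1 e2 sum3E !ReD !ImD r0 r1 r2 i0 i1 i2 !sumr_crd !crd_vec.
Qed.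

(* Re (i z) + Im (i z) = Re z - Im z, so taking the transform of u at -xi and that
   of w at xi absorbs the factor i of the curl. On the exceptional null set the
   fields are set to 0, which also solves the system. *)
Lemma hartley_fields (mu chi gamma kappa : R) (u0 w0 : vfield R) (u w : R -> vfield R) :
  micropolar_solution mu chi gamma kappa u0 w0 u w ->
  exists A B : R -> R3 R -> R3 R,
  [/\ forall xi t, 0 < t -> vd (A ^~ xi) t (odeA mu chi xi (A t xi) (B t xi)),
      forall xi t, 0 < t -> vd (B ^~ xi) t (odeB chi gamma kappa xi (A t xi) (B t xi)),
      forall xi t, 0 < t -> dot xi (A t xi) = 0,
      forall t, 0 < t -> forall i, hart3 (u t i) (fun xi => crd (A t (- (xi : R3 R))) i) &
      forall t, 0 < t -> forall i, hart3 (w t i) (fun xi => crd (B t xi) i)].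
Proof.
move=> [U [W [_ hUW _ [N [mN N0 ode]]]]].
pose A t xi : R3 R := if xi \in N then 0 else vec (fun i => Re (U t xi i) + Im (U t xi i)).
pose B t xi : R3 R := if xi \in N then 0 else vec (fun i => Re (W t xi i) - Im (W t xi i)).
have mNc : measurable (~` N) by exact: measurableC.
have aeN : {ae mu3, forall xi, xi \notin N}.
  by exists N; split => // xi /= /negP; rewrite negbK => /set_mem.
have ode' xi : xi \notin N -> forall t : R, 0 < t ->
        [/\ forall i, is_cderive (fun s => U s xi i) t
              (- ((mu + chi) * dot xi xi)%:C%C * U t xi i
               + (2 * chi)%:C%C * fcurl xi (W t xi) i),
            forall i, is_cderive (fun s => W s xi i) t
              (- (gamma * dot xi xi)%:C%C * W t xi i
               + kappa%:C%C * ('i%C * (crd xi i)%:C%C * fdiv xi (W t xi))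
               + (2 * chi)%:C%C * fcurl xi (U t xi) i
               - (4 * chi)%:C%C * W t xi i) &
            fdiv xi (U t xi) = 0].
  move=> xN; apply: contrapT => h; move/negP: xN; apply; apply/mem_set; exact: ode.
exists A, B; split.
- move=> xi t t0; rewrite /A /B; case: ifPn => [_|/ode' /(_ t t0) [dU _ dv]].
    rewrite /odeA; have -> : cross xi 0 = 0 by apply: R3_eq; rewrite /= !mulr0 subrr.
    by rewrite !scaler0 addr0; exact: vd_cst.
  move=> i; have [hr hi] := dU i.
  rewrite (_ : (fun s => _) = (fun s : R => Re (U s xi i)) + (fun s : R => Im (U s xi i))); last first.
    by apply/funext => s; rewrite crd_vec.
  apply: (is_derive_eq (is_deriveD hr hi)).
  rewrite !ReD !ImD.
  have [-> ->] := ReIm_realNM ((mu + chi) * dot xi xi) (U t xi i).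
  have [-> ->] := ReIm_realM (2 * chi) (fcurl xi (W t xi) i).
  have [-> ->] := ReIm_fcurl xi (W t xi) i.
  by rewrite /odeA crdD !crdZ !crd_cross !crd_vec; ring.
- move=> xi t t0; rewrite /A /B; case: ifPn => [_|/ode' /(_ t t0) [_ dW _]].
    rewrite /odeB; have -> : cross xi 0 = 0 by apply: R3_eq; rewrite /= !mulr0 subrr.
    by rewrite dotC dot0l mulr0 scale0r !scaler0 !subrr; exact: vd_cst.
  move=> i; have [hr hi] := dW i.
  rewrite (_ : (fun s => _) = (fun s : R => Re (W s xi i)) - (fun s : R => Im (W s xi i))); last first.
    by apply/funext => s; rewrite crd_vec.
  apply: (is_derive_eq (is_deriveB hr hi)).
  rewrite !ReB !ImB !ReD !ImD -mulrA.
  have [-> ->] := ReIm_realNM (gamma * dot xi xi) (W t xi i).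
  have [-> ->] := ReIm_realM kappa ('i%C * ((crd xi i)%:C%C * fdiv xi (W t xi))).
  have [-> ->] := ReIm_realM (2 * chi) (fcurl xi (U t xi) i).
  have [-> ->] := ReIm_realM (4 * chi) (W t xi i).
  have [-> ->] := ReIm_iM ((crd xi i)%:C%C * fdiv xi (W t xi)).
  have [-> ->] := ReIm_realM (crd xi i) (fdiv xi (W t xi)).
  have [-> ->] := ReIm_fcurl xi (U t xi) i.
  have [-> ->] := ReIm_fdiv xi (W t xi).
  rewrite /odeB !crdB !crdZ !crd_cross !crd_vec !sumr_crd !crd_vec; ring.
- move=> xi t t0; rewrite /A; case: ifPn => [_|/ode' /(_ t t0) [_ _ dv]].
    by rewrite dotC dot0l.
  have [] := ReIm_fdiv xi (U t xi); rewrite dv /= => /eqP.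
  rewrite eq_sym oppr_eq0 => /eqP e1 e2.
  by move: e1 e2; rewrite !sumr_crd !crd_vec; lra.
- move=> t t0 i; have [/(_ i) hU _] := hUW t t0; have [_ h] := fourier_hart hU.
  have mA : measurable_fun setT (fun xi : L3 => crd (A t (- (xi : R3 R))) i).
    rewrite (_ : (fun xi => _) = fun xi : L3 => \1_(~` N) (- (xi : R3 R)) *
        (Re (U t (- xi) i) + Im (U t (- xi) i))); last first.
      apply/funext => xi; rewrite /A indicE in_setC; case: ifPn => _ /=; last by rewrite mul1r crd_vec.
      by rewrite mul0r crd0.
    apply: measurable_funM; last by case: h => _ [].
    by apply: (measurableT_comp _ measurable_opp3); exact: measurable_indic.
  apply: (hart_ae K3 h mA).
  by apply: (ae_mono (preserves_ae preserves3_opp aeN)) => xi xN; rewrite /A (negbTE xN) crd_vec.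
- move=> t t0 i; have [_ /(_ i) hW] := hUW t t0; have [h _] := fourier_hart hW.
  have mB : measurable_fun setT (fun xi : L3 => crd (B t xi) i).
    rewrite (_ : (fun xi => _) = fun xi : L3 => \1_(~` N) xi *
        (Re (W t xi i) - Im (W t xi i))); last first.
      apply/funext => xi; rewrite /B indicE in_setC; case: ifPn => _ /=; last by rewrite mul1r crd_vec.
      by rewrite mul0r crd0.
    apply: measurable_funM; last by case: h => _ [].
    exact: measurable_indic.
  apply: (hart_ae K3 h mB).
  by apply: (ae_mono aeN) => xi xN; rewrite /B (negbTE xN) crd_vec.
Qed.

End hartley_fields.

(** * Norms of fields and gradients through their symbols *)

Section vector_symbols.
Context {R : realType}.
Local Notation L := (measurableTypeR R).
Local Notation L3 := (L * L * L)%type.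
Local Notation mu3 := (@mu3 R).
Local Notation c := (@const3 R).
Implicit Types (G : L3 -> R3 R) (F : L3 -> R) (t : R).

Definition vmeas G := forall i, measurable_fun setT (fun xi => crd (G xi) i).
Definition vsqint G := forall i, sqint mu3 (fun xi => crd (G xi) i).

Lemma measurable_dotv G H : vmeas G -> vmeas H -> measurable_fun setT (fun xi => dot (G xi) (H xi)).
Proof.
move=> mG mH; have h i := measurable_funM (mG i) (mH i).
have := measurable_funD (measurable_funD (h 0) (h 1)) (h (1 + 1)).
by congr measurable_fun; apply/funext => xi; rewrite sumr_crd.
Qed.

Lemma vmeas_id : vmeas id.
Proof. exact: measurable_crd. Qed.

Lemma vmeasZ (k : R) G : vmeas G -> vmeas (fun xi => k *: G xi).
Proof. by move=> mG i; under eq_fun do rewrite crdZ; exact: measurable_funM. Qed.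

Lemma vmeasB G H : vmeas G -> vmeas H -> vmeas (fun xi => G xi - H xi).
Proof. by move=> mG mH i; under eq_fun do rewrite crdB; exact: measurable_funB. Qed.

Lemma vmeas_symO G : vmeas G -> vmeas (fun xi => symO xi (G xi)).
Proof.
move=> mG i; rewrite /symO; under eq_fun do rewrite crdN crd_cross.
by apply: measurableT_comp => //; apply: measurable_funB; apply: measurable_funM => //; exact: measurable_crd.
Qed.

Lemma vmeas_tproj G : vmeas G -> vmeas (fun xi => tproj xi (G xi)).
Proof.
move=> mG i; rewrite /tproj; under eq_fun do rewrite crdB crdZ.
apply: measurable_funB => //; apply: measurable_funM; last exact: measurable_crd.
apply: measurable_funM; first exact: measurable_dotv vmeas_id mG.
by apply: (measurableT_comp (@measurable_inv R)); exact: measurable_dotv vmeas_id vmeas_id.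
Qed.

Lemma integrable_dotv G : vsqint G -> mu3.-integrable setT (EFin \o (fun xi => dot (G xi) (G xi))).
Proof.
move=> hG; have h i := integrable_sqintM (hG i) (hG i).
have := integrable_EFinD (integrable_EFinD (h 0) (h 1)) (h (1 + 1)).
by congr (_.-integrable _ (_ \o _)); apply/funext => xi; rewrite sumr_crd.
Qed.

Lemma Rintegral_dotv G : vsqint G ->
  \int[mu3]_xi dot (G xi) (G xi) = \sum_i ip mu3 (fun xi => crd (G xi) i) (fun xi => crd (G xi) i).
Proof.
move=> hG; have h i := integrable_sqintM (hG i) (hG i).
have h01 := integrable_EFinD (h 0) (h 1).
rewrite sum3E /ip -!RintegralD//; try first [exact: h|exact: h01].
by apply: eq_Rintegral => xi _; rewrite sumr_crd.
Qed.

Lemma vsqint_le G F : vmeas G -> (forall xi, dot (G xi) (G xi) <= F xi) ->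
  mu3.-integrable setT (EFin \o F) -> vsqint G.
Proof.
move=> mG GF iF i; apply: sqint_le_sqr iF => // xi.
exact: le_trans (sqr_crd_le _ _) (GF xi).
Qed.

Lemma vdist_sqL2_symbol (V : 'I_3 -> distr R) G :
  (forall i, symbol (V i) (fun xi => crd (G xi) i)) -> vsqint G ->
  vdist_sqL2 V = (c^-1 * \int[mu3]_xi dot (G xi) (G xi))%:E.
Proof.
move=> hV hG; rewrite Rintegral_dotv// mulr_sumr -sumEFin /vdist_sqL2.
by apply: eq_bigr => i _; exact: dist_sqL2_symbol.
Qed.

Lemma vsqL2_hart (v : vfield R) G :
  (forall i, hart mu3 (@cas3 R) (@cube R) (v i) (fun xi => crd (G xi) i)) ->
  vsqL2 v = (c^-1 * \int[mu3]_xi dot (G xi) (G xi))%:E.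
Proof.
move=> hv; have hG : vsqint G by move=> i; case: (hv i).
rewrite Rintegral_dotv// mulr_sumr -sumEFin /vsqL2; apply: eq_bigr => i _.
have hvi : sqint mu3 (v i) by case: (hv i).
have := integral_sqr hvi; rewrite /sqL2 => ->.
by rewrite (hart_norm (@isometric_kernel3 R) (hv i)) mulKf// gt_eqF// const3_gt0.
Qed.

(** The substitution xi -> -xi removes the reflection, and the squares of xi_i G_j add up to |xi|^2
    |G|^2. *)
Lemma tdist_sqL2_symbol (T : 'I_3 -> 'I_3 -> distr R) G :
  (forall i j, symbol (T i j) (fun xi => - crd xi i * crd (G (- (xi : R3 R))) j)) -> vmeas G ->
  mu3.-integrable setT (EFin \o (fun xi => dot xi xi * dot (G xi) (G xi))) ->
  tdist_sqL2 T = (c^-1 * \int[mu3]_xi (dot xi xi * dot (G xi) (G xi)))%:E.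
Proof.
move=> hT mG iG.
pose m i j (xi : L3) : R := crd xi i * crd (G xi) j.
have hm i j : sqint mu3 (m i j).
  apply: sqint_le_sqr iG; first by apply: measurable_funM => //; exact: measurable_crd.
  move=> xi; rewrite exprMn; apply: ler_pM; rewrite ?sqr_ge0//; exact: sqr_crd_le.
have E i j : dist_sqL2 (T i j) = (c^-1 * ip mu3 (m i j) (m i j))%:E.
  have E1 : (fun xi => - crd xi i * crd (G (- (xi : R3 R))) j) = m i j \o (fun xi : L3 => - (xi : R3 R)).
    by apply/funext => xi; rewrite /m /= crdN.
  have hT' := hT i j; rewrite E1 in hT'.
  rewrite (dist_sqL2_symbol hT' (preserves_sqint preserves3_opp (hm i j))).
  by rewrite (preserves_ip preserves3_opp)//; case: (hm i j).
rewrite /tdist_sqL2; under eq_bigr do under eq_bigr do rewrite E.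
under eq_bigr do rewrite sumEFin; rewrite sumEFin; congr EFin.
under eq_bigr do rewrite -mulr_sumr; rewrite -mulr_sumr; congr (_ * _).
have h i j := integrable_sqintM (hm i j) (hm i j).
have hi i : mu3.-integrable setT (EFin \o (fun xi => \sum_j m i j xi * m i j xi)).
  have := integrable_EFinD (integrable_EFinD (h i 0) (h i 1)) (h i (1 + 1)).
  by congr (_.-integrable _ (_ \o _)); apply/funext => xi; rewrite sum3E.
have Ei i : \sum_j ip mu3 (m i j) (m i j) = \int[mu3]_xi (\sum_j m i j xi * m i j xi).
  have h01 := integrable_EFinD (h i 0) (h i 1).
  rewrite sum3E /ip -!RintegralD//; try first [exact: h|exact: h01].
  by apply: eq_Rintegral => xi _; rewrite sum3E.
under eq_bigr do rewrite Ei.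
have h01 := integrable_EFinD (hi 0) (hi 1).
rewrite sum3E -!RintegralD//; try first [exact: hi|exact: h01].
apply: eq_Rintegral => xi _; rewrite /= !sum3E /m !sumr_crd; ring.
Qed.

End vector_symbols.

(** * Domination, differentiation under the integral, decay *)

Section enstrophy_identity.
Context {R : realType}.
Local Notation L := (measurableTypeR R).
Local Notation L3 := (L * L * L)%type.
Local Notation mu3 := (@mu3 R).
Local Notation c := (@const3 R).
Local Notation hart3 := (hart mu3 (@cas3 R) (@cube R)).
Implicit Types (t r : R).
Variables (mu chi gamma kappa : R).
Hypotheses (mu0 : 0 < mu) (chi0 : 0 < chi) (gamma0 : 0 <= gamma) (kappa0 : 0 <= kappa).
Variables (A B : R -> R3 R -> R3 R) (u h : R -> vfield R).
Hypothesis dA : forall xi t, 0 < t -> vd (A ^~ xi) t (odeA mu chi xi (A t xi) (B t xi)).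
Hypothesis dB : forall xi t, 0 < t -> vd (B ^~ xi) t (odeB chi gamma kappa xi (A t xi) (B t xi)).
Hypothesis diva : forall xi t, 0 < t -> dot xi (A t xi) = 0.
Hypothesis hu : forall t, 0 < t -> forall i, hart3 (u t i) (fun xi => crd (A t (- (xi : R3 R))) i).
Hypothesis sB : forall t, 0 < t -> vsqint (B t).
Hypothesis hh : forall t, 0 < t -> forall i, hart3 (h t i) (fun xi => crd (tproj xi (B t xi)) i).

Let en t (xi : L3) := energy (A ^~ xi) (B ^~ xi) t.
Let ens t (xi : L3) := enstrophy mu chi gamma xi (A t xi) (B t xi).
Let pal t (xi : L3) := palinstrophy mu chi gamma xi (A t xi) (B t xi).
Let O t (xi : L3) := symO xi (A t xi).
Let E t (xi : L3) := symE xi (A t xi) (B t xi).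
Let K t (xi : L3) := symK mu chi xi (A t xi) (B t xi).

Lemma vsqint_A t : 0 < t -> vsqint (A t).
Proof.
move=> t0 i; have [_ + _] := hu t0 i => /(preserves_sqint preserves3_opp).
by congr sqint; apply/funext => xi /=; rewrite opprK.
Qed.

Lemma vmeas_A t : 0 < t -> vmeas (A t).
Proof. by move=> t0 i; case: (vsqint_A t0 i). Qed.

Lemma vmeas_B t : 0 < t -> vmeas (B t).
Proof. by move=> t0 i; case: (sB t0 i). Qed.

Lemma vmeas_O t : 0 < t -> vmeas (O t).
Proof. by move=> t0; apply: vmeas_symO; exact: vmeas_A. Qed.

Lemma vmeas_E t : 0 < t -> vmeas (E t).
Proof.
move=> t0; apply: vmeasB; first by apply: vmeas_tproj; exact: vmeas_B.
by apply: vmeasZ; exact: vmeas_O.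
Qed.

Lemma vmeas_K t : 0 < t -> vmeas (K t).
Proof. by move=> t0; apply: vmeasB; [exact: vmeas_E|apply: vmeasZ; exact: vmeas_O]. Qed.

Lemma integrable_en t : 0 < t -> mu3.-integrable setT (EFin \o en t).
Proof.
move=> t0; exact: integrable_EFinD (integrable_dotv (vsqint_A t0)) (integrable_dotv (sB t0)).
Qed.

Lemma ens_le r t xi : 0 < r -> r < t -> ens t xi <= cE mu chi gamma / (t - r) * en r xi.
Proof. exact: (enstrophy_le_energy mu0 chi0 gamma0 kappa0 (dA xi) (dB xi)). Qed.

Lemma pal_le r t xi : 0 < r -> r < t ->
  pal t xi <= cD mu chi gamma * ((t - r)^-1 + 4 / (t - r) ^+ 2) * en r xi.
Proof. exact: (palinstrophy_le_energy mu0 chi0 gamma0 kappa0 (dA xi) (dB xi) (diva xi)). Qed.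

Lemma ens_ge0 t xi : 0 <= ens t xi.
Proof. exact: enstrophy_ge0. Qed.

Lemma pal_ge0 t xi : 0 <= pal t xi.
Proof. exact: palinstrophy_ge0. Qed.

Lemma half_itv t : 0 < t -> 0 < t / 2 /\ t / 2 < t.
Proof. by move=> t0; split; lra. Qed.

Lemma measurable_ens t : 0 < t -> measurable_fun setT (ens t).
Proof.
move=> t0; apply: measurable_funD; first by apply: measurable_dotv; exact: vmeas_E.
by apply: measurable_funM => //; apply: measurable_dotv; exact: vmeas_O.
Qed.

Lemma measurable_pal t : 0 < t -> measurable_fun setT (pal t).
Proof.
move=> t0; have m2 := measurable_dotv (@vmeas_id R) (@vmeas_id R).
have mE := measurable_dotv (vmeas_E t0) (vmeas_E t0).
have mK := measurable_dotv (vmeas_K t0) (vmeas_K t0).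
have mO := measurable_dotv (vmeas_O t0) (vmeas_O t0).
apply: measurable_funD; first apply: measurable_funD.
- exact: measurable_funM.
- by apply: measurable_funM => //; exact: measurable_funM m2 mK.
- by apply: measurable_funM => //; exact: measurable_funM m2 mO.
Qed.

(** Dominated by a multiple of the energy at the earlier positive time t / 2. *)
Lemma integrable_ens t : 0 < t -> mu3.-integrable setT (EFin \o ens t).
Proof.
move=> t0; have [r0 rt] := half_itv t0.
apply: (le_integrable_EFin (measurable_ens t0) _ (integrable_EFinZ _ (integrable_en r0))) => xi.
by rewrite ger0_norm ?ens_ge0//; exact: ens_le.
Qed.

Lemma integrable_pal t : 0 < t -> mu3.-integrable setT (EFin \o pal t).
Proof.
move=> t0; have [r0 rt] := half_itv t0.
apply: (le_integrable_EFin (measurable_pal t0) _ (integrable_EFinZ _ (integrable_en r0))) => xi.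
by rewrite ger0_norm ?pal_ge0//; exact: pal_le.
Qed.

Let al := alpha mu chi gamma.
Let al0 : 0 < al. Proof. exact: alpha_gt0. Qed.

Lemma vsqint_E t : 0 < t -> vsqint (E t).
Proof.
move=> t0; apply: vsqint_le (integrable_ens t0); first exact: vmeas_E.
by move=> xi; rewrite lerDl mulr_ge0 ?dot_ge0// ltW.
Qed.

Lemma vsqint_O t : 0 < t -> vsqint (O t).
Proof.
move=> t0; apply: vsqint_le (integrable_EFinZ al^-1 (integrable_ens t0)); first exact: vmeas_O.
move=> xi; rewrite mulrC ler_pdivlMr// mulrC lerDr; exact: dot_ge0.
Qed.

Lemma integrable_sK t : 0 < t ->
  mu3.-integrable setT (EFin \o (fun xi => dot xi xi * dot (K t xi) (K t xi))).
Proof.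
move=> t0; have gc0 : 0 < gamma + chi by rewrite ltr_wpDl.
have rho0 := rho_ge0 mu0 chi0 gamma0.
apply: (le_integrable_EFin _ _ (integrable_EFinZ (gamma + chi)^-1 (integrable_pal t0))).
  apply: measurable_funM; first exact: measurable_dotv vmeas_id vmeas_id.
  by apply: measurable_dotv; exact: vmeas_K.
move=> xi; rewrite ger0_norm ?mulr_ge0 ?dot_ge0//.
rewrite [leRHS]mulrC ler_pdivlMr// mulrC /pal /palinstrophy.
rewrite -/(K t xi); apply: ler_wpDr; last apply: ler_wpDl => //; move: (rho _ _ _) rho0 => ? ?; nonneg.
Qed.

(** For gamma > 0 the coefficient [rho] is positive and the integrable [pal] dominates; for gamma =
    0 [pal] does not contain this term. *)
Lemma integrable_sO t : 0 < t -> 0 < gamma ->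
  mu3.-integrable setT (EFin \o (fun xi => dot xi xi * dot (O t xi) (O t xi))).
Proof.
move=> t0 g0; have r0 : 0 < rho mu chi gamma.
  by rewrite /rho mulr_gt0 ?addr_gt0// divr_gt0 ?mulr_gt0// exprn_gt0.
apply: (le_integrable_EFin _ _ (integrable_EFinZ (rho mu chi gamma)^-1 (integrable_pal t0))).
  apply: measurable_funM; first exact: measurable_dotv vmeas_id vmeas_id.
  by apply: measurable_dotv; exact: vmeas_O.
move=> xi; rewrite ger0_norm ?mulr_ge0 ?dot_ge0//.
rewrite [leRHS]mulrC ler_pdivlMr// mulrC /pal /palinstrophy -/(O t xi).
by apply: ler_wpDl => //; nonneg.
Qed.

Let Om t := dcurl (vdist_of (u t)).
Let Ed t : 'I_3 -> distr R := vdist_of (h t) - 2^-1 *: Om t.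

(** Two reflections cancel: one because [A] is the transform of the velocity at -xi, one from the
    derivative. *)
Lemma symbol_Om t i : 0 < t -> symbol (Om t i) (fun xi => crd (O t xi) i).
Proof.
move=> t0; have hs j := symbol_dist_of (hu t0 j).
have := symbolB (symbol_partial (i + 1) (hs (i + 2))) (symbol_partial (i + 2) (hs (i + 1))).
congr symbol; apply/funext => xi /=; rewrite /O /symO crdN crd_cross !opprK; ring.
Qed.

Lemma symbol_Ed t i : 0 < t -> symbol (Ed t i) (fun xi => crd (E t xi) i).
Proof.
move=> t0; have := symbolB (symbol_dist_of (hh t0 i)) (symbolZ 2^-1 (symbol_Om i t0)).
by congr symbol; apply/funext => xi; rewrite /E /symE crdB crdZ.
Qed.

Lemma vdist_Om t : 0 < t -> vdist_sqL2 (Om t) = (c^-1 * \int[mu3]_xi dot (O t xi) (O t xi))%:E.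
Proof. by move=> t0; apply: vdist_sqL2_symbol (vsqint_O t0) => i; exact: symbol_Om. Qed.

Lemma vdist_Ed t : 0 < t -> vdist_sqL2 (Ed t) = (c^-1 * \int[mu3]_xi dot (E t xi) (E t xi))%:E.
Proof. by move=> t0; apply: vdist_sqL2_symbol (vsqint_E t0) => i; exact: symbol_Ed. Qed.

Lemma tdist_Om t : 0 < t -> 0 < gamma ->
  tdist_sqL2 (dgrad (Om t)) = (c^-1 * \int[mu3]_xi (dot xi xi * dot (O t xi) (O t xi)))%:E.
Proof.
move=> t0 g0; apply: tdist_sqL2_symbol (integrable_sO t0 g0); last exact: vmeas_O.
by move=> i j; exact: symbol_partial (symbol_Om j t0).
Qed.

Lemma tdist_Ed t : 0 < t ->
  tdist_sqL2 (dgrad (Ed t) - (mu / (2 * chi)) *: dgrad (Om t)) =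
  (c^-1 * \int[mu3]_xi (dot xi xi * dot (K t xi) (K t xi)))%:E.
Proof.
move=> t0; apply: tdist_sqL2_symbol (integrable_sK t0); last exact: vmeas_K.
move=> i j; have := symbolB (symbol_partial i (symbol_Ed j t0))
  (symbolZ (mu / (2 * chi)) (symbol_partial i (symbol_Om j t0))).
congr symbol; apply/funext => xi.
have -> : K t (- (xi : R3 R)) = E t (- (xi : R3 R)) - kk mu chi *: O t (- (xi : R3 R)) by [].
by rewrite crdB crdZ /kk /=; move: (crd (E _ _) j) (crd (O _ _) j) => *; ring.
Qed.

Lemma Rintegral_ens t : 0 < t -> \int[mu3]_xi ens t xi =
  \int[mu3]_xi dot (E t xi) (E t xi) + al * \int[mu3]_xi dot (O t xi) (O t xi).
Proof.
move=> t0; have iE := integrable_dotv (vsqint_E t0); have iO := integrable_dotv (vsqint_O t0).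
rewrite -RintegralZl// -RintegralD//; exact: integrable_EFinZ.
Qed.

Lemma Rintegral_pal t : 0 < t -> \int[mu3]_xi pal t xi =
  4 * chi * \int[mu3]_xi dot (E t xi) (E t xi)
  + (gamma + chi) * \int[mu3]_xi (dot xi xi * dot (K t xi) (K t xi))
  + rho mu chi gamma * \int[mu3]_xi (dot xi xi * dot (O t xi) (O t xi)).
Proof.
move=> t0; have iE := integrable_EFinZ (4 * chi) (integrable_dotv (vsqint_E t0)).
have iK := integrable_EFinZ (gamma + chi) (integrable_sK t0).
have iEK := integrable_EFinD iE iK.
have iO : mu3.-integrable setT (EFin \o (fun xi => rho mu chi gamma * (dot xi xi * dot (O t xi) (O t xi)))) /\
   \int[mu3]_xi (rho mu chi gamma * (dot xi xi * dot (O t xi) (O t xi))) =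
   rho mu chi gamma * \int[mu3]_xi (dot xi xi * dot (O t xi) (O t xi)).
  (* For gamma = 0 the integrand is 0 and so is the right-hand side, whatever the value of its
     integral. *)
  have [g0|] := ltP 0 gamma.
    have i := integrable_sO t0 g0; split; first exact: integrable_EFinZ.
    by rewrite RintegralZl.
  move=> g0; have -> : rho mu chi gamma = 0.
    by rewrite /rho (@le_anti _ _ gamma 0) ?g0 ?gamma0// mulr0 !mul0r.
  under [X in EFin \o X]eq_fun do rewrite mul0r.
  under eq_Rintegral do rewrite mul0r.
  by split; [exact: integrable0|rewrite mul0r /Rintegral integral0].
rewrite -RintegralZl//; last exact: integrable_dotv (vsqint_E t0).
rewrite -RintegralZl//; last exact: integrable_sK.
rewrite -iO.2 -RintegralD// -RintegralD//; exact: iO.1.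
Qed.

Let Z t := c^-1 * \int[mu3]_xi ens t xi.

Lemma is_derive_Z t : 0 < t -> is_derive t 1 Z (c^-1 * (-2 * \int[mu3]_xi pal t xi)).
Proof.
(* For x > t / 2 this gives x - r > r, so one multiple of the energy at [r] dominates the derivative
   on the whole neighbourhood. *)
move=> t0; pose r := t / 4.
have r0 : 0 < r by rewrite /r; lra.
pose M := cD mu chi gamma * (r^-1 + 4 / r ^+ 2).
have It : `]t / 2, t * 2[%classic t by rewrite /= in_itv/=; apply/andP; split; lra.
have dens (x : R) (xi : L3) : 0 < x -> is_derive x 1 (ens ^~ xi) (-2 * pal x xi).
  exact: (is_derive_enstrophy chi0 (dA xi) (dB xi)).
have pos (x : R) : `]t / 2, t * 2[%classic x -> 0 < x /\ r < x - r.
  by rewrite /= in_itv/= => /andP[x1 x2]; split; rewrite /r; lra.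
have G0 (xi : L3) : 0 <= 2 * (M * en r xi).
  have e0 := energy_ge0 (A ^~ xi) (B ^~ xi) r.
  have cd0 := cD_ge0 mu0 chi0 gamma0; rewrite /M /en; move: (cD _ _ _) (energy _ _ _) cd0 e0 => ? ? ? ?.
  by nonneg.
have iG : mu3.-integrable setT (EFin \o (fun xi => 2 * (M * en r xi))).
  exact: integrable_EFinZ (integrable_EFinZ M (integrable_en r0)).
have P1 (x : R) (xi : L3) : 0 < x -> partial1of2 ens x xi = -2 * pal x xi.
  by move=> x0; rewrite partial1of2E; case: (dens x xi x0).
have Gub (x : R) (xi : L3) : `]t / 2, t * 2[%classic x -> setT xi -> `|partial1of2 ens x xi| <= 2 * (M * en r xi).
  move=> Ix _; have [x0 rx] := pos x Ix; rewrite P1// normrM normrN !ger0_norm ?pal_ge0// ler_pM2l//.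
  have rx' : r < x by lra.
  apply: (le_trans (pal_le xi r0 rx')); apply: ler_wpM2r; first exact: energy_ge0.
  apply: ler_wpM2l; first exact: cD_ge0.
  have h0 : 0 < x - r by lra.
  apply: lerD; first by rewrite lef_pV2 ?posrE// ltW.
  rewrite ler_pM2l// lef_pV2 ?posrE ?exprn_gt0//.
  by rewrite ler_pXn2r ?nnegrE ?ltW.
have D1 (x : R) (xi : L3) : `]t / 2, t * 2[%classic x -> setT xi -> derivable (ens ^~ xi) x 1.
  by move=> Ix _; have [x0 _] := pos x Ix; case: (dens x xi x0).
have I1 (x : R) : `]t / 2, t * 2[%classic x -> mu3.-integrable setT (EFin \o ens x).
  by move=> Ix; have [x0 _] := pos x Ix; exact: integrable_ens.
have der := derivable_under_integral measurableT It I1 D1 G0 iG Gub.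
have dif := differentiation_under_integral measurableT It I1 D1 G0 iG Gub.
have dI : is_derive t 1 (fun x => \int[mu3]_xi ens x xi) (-2 * \int[mu3]_xi pal t xi).
  split => //; rewrite -derive1E dif -RintegralZl//; last exact: integrable_pal.
  by apply: eq_Rintegral => xi _; exact: P1.
exact: is_deriveZ.
Qed.

(** For t > 2 r, t times the enstrophy is at most a constant times the energy drop between [r] and
    [t], and a suitable [r] makes this drop small for all later t. *)
Lemma Z_decay (e : R) : 0 < e -> exists M, forall t, M < t -> t * Z t <= e.
Proof.
move=> e0; pose En t := \int[mu3]_xi en t xi.
have En0 t : 0 <= En t by apply: Rintegral_ge0 => xi _; exact: energy_ge0.
have cd0 : 0 <= cE mu chi gamma := cE_ge0 mu0 chi0 gamma0.
have cV0 : 0 < (c^-1 : R) by rewrite invr_gt0 const3_gt0.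
(* The summand 1 keeps [k] positive, as [cE] is only known to be nonnegative here. *)
pose k := c^-1 * (cE mu chi gamma + 1).
have k0 : 0 < k by rewrite mulr_gt0// ltr_wpDl.
(* At a time where the energy nearly attains its infimum over positive times, every later drop is
   small. *)
have [r r0 rP] : exists2 r, 0 < r & forall t, r < t -> En r - En t <= e / (2 * k).
  pose S := [set En t | t in [set t : R | 0 < t]].
  have hS : has_inf S by split; [exists (En 1); exists 1 => //=|exists 0 => _ [t _ <-]; exact: En0].
  have ek0 : 0 < e / (2 * k) by rewrite divr_gt0// mulr_gt0.
  have [_ [r r0 <-] rlt] := inf_adherent ek0 hS.
  exists r => // t rt; rewrite lerBlDr addrC; apply: (le_trans (ltW rlt)).
  rewrite lerD2r; apply: ge_inf; first exact: hS.2.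
  by exists t => //=; exact: lt_trans rt.
(* Beyond 2 r one has t <= 2 (t - r). *)
exists (2 * r) => t rt.
have rt' : r < t by lra.
have t0 : 0 < t by exact: lt_trans rt'.
have h1 : (t - r) * \int[mu3]_xi ens t xi <= cE mu chi gamma * (En r - En t).
  have i1 := integrable_en r0; have i2 := integrable_en t0; have i3 := integrable_EFinB i1 i2.
  rewrite /En -RintegralB// -!RintegralZl//; last exact: integrable_ens.
  apply: le_Rintegral => //; [exact: integrable_EFinZ (integrable_ens t0)|exact: integrable_EFinZ|].
  by move=> xi _; exact: (enstrophy_le_drop mu0 chi0 gamma0 kappa0 (dA xi) (dB xi)).
have i0 : 0 <= \int[mu3]_xi ens t xi by apply: Rintegral_ge0 => xi _; exact: ens_ge0.
have h2 := rP t rt'.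
have h3 : t * \int[mu3]_xi ens t xi <= 2 * ((t - r) * \int[mu3]_xi ens t xi).
  by rewrite mulrA; apply: ler_wpM2r => //; lra.
have h4 : cE mu chi gamma * (En r - En t) <= (cE mu chi gamma + 1) * (e / (2 * k)).
  apply: (le_trans (ler_wpM2l cd0 h2)); apply: ler_wpM2r; last by rewrite lerDl.
  by apply: ltW; apply: divr_gt0 => //; exact: mulr_gt0.
rewrite /Z mulrCA.
have -> : e = c^-1 * (2 * ((cE mu chi gamma + 1) * (e / (2 * k)))).
  by rewrite /k; field; rewrite !gt_eqF ?const3_gt0// ltr_wpDl.
rewrite ler_pM2l//; lra.
Qed.

End enstrophy_identity.

Lemma littleo_inv_of_le (R : realType) (f g : R -> R) (C : R) : 0 <= C ->
  (forall t, 0 < t -> 0 <= f t <= C * g t) ->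
  (forall e : R, 0 < e -> exists M, forall t, M < t -> t * g t <= e) ->
  f =o_ at_infty (fun t => t^-1).
Proof.
move=> C0 fg gd; apply/eqoP => e e0.
(* C + 1 instead of C because C may be 0. *)
have eC : 0 < e / (C + 1) by rewrite divr_gt0// ltr_wpDl.
have [M MP] := gd _ eC.
exists (Num.max M 0); split; first exact: num_real.
move=> t; rewrite gt_max => /andP[Mt t0].
have /andP[f0 fC] := fg t t0.
rewrite (ger0_norm f0) ger0_norm ?invr_ge0 ?(ltW t0)// ler_pdivlMr//.
apply: (@le_trans _ _ (C * (t * g t))).
  by rewrite mulrCA mulrC ler_pM2l.
apply: (le_trans (ler_wpM2l C0 (MP t Mt))).
by rewrite mulrCA ler_piMr ?(ltW e0)// ler_pdivrMr ?ltr_wpDl// mul1r lerDl.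
Qed.

Theorem propositionA1 (R : realType) (mu chi gamma kappa : R)
    (u0 w0 : vfield R) (u w h : R -> vfield R) :
  0 < mu -> 0 < chi -> 0 <= gamma -> 0 <= kappa ->
  L2sigma u0 -> L2 w0 ->
  micropolar_solution mu chi gamma kappa u0 w0 u w ->
  (forall t : R, 0 < t -> leray_projection (w t) (h t)) ->
  let Omega := fun t : R => dcurl (vdist_of (u t)) in
  let E := fun t : R => vdist_of (h t) - 2^-1 *: Omega t : 'I_3 -> distr R in
  let a := (gamma * chi + mu * chi + 2 * mu * gamma) / (4 * chi ^+ 2) in
  let Y := fun t : R => fine (vdist_sqL2 (E t)) + a * fine (vdist_sqL2 (Omega t)) in
  (forall t : R, 0 < t ->
    [/\ (vdist_sqL2 (E t) < +oo)%E, (vdist_sqL2 (Omega t) < +oo)%E,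
        derivable Y t 1 &
        ((2^-1 * 'D_1 Y t)%:E
         + (4 * chi)%:E * vdist_sqL2 (E t)
         + (gamma + chi)%:E *
             tdist_sqL2 (dgrad (E t) - (mu / (2 * chi)) *: dgrad (Omega t))%R
         + (mu * gamma / (4 * chi ^+ 2) * (mu + chi))%:E *
             tdist_sqL2 (dgrad (Omega t)) = 0)%E]) /\
  [/\ (fun t => fine (vdist_sqL2 (E t))) =o_ at_infty (fun t => t^-1),
      (fun t => fine (vdist_sqL2 (Omega t))) =o_ at_infty (fun t => t^-1) &
      (fun t => fine (vsqL2 (h t))) =o_ at_infty (fun t => t^-1)].
Proof.
move=> mu0 chi0 gamma0 kappa0 _ _ sol lh Omega E a Y.
have [A [B [dA dB diva hu hw]]] := hartley_fields sol.
have sB t : 0 < t -> vsqint (B t) by move=> t0 i; case: (hw t t0 i).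
have hh t : 0 < t -> forall i, hart mu3 (@cas3 R) (@cube R) (h t i) (fun xi => crd (tproj xi (B t xi)) i).
  move=> t0 i; have := hart_leray (lh t t0) (hw t t0) i.
  congr hart; apply/funext => xi; congr (crd (tproj xi _) i).
pose ens t xi := enstrophy mu chi gamma xi (A t xi) (B t xi).
pose Z (t : R) := const3^-1 * \int[mu3]_xi ens t xi.
have vE (t : R) (t0 : 0 < t) := vdist_Ed mu0 chi0 gamma0 kappa0 dA dB hu sB hh t0.
have vO (t : R) (t0 : 0 < t) := vdist_Om mu0 chi0 gamma0 kappa0 dA dB hu sB t0.
have iZ (t : R) (t0 : 0 < t) := Rintegral_ens mu0 chi0 gamma0 kappa0 dA dB hu sB t0.
have dZ (t : R) (t0 : 0 < t) : is_derive t 1 Z _ := is_derive_Z mu0 chi0 gamma0 kappa0 dA dB diva hu sB t0.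
have Zd (e : R) (e0 : 0 < e) : exists M, forall t, M < t -> t * Z t <= e :=
  Z_decay mu0 chi0 gamma0 kappa0 dA dB hu sB e0.
have c0 : 0 < (const3^-1 : R) by rewrite invr_gt0 const3_gt0.
have a0 : 0 < a by exact: alpha_gt0.
have YZ t : 0 < t -> Y t = Z t.
  by move=> t0; rewrite /Y vE// vO//= /Z /ens iZ// mulrDr mulrCA.
have I0 (G : _ -> R3 R) : 0 <= const3^-1 * \int[mu3]_xi dot (G xi) (G xi).
  by rewrite mulr_ge0 ?(ltW c0)//; apply: Rintegral_ge0 => xi _; exact: dot_ge0.
have fE t : 0 < t -> 0 <= fine (vdist_sqL2 (E t)) by move=> t0; rewrite vE//=; exact: I0.
have fO t : 0 < t -> 0 <= fine (vdist_sqL2 (Omega t)) by move=> t0; rewrite vO//=; exact: I0.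
split=> [t t0|].
  split; [by rewrite vE// ltry|by rewrite vO// ltry| |].
    (* [Y] and [Z] are compared at positive times, which form a neighbourhood of [t]. *)
    apply: (@near_eq_derivable _ _ _ Z); last by case: (dZ t t0).
    by near=> r; rewrite YZ//; near: r; exact: lt_nbhsr.
  have -> : 'D_1 Y t = 'D_1 Z t.
    by apply: near_eq_derive; near=> r; rewrite YZ//; near: r; exact: lt_nbhsr.
  have -> := @derive_val _ _ _ _ _ _ _ (dZ t t0).
  have iP := Rintegral_pal mu0 chi0 gamma0 kappa0 dA dB diva hu sB t0.
  have -> := tdist_Ed mu0 chi0 gamma0 kappa0 dA dB diva hu sB hh t0.
  rewrite vE//.
  set IE := \int[mu3]_xi dot _ _ in iP *; set IK := \int[mu3]_xi (dot xi xi * _) in iP *.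
  have -> : mu * gamma / (4 * chi ^+ 2) * (mu + chi) = rho mu chi gamma by [].
  (* For gamma = 0 no finiteness of the last norm is available; its coefficient is 0 and the
     convention on 0 times +oo removes the term. *)
  have [g0|g0] := ltP 0 gamma.
    have -> := tdist_Om mu0 chi0 gamma0 kappa0 dA dB diva hu sB t0 g0.
    rewrite iP -!EFinM -!EFinD; congr EFin.
    by move: (rho mu chi gamma) const3^-1 (Rintegral _ _ _) @IE @IK {iP} => *; field.
  have r0 : rho mu chi gamma = 0.
    by rewrite /rho (_ : gamma = 0) ?mulr0 ?mul0r//; apply/le_anti; rewrite g0 gamma0.
  rewrite iP r0 mul0e adde0 mul0r addr0 -!EFinM -!EFinD; congr EFin.
  by move: const3^-1 @IE @IK {iP} => *; field.
have Z0 t : 0 < t -> 0 <= Z t.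
  by move=> t0; rewrite -YZ// addr_ge0 ?fE// mulr_ge0 ?fO// ltW.
split.
- apply: (@littleo_inv_of_le _ _ Z 1) => // t t0; rewrite fE// mul1r -YZ// lerDl.
  by rewrite mulr_ge0 ?fO// ltW.
- apply: (@littleo_inv_of_le _ _ Z a^-1) => [|t t0|//]; first by rewrite invr_ge0 ltW.
  by rewrite fO// mulrC ler_pdivlMr// mulrC -YZ// lerDr fE.
(* As h = E + O/2, |h|^2 <= 2 |E|^2 + |O|^2 / 2, and |O|^2 / 2 is (2 a)^-1 times a |O|^2. *)
- apply: (@littleo_inv_of_le _ _ Z (2 + (2 * a)^-1)) => [|t t0|//].
    by rewrite addr_ge0// invr_ge0 mulr_ge0// ltW.
  rewrite (vsqL2_hart (hh t t0))/= I0/=.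
  rewrite /Z mulrCA ler_pM2l//.
  have iens : mu3.-integrable setT (EFin \o ens t) := integrable_ens mu0 chi0 gamma0 kappa0 dA dB hu sB t0.
  have sh : vsqint (fun xi => tproj xi (B t xi)) by move=> i; case: (hh t t0 i).
  rewrite -RintegralZl//; apply: le_Rintegral => //.
  + exact: integrable_dotv sh.
  + exact: integrable_EFinZ.
  move=> xi _; pose O := symO xi (A t xi); pose F := symE xi (A t xi) (B t xi).
  have -> : tproj xi (B t xi) = F + 2^-1 *: O by rewrite subrK.
  have -> : ens t xi = dot F F + a * dot O O by [].
  clearbody O F.
  have h1 : 0 <= dot (F - 2^-1 *: O) (F - 2^-1 *: O) by exact: dot_ge0.
  move: h1; rewrite !(dotDl, dotDr, dotNl, dotNr, dotZl, dotZr) (dotC O F).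
  have h2 : 0 <= (2 * a)^-1 * dot F F by rewrite mulr_ge0 ?dot_ge0// invr_ge0 mulr_ge0// ltW.
  have h3 : 0 <= a * dot O O by rewrite mulr_ge0 ?dot_ge0// ltW.
  have -> : (2 + (2 * a)^-1) * (dot F F + a * dot O O) =
    2 * dot F F + (2 * a)^-1 * dot F F + 2 * (a * dot O O) + 2^-1 * dot O O.
    by field; rewrite gt_eqF.
  lra.
Unshelve. all: by end_near. Qed.
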